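(* Let $(X_n)$ be deterministic $n\times p$ matrices with SVD $X_n=U_nL_nV_n^\top$, satisfying $\limsup_n\ell_{n,1}/\ell_{n,p}<\infty$ and $\liminf_n\min_{i\in[p-1]}\ell_{n,i}/\ell_{n,i+1}>1$, and suppose $\lim_{n\to\infty}\max_{i=1,\dots,n}\|U_{i:}\|=0$, where $U_{i:}$ is the $i$-th row of $U_n$. Let $S_{m,n}$ be subsampled randomized Hadamard transform (SRHT) sketching matrices. Then as $m,n\to\infty$ with $p$ fixed, such that $m/\log^2n\to\infty$ and $\limsup\gamma_n<1$, where $\gamma_n=m/n$, for any $i\in[p]$, $$\sqrt{\frac{m}{3(1-\gamma_n)}}\;\hat\Lambda_{m,n,i}^{-1}(\hat\Lambda_{m,n,i}-\Lambda_{n,i})\Rightarrow\mathcal N(0,1),$$ and for any unit vector $c\in\mathbb R^p$ with $\limsup_{n\to\infty}(c^\top v_{n,i})^2<1$, $$\sqrt{\frac{m}{1-\gamma_n}}\Big(\sum_{k\ne i}\frac{\hat\Lambda_{m,n,i}\hat\Lambda_{m,n,k}}{(\hat\Lambda_{m,n,i}-\hat\Lambda_{m,n,k})^2}(c^\top\hat v_{m,n,k})^2\Big)^{-1/2}c^\top(\hat v_{m,n,i}-v_{n,i})\Rightarrow\mathcal N(0,1).$$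
   Context: $n=2^l$ is a power of two (without loss of generality: otherwise the data are padded with zeroes up to the smallest power of two greater than $n$). Hadamard matrices: $H_0=1$, $H_{t+1}=\frac1{\sqrt2}\begin{pmatrix}H_t&H_t\\H_t&-H_t\end{pmatrix}$. The SRHT sketching matrix is $S_{m,n}=\sqrt{n/m}\,BH_lD$, where $B$ is an $n\times n$ diagonal matrix with i.i.d. Bernoulli$(m/n)$ diagonal entries and $D$ is an independent $n\times n$ diagonal matrix with i.i.d. Rademacher ($\pm1$ with probability $1/2$) diagonal entries. SVD: $U_n$ is $n\times p$ with orthonormal columns, $L_n=\mathrm{diag}(\ell_{n,1},\dots,\ell_{n,p})$, $\ell_{n,1}\ge\dots\ge\ell_{n,p}>0$, $V_n$ is $p\times p$ orthogonal. For a symmetric $p\times p$ matrix $\Xi$, $\lambda_i(\Xi)$ is its $i$-th largest eigenvalue and $v_i(\Xi)$ an associated unit eigenvector whose first nonzero coordinate is positive. $\Lambda_{n,i}=\lambda_i(X_n^\top X_n)$, $v_{n,i}=v_i(X_n^\top X_n)$, $\hat\Lambda_{m,n,i}=\lambda_i(X_n^\top S_{m,n}^\top S_{m,n}X_n)$, $\hat v_{m,n,i}=v_i(X_n^\top S_{m,n}^\top S_{m,n}X_n)$.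
   Formalization: The eigenvector limit, false as written due to the sign convention, is proved with the estimated eigenvector replaced by plus or minus itself to have nonnegative inner product with the target, and as written only if sqrt(m) times the first coordinate of v_{n,i} tends to +infinity. *)

(* Defs.v *)
From HB Require Import structures.
From mathcomp Require Import all_boot all_order all_algebra.
From mathcomp Require Import polyrcf.
From mathcomp Require Import all_classical all_reals all_analysis.

Set Implicit Arguments.
Unset Strict Implicit.
Unset Printing Implicit Defensive.

Import Order.TTheory GRing.Theory Num.Theory.
Import numFieldNormedType.Exports.

Local Open Scope classical_set_scope.
Local Open Scope ring_scope.

Definition dotv (R : realType) (q : nat) (u w : 'cV[R]_q) : R := (u^T *m w) 0 0.

(* The Euclidean norm of a row vector; the norm [`|u|] that the library puts on
   matrices is the sup norm. *)
Definition norm2 (R : realType) (q : nat) (u : 'rV[R]_q) : R :=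
  Num.sqrt (\sum_j u 0 j ^+ 2).

(* The real eigenvalues of [A], repeated according to their multiplicity as
   roots of the characteristic polynomial, in nonincreasing order ([rootsR] is
   increasing and duplicate-free). *)
Definition eigvals (R : realType) (q : nat) (A : 'M[R]_q) : seq R :=
  flatten [seq nseq (mup x (char_poly A)) x | x <- rev (rootsR (char_poly A))].

(* The index [i] starts at 0. The default value of [nth] is never used when [A]
   is symmetric, since then [size (eigvals A) = q]. *)
Definition eigval (R : realType) (q : nat) (A : 'M[R]_q) (i : 'I_q) : R :=
  nth 0 (eigvals A) i.

Definition first_nonzero_pos (R : realType) (q : nat) (v : 'cV[R]_q) : Prop :=
  exists j : 'I_q, 0 < v j 0 /\ forall j' : 'I_q, (j' < j)%N -> v j' 0 = 0.

(* [v] selects, for every symmetric matrix, unit eigenvectors with the sign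
   convention "the first nonzero coordinate is positive". The selection is
   unique exactly where the eigenvalue is simple. *)
Definition eigvec_choice (R : realType) (q : nat)
    (v : 'M[R]_q -> 'I_q -> 'cV[R]_q) : Prop :=
  forall (A : 'M[R]_q) (i : 'I_q), A^T = A ->
    [/\ A *m v A i = eigval A i *: v A i, dotv (v A i) (v A i) = 1
      & first_nonzero_pos (v A i)].

(* The one of [w], [- w] that makes a nonobtuse angle with [v]. *)
Definition sign_align (R : realType) (q : nat) (v w : 'cV[R]_q) : 'cV[R]_q :=
  if 0 <= dotv v w then w else - w.

Lemma hadamard_dim (t : nat) : (2 ^ t + 2 ^ t = 2 ^ t.+1)%N.
Proof. by rewrite addnn -mul2n -expnS. Qed.

Fixpoint hadamard (R : realType) (t : nat) : 'M[R]_(2 ^ t) :=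
  match t with
  | 0 => 1%:M
  | t'.+1 =>
      let H := hadamard R t' in
      (Num.sqrt 2)^-1 *:
        castmx (hadamard_dim t', hadamard_dim t') (block_mx H H H (- H))
  end.

(* Mutual independence of a finite family of real random variables. *)
Definition mutual_indep (d : measure_display) (T : measurableType d)
    (R : realType) (P : probability T R) (I : finType)
    (X : I -> {RV P >-> R}) : Prop :=
  forall (J : {set I}) (A : I -> set R), (forall i, measurable (A i)) ->
    P (\bigcap_(i in [set` J]) (X i @^-1` A i)) =
    (\prod_(i in J) P (X i @^-1` A i))%E.

Definition bernoulli_rv (d : measure_display) (T : measurableType d)
    (R : realType) (P : probability T R) (X : {RV P >-> R}) (q : R) : Prop :=
  [/\ forall w, X w = 0 \/ X w = 1, P [set w | X w = 1] = q%:E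
    & P [set w | X w = 0] = (1 - q)%:E].

Definition rademacher_rv (d : measure_display) (T : measurableType d)
    (R : realType) (P : probability T R) (X : {RV P >-> R}) : Prop :=
  [/\ forall w, X w = 1 \/ X w = -1, P [set w | X w = 1] = (2^-1)%:E
    & P [set w | X w = -1] = (2^-1)%:E].

(* [b] and [e] are the diagonals of the two random matrices of the sketch. Both
   families being i.i.d. and independent of each other amounts to the mutual
   independence of the joint family. *)
Definition srht_diagonals (d : measure_display) (T : measurableType d)
    (R : realType) (P : probability T R) (n : nat) (q : R)
    (b e : 'I_n -> {RV P >-> R}) : Prop :=
  [/\ forall j, bernoulli_rv (b j) q, forall j, rademacher_rv (e j)
    & mutual_indep (fun s : 'I_n + 'I_n =>
        match s with inl j => b j | inr j => e j end)].

Definition srht (R : realType) (l m : nat) (b e : 'rV[R]_(2 ^ l)) :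
    'M[R]_(2 ^ l) :=
  Num.sqrt ((2 ^ l)%:R / m%:R) *: (diag_mx b *m hadamard R l *m diag_mx e).

(* Convergence in distribution of [Y k], a random variable on its own
   probability space, to [mu]: pointwise convergence of the distribution
   functions at the continuity points of the limit one. *)
Definition cvg_in_law (R : realType) (d : nat -> measure_display)
    (T : forall k, measurableType (d k)) (P : forall k, probability (T k) R)
    (Y : forall k, T k -> R) (mu : probability (measurableTypeR R) R) : Prop :=
  (forall k, measurable_fun [set: T k] (Y k)) /\
  forall x : R, mu [set x] = 0%E ->
    P k [set w | Y k w <= x] @[k --> \oo] --> mu [set y | y <= x].

(* Main.v *)
Require Import Defs.
From HB Require Import structures.
From mathcomp Require Import all_boot all_order all_algebra.
From mathcomp Require Import ring lra.
From mathcomp Require Import polyrcf perm.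
From mathcomp Require Import all_classical all_reals all_analysis measurable_realfun.

Set Implicit Arguments.
Unset Strict Implicit.
Unset Printing Implicit Defensive.

Import Order.TTheory GRing.Theory Num.Theory.
Import numFieldNormedType.Exports.

Local Open Scope classical_set_scope.
Local Open Scope ring_scope.

(** The sketched matrix has the Gram matrix [V *m L *m (1 + E) *m L *m V^T], where
    [E] is the error that the sketch makes on the orthonormal columns of [U]. Up
    to terms of second order in [E], the statistics of the theorem are values of
    the bilinear form of [E], and such a value satisfies a central limit theorem.

    The central limit theorem. At coefficient vectors [a] and [b] the form is a
    sum over the rows of the Hadamard transform: the product [y j * z j] of two
    entries of the transformed vectors [U a] and [U b], whose coordinates carry
    random signs, is weighted by an independent centered sampling variable
    ([gram_srht]). Given the signs this is a weighted sum of independent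
    variables. Its variance is the empirical second moment of the products, which
    polarization reduces to empirical fourth moments of transformed vectors. When
    the rows of [U] are small, the fourth moments have nearly the Gaussian value 3,
    and by the inequality of Efron and Stein they concentrate ([Ex_quart_dist]).
    So the variance is close to [(1 - gamma) / m * (1 + 2 * r ^+ 2)] for unit
    vectors of scalar product [r]. Stein's identity for the standardized sum
    follows by swapping one sampling variable at a time, with an error of order
    [1 / sqrt m] coming from the third moments ([stein_gram]). The solution of
    Stein's equation for a continuous approximation of the indicator of a
    half-line turns it into the convergence of the distribution functions, and
    this convergence is insensitive to remainders that vanish in probability
    ([cdf_limit]).

    The expansions. The singular values have bounded ratios and are separated by a
    factor. The characteristic polynomial therefore changes sign across disjoint
    intervals around the unperturbed eigenvalues as soon as [E] is small, which
    locates all the eigenvalues ([eigval_scaled_gram]). The eigenvector equation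
    then gives, uniformly in the data, a relative deviation [E i i] of the [i]-th
    eigenvalue and a coordinate of the [i]-th eigenvector on the [j]-th one that
    is a bounded multiple of [E j i], both up to a remainder of the order of the
    square of [E] ([O_eigval], [O_eigvec]). Since [E] is of order [1 / sqrt m] in
    mean square ([Ex_err_norm_sqr]), the remainders vanish after multiplication by
    [sqrt m] ([remainder_vanishes]).

    The eigenvalue thus leads to the form at a pair of equal unit vectors, with
    [r = 1] and variance factor 3 ([eigval_cdf]). The eigenvector leads to the
    form at two orthogonal vectors, with [r = 0]; the denominator of the statistic
    estimates the norm of one of them, which is bounded away from zero because the
    direction [c] keeps away from the target ([studentized_cdf]). The expansions
    hold for the estimated eigenvector aligned with the target. When the first
    coordinate of the target is large compared with [1 / sqrt m], the sign
    convention and the alignment agree with probability tending to one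
    ([sign_resolved]).

    The random diagonals enter through finitely many configurations, so all
    probabilities are finite sums against a product weight ([prob_signs_in]). *)

(** * Finite product measures on boolean configurations *)

Section FiniteProduct.
Variables (R : realType) (I : finType) (q : I -> R).
Hypothesis q01 : forall i, 0 <= q i <= 1.
Implicit Types (F G : {ffun I -> bool} -> R) (s : {ffun I -> bool}).

Definition bwt (i : I) (c : bool) : R := if c then q i else 1 - q i.

Definition wt s : R := \prod_i bwt i (s i).

Definition Ex F : R := \sum_s wt s * F s.

Lemma bwt_ge0 i c : 0 <= bwt i c.
Proof. by rewrite /bwt; have /andP[h1 h2] := q01 i; case: c; lra. Qed.

Lemma wt_ge0 s : 0 <= wt s.
Proof. by apply: prodr_ge0 => i _; exact: bwt_ge0. Qed.

Lemma sum_wt : \sum_s wt s = 1.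
Proof.
rewrite /wt -(bigA_distr_bigA (fun i c => bwt i c)) big1 // => i _.
by rewrite big_bool /bwt /=; ring.
Qed.

Lemma eq_Ex F G : F =1 G -> Ex F = Ex G.
Proof. by move=> FG; apply: eq_bigr => s _; rewrite FG. Qed.

Lemma ExD F G : Ex (fun s => F s + G s) = Ex F + Ex G.
Proof. by rewrite -big_split; apply: eq_bigr => s _; rewrite mulrDr. Qed.

Lemma ExZ c F : Ex (fun s => c * F s) = c * Ex F.
Proof. by rewrite mulr_sumr; apply: eq_bigr => s _; ring. Qed.

Lemma ExB F G : Ex (fun s => F s - G s) = Ex F - Ex G.
Proof. by rewrite /Ex -sumrB; apply: eq_bigr => s _; rewrite mulrBr. Qed.

Lemma Ex_cst c : Ex (fun=> c) = c.
Proof. by rewrite /Ex -mulr_suml sum_wt mul1r. Qed.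

Lemma Ex_sum (J : Type) (r : seq J) (F : J -> {ffun I -> bool} -> R) :
  Ex (fun s => \sum_(j <- r) F j s) = \sum_(j <- r) Ex (F j).
Proof. by rewrite exchange_big; apply: eq_bigr => s _; rewrite mulr_sumr. Qed.

Lemma le_Ex F G : (forall s, F s <= G s) -> Ex F <= Ex G.
Proof. by move=> FG; apply: ler_sum => s _; exact: ler_wpM2l (wt_ge0 s) _ _ (FG s). Qed.

Lemma Ex_ge0 F : (forall s, 0 <= F s) -> 0 <= Ex F.
Proof. by move=> F0; apply: sumr_ge0 => s _; rewrite mulr_ge0 ?wt_ge0. Qed.

Lemma ler_norm_Ex F : `|Ex F| <= Ex (fun s => `|F s|).
Proof.
apply: le_trans (ler_norm_sum _ _ _) _; apply: ler_sum => s _.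
by rewrite normrM ger0_norm ?wt_ge0.
Qed.

Lemma Ex_sqr_center F c :
  Ex (fun s => (F s - c) ^+ 2) = Ex (fun s => F s ^+ 2) - c *+ 2 * Ex F + c ^+ 2.
Proof.
rewrite -[in RHS](Ex_cst (c ^+ 2)) -ExZ -ExB -ExD.
by apply: eq_Ex => s; ring.
Qed.

(** Cauchy-Schwarz, through the variance of [`|F|]. *)
Lemma Ex_norm_sqr F : Ex (fun s => `|F s|) ^+ 2 <= Ex (fun s => F s ^+ 2).
Proof.
set c := Ex (fun s => `|F s|).
have : 0 <= Ex (fun s => (`|F s| - c) ^+ 2) by apply: Ex_ge0 => s; exact: sqr_ge0.
rewrite Ex_sqr_center -/c; under eq_Ex => s do rewrite real_normK ?num_real //.
by rewrite expr2; lra.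
Qed.

Definition upd s i (c : bool) : {ffun I -> bool} :=
  [ffun j => if j == i then c else s j].

(** Drawing a fresh value for the coordinate [i] and averaging over it. *)
Definition resample i F s : R := q i * F (upd s i true) + (1 - q i) * F (upd s i false).

Lemma upd_eq s i c : upd s i c i = c.
Proof. by rewrite ffunE eqxx. Qed.

Lemma upd_neq s i c j : j != i -> upd s i c j = s j.
Proof. by rewrite ffunE => /negbTE ->. Qed.

Lemma upd_upd s i c c' : upd (upd s i c) i c' = upd s i c'.
Proof. by apply/ffunP => j; rewrite !ffunE; case: eqP. Qed.

Lemma upd_id s i : upd s i (s i) = s.
Proof. by apply/ffunP => j; rewrite ffunE; case: eqP => [->|]. Qed.

Lemma updC s i j c c' : i != j -> upd (upd s i c) j c' = upd (upd s j c') i c.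
Proof.
move=> ij; apply/ffunP => k; rewrite !ffunE; case: (eqVneq k j) => // ->.
by rewrite eq_sym (negbTE ij).
Qed.

(** Drawing one coordinate afresh does not change the law of the configuration:
    exchanging the old and the new value of that coordinate is an involution
    that preserves the joint weight. *)
Lemma Ex_resample i F : Ex F = Ex (resample i F).
Proof.
pose rest s := \prod_(j | j != i) bwt j (s j).
have wtE s : wt s = bwt i (s i) * rest s by rewrite /wt (bigD1 i).
have restU s c : rest (upd s i c) = rest s.
  by apply: eq_bigr => j ji; rewrite upd_neq.
have -> : Ex (resample i F) =
  \sum_(u : {ffun I -> bool} * bool)
     bwt i (u.1 i) * bwt i u.2 * rest u.1 * F (upd u.1 i u.2).
  rewrite -(pair_big xpredT xpredT (fun s c =>
    bwt i (s i) * bwt i c * rest s * F (upd s i c)))/=.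
  by apply: eq_bigr => s _; rewrite big_bool wtE /resample /bwt /=; ring.
pose sw (u : {ffun I -> bool} * bool) := (upd u.1 i u.2, u.1 i).
have swK : involutive sw.
  by move=> [s c]; rewrite /sw /= upd_upd upd_id upd_eq.
rewrite (reindex_inj (can_inj swK)) /=.
under eq_bigr => u _ do rewrite upd_upd upd_id restU upd_eq.
rewrite -(pair_big xpredT xpredT (fun s c =>
    bwt i c * bwt i (s i) * rest s * F s))/=.
by apply: eq_bigr => s _; rewrite big_bool wtE /bwt /=; ring.
Qed.

Lemma resample_idem i F s c : resample i F (upd s i c) = resample i F s.
Proof. by rewrite /resample !upd_upd. Qed.

Lemma resampleC i j F s : resample i (resample j F) s = resample j (resample i F) s.
Proof.
have [->//|ij] := eqVneq i j.
by rewrite /resample ![upd (upd s i _) j _]updC //; ring.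
Qed.

Definition avg_out (r : seq I) F := foldr resample F r.

Lemma avg_out_upd r F i c s : i \in r -> avg_out r F (upd s i c) = avg_out r F s.
Proof.
elim: r s => //= j r IH s; rewrite inE => /orP[/eqP->|ir]; first exact: resample_idem.
have [->|ij] := eqVneq i j; first exact: resample_idem.
by rewrite /resample ![upd (upd s i c) j _]updC // !IH.
Qed.

(** After all coordinates have been averaged out, nothing is left to depend on:
    overwriting them one by one turns any configuration into any other. *)
Lemma avg_out_all F : forall s s', avg_out (enum I) F s = avg_out (enum I) F s'.
Proof.
have H r s s' : avg_out (enum I) F s =
    avg_out (enum I) F (foldr (fun i u => upd u i (s' i)) s r).
  by elim: r => //= i r IH; rewrite avg_out_upd // mem_enum.
move=> s s'; rewrite (H (enum I) s s'); congr (avg_out _ _ _).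
apply/ffunP => j.
have : j \in enum I by rewrite mem_enum.
elim: (enum I) => //= i r IH; rewrite inE ffunE; case: eqVneq => [->//|_] /=.
exact: IH.
Qed.

Lemma avg_out_resample i r F s : avg_out r (resample i F) s = resample i (avg_out r F) s.
Proof.
elim: r s => //= j r IH s; rewrite resampleC /resample.
by congr (_ * _ + _ * _); rewrite !IH.
Qed.

Lemma avg_outB r F G s : avg_out r (fun u => F u - G u) s = avg_out r F s - avg_out r G s.
Proof. by elim: r s => //= j r IH s; rewrite /resample !IH; ring. Qed.

Lemma Ex_avg_out r F : Ex (avg_out r F) = Ex F.
Proof. by elim: r => //= i r IH; rewrite -Ex_resample. Qed.

Lemma resample_sqr i F s : resample i F s ^+ 2 <= resample i (fun u => F u ^+ 2) s.
Proof.
rewrite /resample; set a := F _; set c := F _.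
have /andP[h1 h2] := q01 i; rewrite -subr_ge0.
have -> : q i * a ^+ 2 + (1 - q i) * c ^+ 2 - (q i * a + (1 - q i) * c) ^+ 2 =
  q i * (1 - q i) * (a - c) ^+ 2 by ring.
by rewrite mulr_ge0 ?sqr_ge0 // mulr_ge0 // subr_ge0.
Qed.

Lemma Ex_avg_out_sqr r F : Ex (fun s => avg_out r F s ^+ 2) <= Ex (fun s => F s ^+ 2).
Proof.
elim: r => //= i r IH; apply: le_trans IH.
rewrite [leRHS](Ex_resample i); apply: le_Ex => s; exact: resample_sqr.
Qed.

Lemma Ex_sqr_resample i F :
  Ex (fun s => F s ^+ 2) - Ex (fun s => resample i F s ^+ 2)
  = Ex (fun s => (F s - resample i F s) ^+ 2).
Proof.
rewrite -ExB [LHS](Ex_resample i) [RHS](Ex_resample i); apply: eq_Ex => s.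
by rewrite /resample !upd_upd; ring.
Qed.

(** The Efron-Stein inequality: averaging out the coordinates one after the
    other splits the variance into orthogonal increments, and each increment is
    an average of [F - resample i F]. *)
Lemma Efron_Stein F :
  Ex (fun s => (F s - Ex F) ^+ 2)
  <= \sum_i Ex (fun s => (F s - resample i F s) ^+ 2).
Proof.
have H r : uniq r -> Ex (fun s => F s ^+ 2) - Ex (fun s => avg_out r F s ^+ 2)
    <= \sum_(i <- r) Ex (fun s => (F s - resample i F s) ^+ 2).
  elim: r => [|i r IH]; first by rewrite big_nil subrr.
  move=> /= /andP[ir /IH {}IH]; rewrite big_cons addrC.
  rewrite -(subrK (Ex (fun s => avg_out r F s ^+ 2)) (Ex (fun s => F s ^+ 2))).
  rewrite addrC -addrA addrC lerD // Ex_sqr_resample.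
  under eq_Ex => s do rewrite -avg_out_resample -avg_outB.
  exact: Ex_avg_out_sqr.
have /H := enum_uniq I.
have cst s : avg_out (enum I) F s = Ex F.
  rewrite -(Ex_avg_out (enum I)) -[LHS]Ex_cst.
  by apply: eq_Ex => u; exact: avg_out_all.
under [X in _ - X]eq_Ex => s do rewrite cst.
rewrite Ex_cst big_enum /=; apply: le_trans.
by rewrite Ex_sqr_center expr2; lra.
Qed.

End FiniteProduct.

(** * Moments of random sign combinations and of their fourth powers *)

Section Rademacher.
Variables (R : realType) (n : nat) (g : R).
Hypothesis g01 : 0 <= g <= 1.

(** The configurations list the sampling variables on the left and the signs on
    the right. *)
Definition qs (u : 'I_n + 'I_n) : R := if u is inl _ then g else 2^-1.

Lemma qs01 u : 0 <= qs u <= 1.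
Proof. by case: u => _ //=; apply/andP; split; lra. Qed.

Implicit Types (s : {ffun 'I_n + 'I_n -> bool}) (al : 'I_n -> R).

Local Notation E := (Ex qs).

Definition sgn s (i : 'I_n) : R := if s (inr i) then 1 else -1.

Lemma sgn_sqr s i : sgn s i ^+ 2 = 1.
Proof. by rewrite /sgn; case: ifP; rewrite ?expr1n // sqrrN expr1n. Qed.

Definition rsum (r : seq 'I_n) al s : R := \sum_(i <- r) al i * sgn s i.

Lemma rsum_upd r al s i c : i \notin r -> rsum r al (upd s (inr i) c) = rsum r al s.
Proof.
move=> ir; apply: eq_big_seq => j jr; rewrite /sgn upd_neq //.
by apply: contra ir => /eqP[<-].
Qed.

(** Conditioning on the remaining signs; the moments of order two, four and six
    follow by induction on the list of signs. *)
Lemma Ex_rsum_cons (f : R -> R) r al i : i \notin r ->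
  E (fun s => f (rsum (i :: r) al s)) =
  E (fun s => 2^-1 * (f (rsum r al s + al i) + f (rsum r al s - al i))).
Proof.
move=> ir; rewrite (Ex_resample _ (inr i)); apply: eq_Ex => s.
rewrite /resample /= /rsum !big_cons -!/(rsum _ _ _).
do 2 rewrite rsum_upd //.
rewrite /sgn !upd_eq mulr1 mulrN1 ![_ + rsum _ _ _]addrC.
by field.
Qed.

Lemma Ex_rsum2 r al : uniq r ->
  E (fun s => rsum r al s ^+ 2) = \sum_(i <- r) al i ^+ 2.
Proof.
elim: r => [_|i r IH /= /andP[ir ur]].
  rewrite big_nil -[RHS](Ex_cst qs); apply: eq_Ex => s.
  by rewrite /rsum big_nil expr0n.
rewrite (Ex_rsum_cons (fun x => x ^+ 2)) //.
rewrite big_cons -IH // -[X in _ = X + _](Ex_cst qs) -ExD; apply: eq_Ex => s.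
by field.
Qed.

Lemma Ex_rsum4 r al : uniq r ->
  E (fun s => rsum r al s ^+ 4) =
  3 * (\sum_(i <- r) al i ^+ 2) ^+ 2 - 2 * \sum_(i <- r) al i ^+ 4.
Proof.
elim: r => [_|i r IH /= /andP[ir ur]].
  rewrite !big_nil -[RHS](Ex_cst qs); apply: eq_Ex => s.
  by rewrite /rsum big_nil !expr0n /=; ring.
rewrite (Ex_rsum_cons (fun x => x ^+ 4)) //.
rewrite !big_cons.
transitivity (E (fun s => rsum r al s ^+ 4) + 6 * al i ^+ 2 * E (fun s => rsum r al s ^+ 2)
   + al i ^+ 4).
  by rewrite -[X in _ = _ + X](Ex_cst qs) -ExZ -!ExD; apply: eq_Ex => s; field.
by rewrite IH // Ex_rsum2 //; ring.
Qed.

Lemma Ex_rsum6 r al : uniq r ->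
  E (fun s => rsum r al s ^+ 6) <= 15 * (\sum_(i <- r) al i ^+ 2) ^+ 3.
Proof.
elim: r => [_|i r IH /= /andP[ir ur]].
  rewrite !big_nil expr0n mulr0 -[leRHS](Ex_cst qs); apply: le_Ex => [|s]; first exact: qs01.
  by rewrite /rsum big_nil !expr0n.
rewrite (Ex_rsum_cons (fun x => x ^+ 6)) //.
rewrite !big_cons.
have -> : E (fun s => 2^-1 * ((rsum r al s + al i) ^+ 6 + (rsum r al s - al i) ^+ 6)) =
   E (fun s => rsum r al s ^+ 6) + 15 * al i ^+ 2 * E (fun s => rsum r al s ^+ 4)
   + 15 * al i ^+ 4 * E (fun s => rsum r al s ^+ 2) + al i ^+ 6.
  by rewrite -[X in _ = _ + X](Ex_cst qs) -!ExZ -!ExD; apply: eq_Ex => s; field.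
have {}IH := IH ur.
rewrite Ex_rsum4 // Ex_rsum2 //; set A := \sum_(_ <- _) _; set A4 := \sum_(_ <- _) _.
have A4_ge0 : 0 <= A4 by apply: sumr_ge0 => j _; rewrite -[4%N]/(2 * 2)%N exprM sqr_ge0.
have h1 : 0 <= al i ^+ 2 * A4 by rewrite mulr_ge0 ?sqr_ge0.
have h2 : 0 <= al i ^+ 6 by rewrite -[6%N]/(2 * 3)%N exprM exprn_ge0 ?sqr_ge0.
have h3 : 0 <= al i ^+ 4 * A.
  by rewrite mulr_ge0 ?sumr_ge0 // => [|j _]; rewrite ?sqr_ge0 // -[4%N]/(2 * 2)%N exprM sqr_ge0.
rewrite -/A in IH; apply: le_trans (_ : 15 * A ^+ 3 + 15 * al i ^+ 2 * (3 * A ^+ 2 - 2 * A4) + 15 * al i ^+ 4 * A + al i ^+ 6 <= _).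
  by rewrite !lerD.
rewrite -subr_ge0.
have -> : 15 * (al i ^+ 2 + A) ^+ 3 - (15 * A ^+ 3 + 15 * al i ^+ 2 * (3 * A ^+ 2 - 2 * A4) + 15 * al i ^+ 4 * A + al i ^+ 6) =
  30 * (al i ^+ 2 * A4) + 30 * (al i ^+ 4 * A) + 14 * al i ^+ 6 by ring.
by rewrite !addr_ge0 // mulr_ge0.
Qed.

(** [h] is a matrix with entries of modulus one and orthogonal rows and columns,
    that is, a Hadamard matrix before normalization. *)
Variable h : 'M[R]_n.
Hypothesis h2 : forall j i, h j i ^+ 2 = 1.
Hypothesis hrow : forall j j', \sum_i h j i * h j' i = n%:R * (j == j')%:R.
Hypothesis hcol : forall i i', \sum_j h j i * h j i' = n%:R * (i == i')%:R.

(** The transformed vector, its coordinates carrying random signs; the entries of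
    [h] having modulus one, they do not change the moments of its entries. *)
Definition lin al (j : 'I_n) s : R := \sum_i h j i * al i * sgn s i.

Lemma sum_hal al j : \sum_i (h j i * al i) ^+ 2 = \sum_i al i ^+ 2.
Proof. by apply: eq_bigr => i _; rewrite exprMn h2 mul1r. Qed.

Lemma Ex_lin4 al j :
  E (fun s => lin al j s ^+ 4) = 3 * (\sum_i al i ^+ 2) ^+ 2 - 2 * \sum_i al i ^+ 4.
Proof.
rewrite [LHS]Ex_rsum4 ?index_enum_uniq // sum_hal; congr (_ - 2 * _).
by apply: eq_bigr => i _; rewrite exprMn -[4%N]/(2 * 2)%N exprM h2 expr1n mul1r.
Qed.

Lemma Ex_lin6 al j : E (fun s => lin al j s ^+ 6) <= 15 * (\sum_i al i ^+ 2) ^+ 3.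
Proof. by rewrite -(sum_hal al j); apply: Ex_rsum6; exact: index_enum_uniq. Qed.

Lemma linD al al' j s : lin (fun i => al i + al' i) j s = lin al j s + lin al' j s.
Proof. by rewrite -big_split; apply: eq_bigr => i _ /=; ring. Qed.

Lemma linB al al' j s : lin (fun i => al i - al' i) j s = lin al j s - lin al' j s.
Proof. by rewrite -sumrB; apply: eq_bigr => i _ /=; ring. Qed.

Lemma sum_h_lin al i s : \sum_j h j i * lin al j s = n%:R * (al i * sgn s i).
Proof.
under eq_bigr => j _ do rewrite mulr_sumr.
rewrite exchange_big (bigD1 i) //= [X in _ + X]big1 => [|i' i'i].
  rewrite addr0; under eq_bigr => j _ do rewrite mulrA mulrA -expr2 -mulrA.
  under eq_bigr => j _ do rewrite h2 mul1r.
  by rewrite sumr_const card_ord mulr_natl.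
under eq_bigr => j _ do rewrite mulrA mulrA -mulrA.
by rewrite -mulr_suml hcol eq_sym (negbTE i'i) mulr0 mul0r.
Qed.

Lemma sum_lin_lin al al' s :
  \sum_j lin al j s * lin al' j s = n%:R * \sum_i al i * al' i.
Proof.
under eq_bigr => j _ do rewrite mulr_suml.
rewrite exchange_big mulr_sumr; apply: eq_bigr => i _ /=.
transitivity (al i * sgn s i * \sum_j h j i * lin al' j s).
  by rewrite mulr_sumr; apply: eq_bigr => j _; ring.
rewrite sum_h_lin; have e2 := sgn_sqr s i; ring: e2.
Qed.

Lemma Bessel (x : 'I_n -> R) : \sum_i (\sum_j h j i * x j) ^+ 2 = n%:R * \sum_j x j ^+ 2.
Proof.
transitivity (\sum_i \sum_j \sum_j' (h j i * h j' i) * (x j * x j')).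
  apply: eq_bigr => i _; rewrite expr2 mulr_suml; apply: eq_bigr => j _.
  by rewrite mulr_sumr; apply: eq_bigr => j' _; ring.
rewrite exchange_big mulr_sumr; apply: eq_bigr => j _ /=.
rewrite exchange_big (bigD1 j) //= [X in _ + X]big1 => [|j' j'j].
  by rewrite -mulr_suml hrow eqxx addr0 mulr1; ring.
by rewrite -mulr_suml hrow eq_sym (negbTE j'j) mulr0 mul0r.
Qed.

(** The empirical fourth moment of the entries of the transformed vector. *)
Definition quart al s : R := n%:R^-1 * \sum_j lin al j s ^+ 4.

Lemma lin_upd_inl al j s i c : lin al j (upd s (inl i) c) = lin al j s.
Proof. by apply: eq_bigr => k _; rewrite /sgn upd_neq. Qed.

Lemma lin_flip al j s i :
  lin al j (upd s (inr i) (~~ s (inr i))) = lin al j s - 2 * (h j i * al i * sgn s i).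
Proof.
rewrite /lin [in LHS](bigD1 i) //= [in RHS](bigD1 i) //=.
have -> : \sum_(k | k != i) h j k * al k * sgn (upd s (inr i) (~~ s (inr i))) k =
   \sum_(k | k != i) h j k * al k * sgn s k.
  by apply: eq_bigr => k ki; rewrite /sgn upd_neq.
by rewrite /sgn upd_eq; case: (s _) => /=; ring.
Qed.

Lemma resample_half (F : {ffun 'I_n + 'I_n -> bool} -> R) i s :
  F s - resample qs (inr i) F s = 2^-1 * (F s - F (upd s (inr i) (~~ s (inr i)))).
Proof.
by rewrite /resample /= -{1 4}(upd_id s (inr i)); case: (s _) => /=; field.
Qed.

(** Flipping one sign changes the fourth powers by a polynomial in the entries.
    Orthogonality makes the sums over the rows explicit, except for the
    correlation of a column with the cubes. *)
Lemma quart_diff al i s : (0 < n)%N ->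
  quart al s - resample qs (inr i) (quart al) s =
  4 * al i * sgn s i * (n%:R^-1 * \sum_j h j i * lin al j s ^+ 3)
  - 12 * al i ^+ 2 * (\sum_k al k ^+ 2) + 8 * al i ^+ 4.
Proof.
move=> n0; have n0R : (n%:R : R) != 0 by rewrite pnatr_eq0 -lt0n.
rewrite resample_half /quart -mulrBr -sumrB.
under eq_bigr => j _ do rewrite lin_flip.
have -> : \sum_j (lin al j s ^+ 4 - (lin al j s - 2 * (h j i * al i * sgn s i)) ^+ 4) =
  \sum_j ((8 * al i * sgn s i) * (h j i * lin al j s ^+ 3)
   - (24 * al i ^+ 2) * (lin al j s * lin al j s)
   + (32 * al i ^+ 3 * sgn s i) * (h j i * lin al j s) - 16 * al i ^+ 4).
  apply: eq_bigr => j _.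
  have e1 : h j i * h j i = 1 by rewrite -expr2 h2.
  have e2 : sgn s i * sgn s i = 1 by rewrite -expr2 sgn_sqr.
  ring: e1 e2.
rewrite !(sumrB, big_split) /= -!mulr_sumr sum_lin_lin sum_h_lin sumr_const card_ord.
under [\sum_i0 al i0 * al i0]eq_bigr => k _ do rewrite -expr2.
have e2 : sgn s i ^+ 2 = 1 by exact: sgn_sqr.
rewrite -[al i *+ n]mulr_natl.
field: e2.
exact: n0R.
Qed.

(** The empirical fourth moment concentrates: by the inequality of Efron and
    Stein, its variance is controlled by the influence of the single signs, and
    the sum over the signs of the squared correlations with the cubes is
    evaluated by orthogonality. *)
Lemma quart_var al M : (0 < n)%N ->
  (forall i, al i ^+ 2 <= M) ->
  E (fun s => (quart al s - E (quart al)) ^+ 2) <= (42 * 32) * M * (\sum_i al i ^+ 2) ^+ 3.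
Proof.
(* The constant is [48 * 15 + 624], with 15 the sixth Gaussian moment. *)
move=> n0 alM; set A := \sum_i _.
have n0R : (n%:R : R) != 0 by rewrite pnatr_eq0 -lt0n.
have A0 : 0 <= A by apply: sumr_ge0 => i _; exact: sqr_ge0.
have alA i : al i ^+ 2 <= A.
  by rewrite /A (bigD1 i) //= lerDl sumr_ge0 // => k _; exact: sqr_ge0.
have M0 : 0 <= M by apply: le_trans (alM (Ordinal n0)); exact: sqr_ge0.
apply: le_trans (Efron_Stein qs01 _) _; rewrite big_sumType /=.
rewrite [X in X + _]big1 ?add0r => [|i _]; last first.
  rewrite -[RHS](Ex_cst qs 0); apply: eq_Ex => s; rewrite /resample /quart.
  do 2 under [\sum_j lin _ _ (upd _ _ _) ^+ 4]eq_bigr => j _ do rewrite lin_upd_inl.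
  by rewrite /=; ring.
pose B i s := n%:R^-1 * \sum_j h j i * lin al j s ^+ 3.
have bd i s : (quart al s - resample qs (inr i) (quart al) s) ^+ 2 <=
   48 * M * B i s ^+ 2 + 624 * M * A ^+ 2 * al i ^+ 2.
  rewrite quart_diff // -/(B i s) -/A.
  have sq3 (x y z : R) : (x - y + z) ^+ 2 <= 3 * (x ^+ 2 + y ^+ 2 + z ^+ 2).
    rewrite -subr_ge0.
    have -> : 3 * (x ^+ 2 + y ^+ 2 + z ^+ 2) - (x - y + z) ^+ 2 =
      (x + y) ^+ 2 + (x - z) ^+ 2 + (y + z) ^+ 2 by ring.
    by rewrite !addr_ge0 ?sqr_ge0.
  apply: le_trans (sq3 _ _ _) _.
  have -> : (4 * al i * sgn s i * B i s) ^+ 2 = 16 * (al i ^+ 2 * B i s ^+ 2).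
    by rewrite !exprMn sgn_sqr; ring.
  have e1 : al i ^+ 2 * B i s ^+ 2 <= M * B i s ^+ 2.
    by rewrite ler_wpM2r ?sqr_ge0.
  have e2 : al i ^+ 2 * (al i ^+ 2 * A ^+ 2) <= M * (al i ^+ 2 * A ^+ 2).
    by rewrite ler_wpM2r // mulr_ge0 ?sqr_ge0.
  have e3 : al i ^+ 4 <= A ^+ 2.
    by rewrite -[4%N]/(2 * 2)%N exprM lerXn2r ?nnegrE ?sqr_ge0.
  have e4 : al i ^+ 2 * al i ^+ 4 * al i ^+ 2 <= M * A ^+ 2 * al i ^+ 2.
    rewrite ler_wpM2r ?sqr_ge0 // ler_pM ?sqr_ge0 //.
    by rewrite -[4%N]/(2 * 2)%N exprM sqr_ge0.
  have -> : (12 * al i ^+ 2 * A) ^+ 2 = 144 * (al i ^+ 2 * (al i ^+ 2 * A ^+ 2)) by ring.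
  have -> : (8 * al i ^+ 4) ^+ 2 = 64 * (al i ^+ 2 * al i ^+ 4 * al i ^+ 2) by ring.
  have -> : 624 * M * A ^+ 2 * al i ^+ 2 = 432 * (M * (al i ^+ 2 * A ^+ 2)) +
    192 * (M * A ^+ 2 * al i ^+ 2) by ring.
  lra.
apply: le_trans (_ : \sum_i E (fun s => 48 * M * B i s ^+ 2 + 624 * M * A ^+ 2 * al i ^+ 2) <= _).
  by apply: ler_sum => i _; apply: le_Ex => [|s]; [exact: qs01|exact: bd].
under eq_bigr => i _ do rewrite ExD ExZ Ex_cst.
rewrite big_split /= -!mulr_sumr -/A -Ex_sum.
have -> : E (fun s => \sum_i B i s ^+ 2) = E (fun s => n%:R^-1 * \sum_j lin al j s ^+ 6).
  apply: eq_Ex => s; rewrite /B.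
  under eq_bigr => i _ do rewrite exprMn.
  rewrite -mulr_sumr Bessel mulrA; congr (_ * _); first by field.
  by apply: eq_bigr => j _; rewrite -exprM.
rewrite ExZ Ex_sum.
have : n%:R^-1 * \sum_j E (fun s => lin al j s ^+ 6) <= 15 * A ^+ 3.
  rewrite ler_pdivrMl ?ltr0n //; apply: le_trans (ler_sum _ (fun j _ => Ex_lin6 al j)) _.
  by rewrite sumr_const card_ord -[leLHS]mulr_natl.
move=> /(ler_wpM2l (_ : 0 <= 48 * M)) => /(_ ltac:(by rewrite mulr_ge0)).
set X := n%:R^-1 * _; move=> H.
have -> : (42 * 32) * M * A ^+ 3 = 48 * M * (15 * A ^+ 3) + 624 * M * A ^+ 2 * A by ring.
by rewrite lerD2r.
Qed.

(** The limit 3 is the fourth Gaussian moment; the exact mean falls short of it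
    by the sum of the fourth powers, negligible for small coefficients. *)
Lemma Ex_quart_dist al M : (0 < n)%N ->
  (forall i, al i ^+ 2 <= M) ->
  E (fun s => `|quart al s - 3 * (\sum_i al i ^+ 2) ^+ 2|) <=
  Num.sqrt ((42 * 32) * M * (\sum_i al i ^+ 2) ^+ 3) + 2 * M * \sum_i al i ^+ 2.
Proof.
move=> n0 alM; set A := \sum_i _.
have n0R : (n%:R : R) != 0 by rewrite pnatr_eq0 -lt0n.
have M0 : 0 <= M by apply: le_trans (alM (Ordinal n0)); exact: sqr_ge0.
have EQ : E (quart al) = 3 * A ^+ 2 - 2 * \sum_i al i ^+ 4.
  rewrite /quart ExZ Ex_sum; under eq_bigr => j _ do rewrite Ex_lin4.
  by rewrite sumr_const card_ord -[X in _ * X]mulr_natl mulKf.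
apply: le_trans (_ : E (fun s => `|quart al s - E (quart al)| + 2 * \sum_i al i ^+ 4) <= _).
  apply: le_Ex => [|s]; first exact: qs01.
  have -> : quart al s - 3 * A ^+ 2 = (quart al s - E (quart al)) - 2 * \sum_i al i ^+ 4.
    by rewrite EQ; ring.
  apply: le_trans (ler_normB _ _) _; rewrite lerD2l ger0_norm // mulr_ge0 //.
  by apply: sumr_ge0 => i _; rewrite -[4%N]/(2 * 2)%N exprM sqr_ge0.
rewrite ExD Ex_cst; apply: lerD.
  rewrite -[leLHS]ger0_norm; last by apply: Ex_ge0 => //; exact: qs01.
  rewrite -sqrtr_sqr ler_sqrt; last first.
    apply: mulr_ge0; first by do ![apply: mulr_ge0]; rewrite ?ler0n.
    by rewrite exprn_ge0 // sumr_ge0 // => i _; exact: sqr_ge0.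
  by apply: le_trans (Ex_norm_sqr qs01 _) _; exact: quart_var.
rewrite -mulrA ler_wpM2l // mulr_sumr; apply: ler_sum => i _.
by rewrite -[4%N]/(2 + 2)%N exprD ler_wpM2r ?sqr_ge0.
Qed.

End Rademacher.

(** * Stein's method for weighted sums of centered Bernoulli variables *)

Lemma MVT_dist (R : realType) (f df : R -> R) (x y : R) :
  (forall z : R, is_derive z 1 f (df z)) ->
  exists2 c, f y - f x = df c * (y - x) & `|c - x| <= `|y - x|.
Proof.
move=> fdf; have cf a b : {within `[a, b], continuous f}.
  by apply: derivable_within_continuous => z _; case: (fdf z).
have [xy|yx|->] := ltgtP x y; last by exists y; rewrite ?subrr ?mulr0 // lexx.
- have [c + ->] := @MVT _ f df x y xy (fun z _ => fdf z) (cf _ _).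
  rewrite in_itv /= => /andP[h1 h2]; exists c => //.
  by rewrite !ger0_norm ?subr_ge0 ?(ltW xy) ?(ltW h1) // lerD2r ltW.
- have [c + e] := @MVT _ f df y x yx (fun z _ => fdf z) (cf _ _).
  rewrite in_itv /= => /andP[h1 h2]; exists c.
    by rewrite -opprB e; ring.
  by rewrite ![`|_ - x|]distrC !ger0_norm ?subr_ge0 ?(ltW yx) ?(ltW h2) // lerD2l lerN2 ltW.
Qed.

Lemma taylor1_lipschitz (R : realType) (f df : R -> R) (C y d : R) :
  (forall z : R, is_derive z 1 f (df z)) ->
  (forall a b, `|df a - df b| <= C * `|a - b|) ->
  `|f (y + d) - f y - d * df y| <= C * d ^+ 2.
Proof.
move=> fdf dfC; have [c e cy] := MVT_dist y (y + d) fdf.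
move: e cy; rewrite [y + d - y]addrAC subrr add0r => -> cy.
rewrite [d * _]mulrC -mulrBl normrM -[d ^+ 2]real_normK ?num_real // expr2 mulrA.
rewrite ler_wpM2r //; apply: le_trans (dfC _ _) _.
have [d0|d0] := eqVneq d 0.
  by move: cy; rewrite d0 normr0 normr_le0 subr_eq0 => /eqP ->; rewrite subrr normr0.
apply: ler_wpM2l => //; rewrite leNgt; apply/negP => C0.
have := dfC 1 0; rewrite subr0 normr1 mulr1 => /(le_trans (normr_ge0 _)); lra.
Qed.

Section Stein.
Variables (R : realType) (n : nat) (g : R).
Hypothesis g01 : 0 < g <= 1.

Let g01' : 0 <= g <= 1. Proof. by case/andP: g01 => /ltW -> ->. Qed.

Local Notation E := (Ex (@qs R n g)).
Implicit Types (s : {ffun 'I_n + 'I_n -> bool}).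

(** The centered sampling variable of the [j]-th row. *)
Definition csamp s (j : 'I_n) : R := (if s (inl j) then 1 else 0) / g - 1.

(** One variable takes the value [1 / g - 1] with probability [g] and [-1]
    otherwise. Expanding [f] at [y] to first order, the terms in [f y] cancel by
    centering, those in [df y] by the value [(1 - g) / g] of the variance. *)
Lemma stein_swap_two_points (f df : R -> R) (C X y : R) :
  (forall z : R, is_derive z 1 f (df z)) ->
  (forall a b, `|df a - df b| <= C * `|a - b|) ->
  `|g * ((1 / g - 1) * X * f (y + (1 / g - 1) * X)
      - (1 - g) / g * X ^+ 2 * df (y + (1 / g - 1) * X)) +
    (1 - g) * (- X * f (y - X) - (1 - g) / g * X ^+ 2 * df (y - X))|
  <= 4 * (1 - g) / g ^+ 2 * C * `|X| ^+ 3.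
Proof.
move=> fdf dfC; set a := 1 / g - 1; set v := (1 - g) / g.
have /andP[g0 g1] := g01.
have gn0 : g != 0 by rewrite gt_eqF.
have C0 : 0 <= C.
  have := dfC 1 0; rewrite subr0 normr1 mulr1; exact: le_trans.
have a0 : 0 <= a by rewrite /a subr_ge0 mul1r invf_ge1.
have v0 : 0 <= v by rewrite /v divr_ge0 ?subr_ge0 // ltW.
set r1 := f (y + a * X) - f y - (a * X) * df y.
set r2 := f (y - X) - f y - (- X) * df y.
set d1 := df y - df (y + a * X); set d2 := df y - df (y - X).
have -> : g * (a * X * f (y + a * X) - v * X ^+ 2 * df (y + a * X)) +
    (1 - g) * (- X * f (y - X) - v * X ^+ 2 * df (y - X)) =
   g * a * X * r1 - (1 - g) * X * r2 + v * g * X ^+ 2 * d1 + v * (1 - g) * X ^+ 2 * d2.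
  by rewrite /r1 /r2 /d1 /d2 /a /v; field.
have hr1 : `|r1| <= C * (a * X) ^+ 2 by exact: taylor1_lipschitz.
have hr2 : `|r2| <= C * (- X) ^+ 2 by exact: taylor1_lipschitz.
have hd1 : `|d1| <= C * (a * `|X|).
  apply: le_trans (dfC _ _) _; rewrite opprD addNKr normrN normrM (ger0_norm a0) //.
have hd2 : `|d2| <= C * `|X|.
  by apply: le_trans (dfC _ _) _; rewrite opprB addrC subrK.
have X0 := normr_ge0 X.
have X2 : X ^+ 2 = `|X| ^+ 2 by rewrite real_normK ?num_real.
have g1' : 0 <= 1 - g by rewrite subr_ge0.
apply: le_trans (_ : g * a * `|X| * (C * (a * X) ^+ 2) + (1 - g) * `|X| * (C * (- X) ^+ 2)
  + v * g * `|X| ^+ 2 * (C * (a * `|X|)) + v * (1 - g) * `|X| ^+ 2 * (C * `|X|) <= _).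
  have nm (u w z : R) : 0 <= u -> `|u * z * w| = u * `|z| * `|w|.
    by move=> u0; rewrite !normrM (ger0_norm u0).
  have nm2 (u w z : R) : 0 <= u -> `|u * z ^+ 2 * w| = u * `|z| ^+ 2 * `|w|.
    by move=> u0; rewrite nm // normrX.
  have n4 (x1 x2 x3 x4 : R) : `|x1 - x2 + x3 + x4| <= `|x1| + `|x2| + `|x3| + `|x4|.
    rewrite (le_trans (ler_normD _ _)) // lerD2r (le_trans (ler_normD _ _)) // lerD2r.
    exact: ler_normB.
  apply: le_trans (n4 _ _ _ _) _; rewrite !nm2 ?nm; do ?[exact: mulr_ge0 | by rewrite mulr_ge0 // ltW | by []].
  have ga : 0 <= g * a * `|X| by rewrite !mulr_ge0 // ltW.
  have gb : 0 <= (1 - g) * `|X| by rewrite mulr_ge0.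
  have vg : 0 <= v * g * `|X| ^+ 2 by apply: mulr_ge0; [apply: mulr_ge0 => //; exact: ltW|exact: exprn_ge0].
  have vg' : 0 <= v * (1 - g) * `|X| ^+ 2 by apply: mulr_ge0; [apply: mulr_ge0|exact: exprn_ge0].
  by rewrite !lerD // ler_wpM2l.
rewrite sqrrN exprMn X2.
have -> : g * a * `|X| * (C * (a ^+ 2 * `|X| ^+ 2)) + (1 - g) * `|X| * (C * `|X| ^+ 2) +
   v * g * `|X| ^+ 2 * (C * (a * `|X|)) + v * (1 - g) * `|X| ^+ 2 * (C * `|X|) =
   (1 - g) / g ^+ 2 * ((1 - g) ^+ 2 + g ^+ 2 + 2 * ((1 - g) * g)) * C * `|X| ^+ 3.
  by rewrite /a /v; field.
rewrite ler_wpM2r ?exprn_ge0 // ler_wpM2r //.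
have -> : 4 * (1 - g) / g ^+ 2 = (1 - g) / g ^+ 2 * 4 by ring.
rewrite ler_wpM2l //; first by rewrite divr_ge0 // exprn_ge0 ?ltW.
nra.
Qed.

(** The weights may depend on the signs, but not on the sampling variables. *)
Variable x : 'I_n -> {ffun 'I_n + 'I_n -> bool} -> R.
Hypothesis xinl : forall j s i c, x j (upd s (inl i) c) = x j s.

Definition csum s : R := \sum_j csamp s j * x j s.

(** Integration by parts for the sampling variables: resampling one of them
    against the rest of the sum produces its variance and a derivative, up to a
    third moment. *)
Lemma stein_swap (f df : R -> R) (C : R) :
  (forall z : R, is_derive z 1 f (df z)) ->
  (forall a b, `|df a - df b| <= C * `|a - b|) ->
  `|E (fun s => csum s * f (csum s)
       - (1 - g) / g * (\sum_j x j s ^+ 2) * df (csum s))|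
  <= 4 * (1 - g) / g ^+ 2 * C * E (fun s => \sum_j `|x j s| ^+ 3).
Proof.
move=> fdf dfC; rewrite Ex_sum mulr_sumr.
have -> : E (fun s => csum s * f (csum s)
       - (1 - g) / g * (\sum_j x j s ^+ 2) * df (csum s)) =
  \sum_j E (fun s => csamp s j * x j s * f (csum s) - (1 - g) / g * x j s ^+ 2 * df (csum s)).
  rewrite -Ex_sum; apply: eq_Ex => s; rewrite sumrB -!mulr_suml.
  by rewrite mulr_sumr mulr_suml.
apply: le_trans (ler_norm_sum _ _ _) _; apply: ler_sum => j _.
rewrite (Ex_resample _ (inl j)); apply: le_trans (ler_norm_Ex (qs01 g01') _) _.
rewrite -ExZ; apply: le_Ex => [|s]; first exact: qs01.
pose y := \sum_(k | k != j) csamp s k * x k s.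
have Te c : csum (upd s (inl j) c) = y + ((if c then 1 else 0) / g - 1) * x j s.
  rewrite /csum (bigD1 j) //= addrC xinl /csamp upd_eq; congr (_ + _).
  by apply: eq_bigr => k kj; rewrite xinl upd_neq.
rewrite /resample /= !Te !xinl /csamp !upd_eq mul0r sub0r mulN1r.
have := @stein_swap_two_points f df C (x j s) y fdf dfC.
by rewrite /=.
Qed.

(** Closeness to the Gaussian law needs two things: the conditional variance has
    to be close to one, and the third moments have to be small. *)
Lemma stein_bound (f df : R -> R) (C : R) :
  (forall z : R, is_derive z 1 f (df z)) -> (forall z, `|df z| <= C) ->
  (forall a b, `|df a - df b| <= C * `|a - b|) ->
  `|E (fun s => df (csum s) - csum s * f (csum s))|
  <= C * E (fun s => `|(1 - g) / g * (\sum_j x j s ^+ 2) - 1|)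
   + 4 * (1 - g) / g ^+ 2 * C * E (fun s => \sum_j `|x j s| ^+ 3).
Proof.
move=> fdf df_le dfC.
set v := (1 - g) / g.
have -> : E (fun s => df (csum s) - csum s * f (csum s)) =
  - E (fun s => (v * (\sum_j x j s ^+ 2) - 1) * df (csum s)) -
  E (fun s => csum s * f (csum s) - v * (\sum_j x j s ^+ 2) * df (csum s)).
  by rewrite -[- E _]mulN1r -ExZ -ExB; apply: eq_Ex => s; ring.
apply: le_trans (ler_normB _ _) _; rewrite lerD ?stein_swap // normrN.
apply: le_trans (ler_norm_Ex (qs01 g01') _) _; rewrite -ExZ.
apply: le_Ex => [|s]; first exact: qs01.
by rewrite normrM mulrC ler_wpM2r.
Qed.

(** For the identity function the integration by parts is exact. *)
Lemma Ex_csum_sqr :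
  E (fun s => csum s ^+ 2) = (1 - g) / g * \sum_j E (fun s => x j s ^+ 2).
Proof.
have := @stein_swap id (cst 1) 0 (fun z => is_derive_id _ _).
move=> /(_ (fun a b => _)); rewrite mulr0 mul0r.
have h (a b : R) : `|cst 1 a - cst 1 b : R| <= 0 * `|a - b|.
  by rewrite subrr normr0 mul0r.
move=> /(_ h); rewrite normr_le0 ExB subr_eq0 => /eqP e.
rewrite -Ex_sum -ExZ; transitivity (E (fun s => csum s * csum s)).
  by apply: eq_Ex => s; rewrite expr2.
by rewrite e; apply: eq_Ex => s; rewrite mulr1.
Qed.

End Stein.

(** * The Gaussian distribution function and Stein's equation *)

Section Gauss.
Variable R : realType.
Implicit Types x y t : R.
Local Notation mu := (@lebesgue_measure R).

Lemma der_le0_nincr (D d : R -> R) x y : (forall z : R, is_derive z 1 D (d z)) ->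
  x <= y -> (forall z, x <= z <= y -> d z <= 0) -> D y <= D x.
Proof.
move=> Dd xy d0; have cD : {within `[x, y], continuous D}.
  by apply: derivable_within_continuous => z _; case: (Dd z).
have [c cxy e] := MVT_segment xy (fun z _ => Dd z) cD.
rewrite -subr_le0 e; apply: mulr_le0_ge0; last by rewrite subr_ge0.
by apply: d0; move: cxy; rewrite in_itv.
Qed.

Lemma der_ge0_ndecr (D d : R -> R) x y : (forall z : R, is_derive z 1 D (d z)) ->
  x <= y -> (forall z, x <= z <= y -> 0 <= d z) -> D x <= D y.
Proof.
move=> Dd xy d0; rewrite -lerN2.
apply: (@der_le0_nincr (fun z => - D z) (fun z => - d z)) => // z /d0.
by rewrite oppr_le0.
Qed.

Lemma der_eq0_cst (D d : R -> R) x y : (forall z : R, is_derive z 1 D (d z)) ->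
  x <= y -> (forall z, x <= z <= y -> d z = 0) -> D y = D x.
Proof.
move=> Dd xy d0; apply/eqP; rewrite eq_le (der_le0_nincr Dd) ?(der_ge0_ndecr Dd) //;
  by move=> z /d0 ->.
Qed.

Lemma is_derive_mul (f g : R -> R) x (a b : R) : is_derive x 1 f a ->
  is_derive x 1 g b -> is_derive x 1 (fun y => f y * g y) (a * g x + f x * b).
Proof.
by move=> fa gb; apply: (is_derive_eq (is_deriveM fa gb)); rewrite /GRing.scale /=; ring.
Qed.

Lemma is_derive_sub (f g : R -> R) x (a b : R) : is_derive x 1 f a ->
  is_derive x 1 g b -> is_derive x 1 (fun y => f y - g y) (a - b).
Proof. by move=> fa gb; exact: is_deriveB. Qed.

Lemma is_derive_mulc (c : R) (f : R -> R) x (a : R) : is_derive x 1 f a ->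
  is_derive x 1 (fun y => c * f y) (c * a).
Proof. by move=> fa; exact: is_deriveZ. Qed.

Definition gpdf : R -> R := normal_pdf 0 1.

Lemma gpdfE x : gpdf x = normal_peak 1 * expR (- (2^-1 * x ^+ 2)).
Proof.
rewrite /gpdf normal_pdfE ?oner_neq0 // /normal_fun subr0 expr1n; congr (_ * expR _).
by rewrite mulNr mulrC.
Qed.

Lemma gpdf_gt0 x : 0 < gpdf x.
Proof. by rewrite gpdfE mulr_gt0 ?expR_gt0 // normal_peak_gt0 ?oner_neq0. Qed.

Lemma gpdf_neq0 x : gpdf x != 0.
Proof. by rewrite gt_eqF ?gpdf_gt0. Qed.

Lemma gpdfN x : gpdf (- x) = gpdf x.
Proof. by rewrite !gpdfE sqrrN. Qed.

Lemma is_derive_gpdf x : is_derive x 1 gpdf (- x * gpdf x).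
Proof.
have -> : gpdf = (fun y => normal_peak 1 * (expR \o (fun y => - 2^-1 * y ^+ 2)) y).
  by apply/funext => y /=; rewrite gpdfE mulNr.
rewrite [X in is_derive _ _ _ X](_ : _ =
  normal_peak 1 * (expR (- 2^-1 * x ^+ 2) * (- 2^-1 * (1 * x + x * 1)))); last first.
  by rewrite /=; field.
apply: is_derive_mulc; apply: is_derive1_comp; apply: is_derive_mulc.
exact: (is_derive_mul (is_derive_id x 1) (is_derive_id x 1)).
Qed.

Lemma mul_gpdf_le x : 0 < x -> x * gpdf x <= 2 * normal_peak 1 / x.
Proof.
move=> x0; rewrite ler_pdivlMr // gpdfE.
have p0 := @normal_peak_gt0 R _ (oner_neq0 _).
have h := expR_ge1Dx (2^-1 * x ^+ 2).
rewrite expRN.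
have e0 := expR_gt0 (2^-1 * x ^+ 2).
have -> : x * (normal_peak 1 * (expR (2^-1 * x ^+ 2))^-1) * x =
  normal_peak 1 * (x ^+ 2 / expR (2^-1 * x ^+ 2)) by ring.
rewrite [2 * _]mulrC ler_wpM2l ?(ltW p0) // ler_pdivrMr //.
by apply: le_trans (ler_wpM2l _ h) => //; rewrite mulrDr mulr1 mulrA divff // mul1r lerDr.
Qed.

Lemma continuous_gpdf : continuous gpdf.
Proof. by apply: continuous_normal_pdf; rewrite oner_neq0. Qed.

(** [G] is a Gaussian tail, characterized by its derivative and its limit; both
    the upper tail and the reflected lower tail are of this form. *)
Section Mills.
Variable G : R -> R.
Hypothesis dG : forall z : R, is_derive z 1 G (- gpdf z).
Hypothesis G0 : G x @[x --> +oo] --> 0.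

Lemma tail_ge0 x : 0 <= G x.
Proof.
apply: (cvgr_to_le G0); near=> y.
have xy : x <= y by near: y; apply: nbhs_pinfty_ge; rewrite num_real.
apply: (der_le0_nincr dG) => // z _; rewrite oppr_le0; exact/ltW/gpdf_gt0.
Unshelve. all: by end_near. Qed.

(** Mills' ratio: the upper bound compares [G] with [gpdf / x] beyond the fixed
    point [x]; the lower one follows, the difference having for derivative twice
    the defect of the upper bound. *)
Lemma mills_upper x : 0 < x -> x * G x <= gpdf x.
Proof.
move=> x0; rewrite -subr_le0.
have dD (z : R) : is_derive z 1 (fun y => x * G y - gpdf y) (x * - gpdf z - - z * gpdf z).
  by apply: is_derive_sub; exact: is_derive_gpdf.
have h y : x <= y -> x * G x - gpdf x <= x * G y.
  move=> xy; apply: le_trans (_ : x * G y - gpdf y <= _); last by rewrite gerBl ltW ?gpdf_gt0.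
  apply: (der_ge0_ndecr dD) => // z /andP[xz _].
  have -> : x * - gpdf z - - z * gpdf z = (z - x) * gpdf z by ring.
  by rewrite mulr_ge0 ?subr_ge0 // ltW ?gpdf_gt0.
have xG0 : x * G y @[y --> +oo] --> 0.
  by rewrite -[X in _ --> X](mulr0 x); apply: cvgMr.
apply: (cvgr_to_ge xG0); near=> y; apply: h.
by near: y; apply: nbhs_pinfty_ge; rewrite num_real.
Unshelve. all: by end_near. Qed.

Lemma mills_lower x : 0 < x -> x * gpdf x <= (1 + x ^+ 2) * G x.
Proof.
move=> x0; pose u y := (1 + y ^+ 2) * G y - y * gpdf y.
have du (z : R) : is_derive z 1 u (2 * (z * G z - gpdf z)).
  rewrite [X in is_derive _ _ _ X](_ : _ = ((0 + (1 * z + z * 1)) * G z + (1 + z * z) * - gpdf z)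
     - (1 * gpdf z + z * (- z * gpdf z))); last by ring.
  apply: is_derive_sub; apply: is_derive_mul => //; last exact: is_derive_gpdf.
  apply: is_deriveD; exact: (is_derive_mul (is_derive_id z 1) (is_derive_id z 1)).
rewrite -subr_ge0 -/(u x) leNgt; apply/negP => ux.
have p0 := @normal_peak_gt0 R _ (oner_neq0 _).
pose y := Num.max x (4 * normal_peak 1 / - u x).
have xy : x <= y by rewrite le_max lexx.
have y0 : 0 < y by exact: lt_le_trans xy.
have : u y <= u x.
  apply: (der_le0_nincr du) => // z /andP[xz _].
  by rewrite pmulr_rle0 // subr_le0 mills_upper // (lt_le_trans x0).
apply/negP; rewrite -ltNge; apply: lt_le_trans (_ : - (y * gpdf y) <= _); last first.
  by rewrite /u lerBrDr addNr mulr_ge0 ?tail_ge0 // addr_ge0 ?sqr_ge0.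
rewrite ltrNr; apply: le_lt_trans (mul_gpdf_le y0) _.
rewrite ltr_pdivrMr //.
have : 4 * normal_peak 1 / - u x <= y by rewrite le_max lexx orbT.
rewrite ler_pdivrMr ?oppr_gt0 //; nra.
Qed.

(** The three quantities that control, in the tails, a solution of Stein's
    equation, the solution times [x], and the derivative of the latter. *)
Lemma mills_bounds x : 1 <= x ->
  [/\ `|G x / gpdf x| <= 1, `|x * (G x / gpdf x)| <= 1 &
     `|(1 + x ^+ 2) * (G x / gpdf x) - x| <= 1].
Proof.
move=> x1; have x0 : 0 < x by lra.
have q0 := gpdf_gt0 x; have G0' := tail_ge0 x.
have hu := mills_upper x0; have hl := mills_lower x0.
set M := G x / gpdf x.
have M0 : 0 <= M by rewrite divr_ge0 // ltW.
have xM : x * M <= 1 by rewrite mulrA ler_pdivrMr // mul1r.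
have lM : x <= (1 + x ^+ 2) * M by rewrite mulrA ler_pdivlMr.
have M1 : M <= 1 by nra.
have xM0 : 0 <= x * M by rewrite mulr_ge0 // ltW.
split; rewrite ger0_norm ?subr_ge0 //.
have -> : (1 + x ^+ 2) * M - x = M - x * (1 - x * M) by ring.
have : 0 <= x * (1 - x * M) by rewrite mulr_ge0 ?subr_ge0 // ltW.
lra.
Qed.

End Mills.

(** The distribution function of the measure with density [k * gpdf]. *)
Definition wcdf (k : R -> R) x : R := \int[mu]_(t in `]-oo, x]) (k t * gpdf t).

Section Wcdf.
Variable k : R -> R.
Hypothesis ck : continuous k.
Hypothesis k01 : forall t, 0 <= k t <= 1.

Lemma integrable_wcdf (D : set R) : measurable D ->
  mu.-integrable D (EFin \o (fun t => k t * gpdf t)).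
Proof.
move=> mD; apply: (@le_integrable _ _ _ mu D mD _ (EFin \o gpdf)).
- apply/measurable_EFinP; apply: measurable_funTS; apply: measurable_funM.
    exact: continuous_measurable_fun.
  exact: measurable_normal_pdf.
- move=> t _ /=; rewrite lee_fin normrM ler_piMl //.
  by have /andP[h0 h1] := k01 t; rewrite ger0_norm.
- by apply: integrableS (integrable_normal_pdf 0 1).
Qed.

Lemma is_derive_wcdf x : is_derive x 1 (wcdf k) (k x * gpdf x).
Proof.
have [] := @continuous_FTC1 R (fun t => k t * gpdf t) -oo%O x (x + 1).
- by rewrite ltrDl.
- exact: integrable_wcdf.
- by rewrite ltNyr.
- by apply: continuousM; [exact: ck|exact: continuous_gpdf].
- by move=> h; rewrite derive1E => e; exact: (DeriveDef h e).
Qed.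

End Wcdf.

Definition Phi x : R := fine (normal_prob 0 1 [set y : R | y <= x]).

Lemma Phi_wcdf : Phi = wcdf (fun=> 1).
Proof.
apply/funext => x; rewrite /Phi /wcdf /Rintegral /normal_prob -set_itvNyc.
by under [in RHS]eq_integral => t _ do rewrite mul1r.
Qed.

Lemma is_derive_Phi x : is_derive x 1 Phi (gpdf x).
Proof.
rewrite Phi_wcdf -[gpdf x]mul1r; apply: is_derive_wcdf; first by move=> y; exact: cst_continuous.
by move=> t; rewrite ler01 lexx.
Qed.

(* The identity, as a random variable of Gaussian law: the limits at infinity of
   its distribution function are those of [Phi]. *)
Let idN : measurableTypeR R -> R := idfun.
#[local] HB.instance Definition _ :=
  @isMeasurableFun.Build _ _ _ _ idN (@measurable_id _ _ setT).

Lemma Phi_fin x : normal_prob 0 1 [set y : R | y <= x] = (Phi x)%:E.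
Proof.
rewrite /Phi fineK // fin_num_measure // -set_itvNyc; exact: measurable_itv.
Qed.

Lemma cdf_idN x : (cdf (idN : {RV (normal_prob 0 1) >-> R}) x) = (Phi x)%:E.
Proof. by rewrite /cdf /distribution /= /pushforward preimage_id -Phi_fin set_itvNyc. Qed.

Lemma cvg_Phiy : Phi x @[x --> +oo] --> (1 : R).
Proof.
have := cvg_cdfy1 (idN : {RV (normal_prob 0 1) >-> R}).
by rewrite (funext cdf_idN) => /fine_cvgP[].
Qed.

Lemma cvg_PhiNy : Phi x @[x --> -oo] --> (0 : R).
Proof.
have := cvg_cdfNy0 (idN : {RV (normal_prob 0 1) >-> R}).
by rewrite (funext cdf_idN) => /fine_cvgP[].
Qed.

Lemma continuous_Phi : continuous Phi.
Proof. by move=> x; apply/differentiable_continuous/derivable1_diffP; case: (is_derive_Phi x). Qed.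

(** A continuous ramp from 1 to 0 on the interval from [a] to [b]. *)
Definition ramp (a b t : R) : R := (`|t - b| - `|t - a| + (b - a)) / (2 * (b - a)).

Section Ramp.
Variables a b : R.
Hypothesis ab : a < b.

Let ba0 : 0 < 2 * (b - a). Proof. by rewrite mulr_gt0 // subr_gt0. Qed.

Lemma ramp_left t : t <= a -> ramp a b t = 1.
Proof.
move=> ta; have h1 : t - a <= 0 by lra.
have h2 : t - b <= 0 by have := ab; lra.
rewrite /ramp (ler0_norm h1) (ler0_norm h2).
by rewrite -[RHS](divff (lt0r_neq0 ba0)); congr (_ / _); ring.
Qed.

Lemma ramp_right t : b <= t -> ramp a b t = 0.
Proof.
move=> tb; have h1 : 0 <= t - b by lra.
have h2 : 0 <= t - a by have := ab; lra.
rewrite /ramp (ger0_norm h1) (ger0_norm h2).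
by rewrite [X in X / _](_ : _ = 0) ?mul0r //; ring.
Qed.

Lemma ramp01 t : 0 <= ramp a b t <= 1.
Proof.
have h := ler_distD t b a; rewrite [`|b - a|]gtr0_norm ?subr_gt0 // in h.
have h' := ler_distD b t a; rewrite [`|b - a|]gtr0_norm ?subr_gt0 // in h'.
have h2 := ler_distD a t b; rewrite [`|a - b|]distrC [`|b - a|]gtr0_norm ?subr_gt0 // in h2.
rewrite /ramp; apply/andP; split.
  by rewrite divr_ge0 ?(ltW ba0) //; lra.
by rewrite ler_pdivrMr // mul1r; lra.
Qed.

Lemma ramp_lipschitz t u : `|ramp a b t - ramp a b u| <= (b - a)^-1 * `|t - u|.
Proof.
have ba : 0 < b - a by rewrite subr_gt0.
have -> : ramp a b t - ramp a b u = (b - a)^-1 * (2^-1 * ((`|t - b| - `|u - b|) - (`|t - a| - `|u - a|))).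
  by rewrite /ramp; field; rewrite gt_eqF.
rewrite normrM gtr0_norm ?invr_gt0 // ler_wpM2l ?invr_ge0 ?(ltW ba) //.
rewrite normrM gtr0_norm // ?invr_gt0 //.
have h c : `| `|t - c| - `|u - c| | <= `|t - u|.
  apply: le_trans (ler_dist_dist _ _) _.
  by have -> : t - c - (u - c) = t - u by ring.
have := ler_normB (`|t - b| - `|u - b|) (`|t - a| - `|u - a|).
have := h a; have := h b; lra.
Qed.

Lemma continuous_ramp : continuous (ramp a b).
Proof.
move=> t; apply: cvgM; last exact: cvg_cst.
apply: cvgD; last exact: cvg_cst.
by apply: cvgB; apply: cvg_norm; apply: cvgB; [exact: cvg_id|exact: cvg_cst|exact: cvg_id|exact: cvg_cst].
Qed.

End Ramp.

Section SteinSolution.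
Variables a b : R.
Hypothesis ab : a < b.

Let h := ramp a b.
Let H := wcdf h.
Let m := H b.
Let A x := H x - m * Phi x.

(** The bounded solution of Stein's equation [f' x - x * f x = h x - m], where
    [m] is the Gaussian mean of the ramp [h]. *)
Let f x := A x / gpdf x.

Let dH (x : R) : is_derive x 1 H (h x * gpdf x).
Proof. by apply: is_derive_wcdf; [exact: continuous_ramp|exact: ramp01]. Qed.

Let H_left x : x <= a -> H x = Phi x.
Proof.
move=> xa; rewrite Phi_wcdf; apply: eq_Rintegral => t.
by rewrite inE /= in_itv /= => tx; rewrite /h ramp_left // (le_trans tx).
Qed.

Let H_right x : b <= x -> H x = m.
Proof.
move=> bx; apply: (der_eq0_cst dH) => // z /andP[bz _].
by rewrite /h ramp_right // mul0r.
Qed.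

Let Phi_a_le : Phi a <= m.
Proof.
rewrite -H_left // /m; apply: (der_ge0_ndecr dH) => [|z _]; first exact: ltW.
by rewrite mulr_ge0 ?(ltW (gpdf_gt0 _)) //; have /andP[] := ramp01 ab z.
Qed.

Let Phi_b_ge : m <= Phi b.
Proof.
rewrite Phi_wcdf /m /H /wcdf.
apply: le_Rintegral => //.
- by apply: integrable_wcdf => //; [exact: continuous_ramp|exact: ramp01].
- apply: integrable_wcdf => //; first by move=> ?; exact: cst_continuous.
  by move=> _; rewrite ler01 lexx.
- by move=> t _; rewrite ler_wpM2r ?(ltW (gpdf_gt0 _)) //; have /andP[] := ramp01 ab t.
Qed.

Let Phi01 x : 0 <= Phi x <= 1.
Proof.
rewrite -!lee_fin -Phi_fin probability_le1 ?andbT //.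
by rewrite -set_itvNyc; exact: measurable_itv.
Qed.

Let m01 : 0 <= m <= 1.
Proof.
have /andP[h1 _] := Phi01 a; have /andP[_ h2] := Phi01 b.
by rewrite (le_trans h1) // (le_trans Phi_b_ge).
Qed.

Let df x := h x - m + x * f x.

Let dA (x : R) : is_derive x 1 A (h x * gpdf x - m * gpdf x).
Proof. exact: (is_derive_sub (dH x) (is_derive_mulc m (is_derive_Phi x))). Qed.

Let dginv (x : R) : is_derive x 1 (fun y => (gpdf y)^-1) (x / gpdf x).
Proof.
apply: (is_derive_eq (is_deriveV (gpdf_neq0 x) (is_derive_gpdf x))).
by rewrite /GRing.scale /=; field; exact: gpdf_neq0.
Qed.

Let dff (x : R) : is_derive x 1 f (df x).
Proof.
apply: (is_derive_eq (is_derive_mul (dA x) (dginv x))).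
by rewrite /df /f; field; exact: gpdf_neq0.
Qed.

(** Beyond the ramp the solution is a multiple of Mills' ratio of the nearer
    tail. *)
Let tails x : Num.max `|a| (Num.max `|b| 1) <= `|x| ->
  [/\ `|f x| <= 1, `|x * f x| <= 1 & `|(1 + x ^+ 2) * f x + x * (h x - m)| <= 1].
Proof.
rewrite !ge_max => /and3P[xa xb x1].
have /andP[m0 m1] := m01.
have small (k M0 M1 M2 : R) : 0 <= k <= 1 -> [/\ `|M0| <= 1, `|M1| <= 1 & `|M2| <= 1] ->
  [/\ `|k * M0| <= 1, `|k * M1| <= 1 & `|k * M2| <= 1].
  move=> /andP[k0 k1] [h0 h1 h2].
  by split; rewrite normrM (ger0_norm k0) mulr_ile1.
have [x0|x0] := lerP 0 x.
  rewrite (ger0_norm x0) in xa xb x1.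
  have bx : b <= x by rewrite (le_trans (ler_norm _)).
  have dG (z : R) : is_derive z 1 (fun y => 1 - Phi y) (- gpdf z).
    by rewrite -[- _]sub0r; apply: is_derive_sub; exact: is_derive_Phi.
  have G0 : 1 - Phi y @[y --> +oo] --> 0.
    by rewrite -[X in _ --> X](subrr 1); apply: cvgB; [exact: cvg_cst|exact: cvg_Phiy].
  have := small m _ _ _ m01 (mills_bounds dG G0 x1).
  have -> : m * ((1 - Phi x) / gpdf x) = f x by rewrite /f /A H_right //; field; exact: gpdf_neq0.
  have -> : m * (x * ((1 - Phi x) / gpdf x)) = x * f x by rewrite /f /A H_right //; field; exact: gpdf_neq0.
  have -> // : m * ((1 + x ^+ 2) * ((1 - Phi x) / gpdf x) - x) = (1 + x ^+ 2) * f x + x * (h x - m).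
  by rewrite /f /A H_right // /h ramp_right //; field; exact: gpdf_neq0.
rewrite (ltr0_norm x0) in xa xb x1.
have ax : x <= a by have := ler_norm (- a); rewrite normrN; lra.
have dG (z : R) : is_derive z 1 (fun y => Phi (- y)) (- gpdf z).
  rewrite -gpdfN -mulrN1; apply: is_derive1_comp; exact: is_derive_Phi.
have G0 : Phi (- y) @[y --> +oo] --> (0 : R).
  by apply: cvg_comp cvg_PhiNy; rewrite ninfty; exact: cvg_id.
have k01 : 0 <= 1 - m <= 1 by lra.
have := small _ _ _ _ k01 (mills_bounds dG G0 x1); rewrite opprK gpdfN.
have -> : (1 - m) * (Phi x / gpdf x) = f x by rewrite /f /A H_left //; field; exact: gpdf_neq0.
have -> : (1 - m) * (- x * (Phi x / gpdf x)) = - (x * f x) by rewrite /f /A H_left //; field; exact: gpdf_neq0.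
have -> : (1 - m) * ((1 + (- x) ^+ 2) * (Phi x / gpdf x) + x) = (1 + x ^+ 2) * f x + x * (h x - m).
  by rewrite /f /A H_left // /h ramp_left //; field; exact: gpdf_neq0.
by rewrite normrN.
Qed.

Let f_bounded : exists2 B, 1 <= B & forall x,
  [/\ `|f x| <= B, `|x * f x| <= B & `|f x + x * df x| <= B].
Proof.
pose c := Num.max `|a| (Num.max `|b| 1).
have c1 : 1 <= c by rewrite !le_max lexx !orbT.
have c0 : - c <= c by lra.
have cf : {within `[- c, c], continuous (fun x => `|f x|)}.
  apply: continuous_subspaceT => x; apply: cvg_norm.
  by apply/differentiable_continuous/derivable1_diffP; case: (dff x).
have [z _ hz] := EVT_max c0 cf.
pose K := Num.max 1 `|f z|.
have K1 : 1 <= K by rewrite le_max lexx.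
exists (K + c * (c * K + 1)); first by nra.
move=> x; have e : f x + x * df x = (1 + x ^+ 2) * f x + x * (h x - m) by rewrite /df; ring.
have [xc|xc] := lerP c `|x|.
  by have [h1 h2 h3] := tails xc; rewrite e; split; nra.
have xc' : x \in `[- c, c] by rewrite in_itv /= -ler_norml ltW.
have fK : `|f x| <= K by rewrite le_max hz ?orbT.
have x0 := normr_ge0 x; have f0 := normr_ge0 (f x).
have h1 : `|x * f x| <= c * K by rewrite normrM ler_pM // ltW.
have hm : `|h x - m| <= 1.
  have /andP[h0 h1'] := ramp01 ab x; have /andP[m0 m1] := m01.
  by rewrite ler_norml -/h in h0 h1' *; apply/andP; split; lra.
have hd : `|df x| <= 1 + c * K by apply: le_trans (ler_normD _ _) _; rewrite lerD.
have cK : 0 <= c * K by nra.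
have ccK : c * K <= c * (c * K) by nra.
split; [by nra|by nra|].
apply: le_trans (ler_normD _ _) _; rewrite lerD // normrM ler_pM // ?(ltW xc) //.
by rewrite addrC.
Qed.

(** The right-hand side of Stein's equation is a ramp minus its Gaussian mean, so
    the solution approximates the centered indicator of a half-line from both
    sides. The derivative is Lipschitz because the ramp is and because the
    derivative of [x * f x] is bounded. *)
Lemma stein_solution : exists f df : R -> R, exists C : R,
  [/\ forall x : R, is_derive x 1 f (df x),
      forall x, `|df x| <= C,
      forall x y, `|df x - df y| <= C * `|x - y| &
      forall x, (x <= a)%R%:R - Phi b <= df x - x * f x <= (x <= b)%R%:R - Phi a].
Proof.
have [B B1 hB] := f_bounded; exists f, df, (B + 1 + (b - a)^-1).
have ba0 : 0 < (b - a)^-1 by rewrite invr_gt0 subr_gt0.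
have hm x : `|h x - m| <= 1.
  have /andP[h0 h1'] := ramp01 ab x; have /andP[m0 m1] := m01.
  by rewrite ler_norml -/h in h0 h1' *; apply/andP; split; lra.
split=> // [x|x y|x].
- have [_ h1 _] := hB x; apply: le_trans (ler_normD _ _) _.
  by have := hm x; lra.
- have dg (z : R) : is_derive z 1 (fun y => y * f y) (f z + z * df z).
    by rewrite -[X in X + _]mul1r; apply: is_derive_mul.
  have -> : df x - df y = (h x - h y) + (x * f x - y * f y) by rewrite /df; ring.
  have [c e _] := MVT_dist y x dg.
  apply: le_trans (ler_normD _ _) _; rewrite e normrM.
  have := ramp_lipschitz ab x y; rewrite -/h => h1.
  have [_ _ h2] := hB c; have n0 := normr_ge0 (x - y).
  have : `|f c + c * df c| * `|x - y| <= B * `|x - y| by rewrite ler_wpM2r.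
  by nra.
- have -> : df x - x * f x = h x - m by rewrite /df; ring.
  have /andP[h0 h1] := ramp01 ab x.
  rewrite lerB ?lerB //.
  + have [xb|xb] := leP x b; [by []|by rewrite /h ramp_right // ltW].
  + by have [xa|xa] := leP x a; [rewrite /h ramp_left|].
Qed.

End SteinSolution.

End Gauss.

(** * From Stein identities to distribution functions *)

Section Limit.
Variable R : realType.

Lemma Ex_indic_le (I : finType) (q : I -> R) (q01 : forall i, 0 <= q i <= 1)
    (A B : pred {ffun I -> bool}) (F : {ffun I -> bool} -> R) (c : R) :
  (forall s, (A s)%:R <= F s + c + (B s)%:R) ->
  Ex q (fun s => (A s)%:R) <= Ex q F + c + Ex q (fun s => (B s)%:R).
Proof.
move=> h; rewrite -[X in _ + X + _](Ex_cst q) -!ExD.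
exact: le_Ex.
Qed.

(** If Stein's identity holds in the limit for [T], then [T] and every [Y] that
    differs from it by a term vanishing in probability converge in law to the
    standard Gaussian: the indicator of a half-line lies between the left-hand
    sides of two Stein equations, up to the constants that they center. *)
Lemma cdf_limit (I : nat -> finType) (q : forall k, I k -> R)
    (T Y : forall k, {ffun I k -> bool} -> R) :
  (forall k i, 0 <= q k i <= 1) ->
  (forall (f df : R -> R) (C : R),
     (forall x : R, is_derive x 1 f (df x)) -> (forall x, `|df x| <= C) ->
     (forall x y, `|df x - df y| <= C * `|x - y|) ->
     Ex (q k) (fun s => df (T k s) - T k s * f (T k s)) @[k --> \oo] --> (0 : R)) ->
  (forall dlt : R, 0 < dlt ->
     Ex (q k) (fun s => (dlt < `|Y k s - T k s|)%R%:R) @[k --> \oo] --> (0 : R)) ->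
  forall x, Ex (q k) (fun s => (Y k s <= x)%R%:R) @[k --> \oo] --> Phi x.
Proof.
move=> q01 hT hY x; apply/cvgrPdist_le => eps eps0.
have e3 : 0 < eps / 3 by rewrite divr_gt0.
have /cvgrPdist_le /(_ _ e3) /nbhs_ballP[r /= r0 hr] := @continuous_Phi R x.
pose dlt := r / 4; have dlt0 : 0 < dlt by rewrite divr_gt0.
have hPhi y : `|x - y| <= 2 * dlt -> `|Phi x - Phi y| <= eps / 3.
  by move=> xy; apply: hr; rewrite /ball /= (le_lt_trans xy) // /dlt; lra.
have xd : x + dlt < x + 2 * dlt by lra.
have xd' : x - 2 * dlt < x - dlt by lra.
have [f1 [df1 [C1 [d1 b1 l1 h1]]]] := stein_solution xd.
have [f2 [df2 [C2 [d2 b2 l2 h2]]]] := stein_solution xd'.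
have /cvgrPdist_le/(_ _ e3) hf1 := hT f1 df1 C1 d1 b1 l1.
have /cvgrPdist_le/(_ _ e3) hf2 := hT f2 df2 C2 d2 b2 l2.
have /cvgrPdist_le/(_ _ e3) hP := hY dlt dlt0.
near=> k.
have : `|0 - Ex (q k) (fun s => df1 (T k s) - T k s * f1 (T k s))| <= eps / 3.
  by near: k; exact: hf1.
have : `|0 - Ex (q k) (fun s => df2 (T k s) - T k s * f2 (T k s))| <= eps / 3.
  by near: k; exact: hf2.
have : `|0 - Ex (q k) (fun s => (dlt < `|Y k s - T k s|)%R%:R)| <= eps / 3.
  by near: k; exact: hP.
rewrite !sub0r !normrN !ler_norml => /andP[_ hp] /andP[hlo _] /andP[_ hup].
have up : Ex (q k) (fun s => (Y k s <= x)%R%:R) <=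
   Ex (q k) (fun s => df1 (T k s) - T k s * f1 (T k s)) + Phi (x + 2 * dlt) +
   Ex (q k) (fun s => (dlt < `|Y k s - T k s|)%R%:R).
  apply: Ex_indic_le => // s; have /andP[h _] := h1 (T k s).
  have [Yx|Yx] := leP (Y k s) x; last first.
    have : 0 <= (T k s <= x + dlt)%R%:R :> R by [].
    have : 0 <= (dlt < `|Y k s - T k s|)%R%:R :> R by [].
    by rewrite /=; lra.
  have [dYT|dYT] := ltP dlt `|Y k s - T k s|.
    have : 0 <= (T k s <= x + dlt)%R%:R :> R by [].
    by rewrite /=; lra.
  have Tx : T k s <= x + dlt by move: dYT; rewrite ler_norml => /andP[]; lra.
  by move: h; rewrite Tx /=; lra.
have lo : Ex (q k) (fun s => df2 (T k s) - T k s * f2 (T k s)) + Phi (x - 2 * dlt) <=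
   Ex (q k) (fun s => (Y k s <= x)%R%:R) + Ex (q k) (fun s => (dlt < `|Y k s - T k s|)%R%:R).
  rewrite -[X in _ + X <= _](Ex_cst (q k)) -!ExD; apply: le_Ex => // s.
  have /andP[_ h] := h2 (T k s).
  have [Tx|Tx] := leP (T k s) (x - dlt); last first.
    have : 0 <= (Y k s <= x)%R%:R :> R by [].
    have : 0 <= (dlt < `|Y k s - T k s|)%R%:R :> R by [].
    by move: h; rewrite (lt_geF Tx) /=; lra.
  move: h; rewrite Tx /= => h.
  have [dYT|dYT] := ltP dlt `|Y k s - T k s|.
    have : 0 <= (Y k s <= x)%R%:R :> R by [].
    by rewrite /=; lra.
  have Yx : Y k s <= x by move: dYT; rewrite ler_norml => /andP[]; lra.
  by rewrite Yx /=; lra.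
have p1 : `|Phi x - Phi (x + 2 * dlt)| <= eps / 3.
  by apply: hPhi; rewrite ler_norml; apply/andP; split; lra.
have p2 : `|Phi x - Phi (x - 2 * dlt)| <= eps / 3.
  by apply: hPhi; rewrite ler_norml; apply/andP; split; lra.
move: p1 p2; rewrite !ler_norml => /andP[p1 _] /andP[_ p2].
by apply/andP; split; lra.
Unshelve. all: by end_near. Qed.

End Limit.

(** * Laws of functions of the two random diagonals *)

Section Transfer.
Variables (R : realType) (d : measure_display) (T : measurableType d).
Variables (P : probability T R) (n : nat) (g : R) (b e : 'I_n -> {RV P >-> R}).
Hypothesis dbe : srht_diagonals g b e.

(** The two diagonals take finitely many values; a configuration records which
    entries are equal to one. *)
Definition signs (w : T) : {ffun 'I_n + 'I_n -> bool} :=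
  [ffun u => match u with inl j => b j w == 1 | inr j => e j w == 1 end].

Let A (s : {ffun 'I_n + 'I_n -> bool}) (u : 'I_n + 'I_n) : set R :=
  match u with
  | inl _ => [set if s u then 1 else 0]
  | inr _ => [set if s u then 1 else -1]
  end.

Let X (u : 'I_n + 'I_n) : {RV P >-> R} := match u with inl j => b j | inr j => e j end.

Let mA s u : measurable (A s u).
Proof. by case: u => j /=; exact: measurable_set1. Qed.

Let signs_fiber s : [set w | signs w = s] =
  \bigcap_(u in [set` [set: 'I_n + 'I_n]%SET]) (X u @^-1` A s u).
Proof.
have [hb he _] := dbe.
apply/seteqP; split => w /=.
  move=> <- u _; rewrite /A /signs /preimage /X; case: u => j /=; rewrite ffunE.
    by have [hbj _ _] := hb j; case: (hbj w) => ->; rewrite ?eqxx // eq_sym oner_eq0.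
  by have [hej _ _] := he j; case: (hej w) => ->; rewrite ?eqxx // eqNr oner_eq0.
move=> h; apply/ffunP => u; have {h} : (X u @^-1` A s u) w by apply: h; rewrite /= inE.
rewrite /A /signs /preimage /X ffunE; case: u => j /= ->; case: (s _) => //=.
- by rewrite eqxx.
- by rewrite eq_sym oner_eq0.
- by rewrite eqxx.
- by rewrite eqNr oner_eq0.
Qed.

Let measurable_fiber s : measurable [set w | signs w = s].
Proof.
rewrite signs_fiber; apply: fin_bigcap_measurable => // u _.
by rewrite -[X in measurable X]setTI; exact: (@measurable_funPT _ _ _ _ (X u)).
Qed.

Lemma prob_signs s : P [set w | signs w = s] = (wt (@qs R n g) s)%:E.
Proof.
have [hb he hi] := dbe.
rewrite signs_fiber hi // /wt -prodEFin.
apply: eq_big => [u|u _]; first by rewrite inE.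
case: u => j; rewrite /bwt /A /=; case: (s _).
- by have [_ <- _] := hb j.
- by have [_ _ <-] := hb j.
- by have [_ <- _] := he j.
- have [_ _] := he j; rewrite (_ : 1 - 2^-1 = 2^-1 :> R) => [<- //|]; by field.
Qed.

Let signs_seq (r : seq {ffun 'I_n + 'I_n -> bool}) : uniq r ->
  measurable [set w | signs w \in r] /\
  P [set w | signs w \in r] = (\sum_(s <- r) wt (@qs R n g) s)%:E.
Proof.
elim: r => [_|s r IH /= /andP[sr /IH[mr Pr]]].
  rewrite big_nil (_ : [set w | _] = set0) ?measure0 //.
  by apply/seteqP; split.
have -> : [set w | signs w \in s :: r] = [set w | signs w = s] `|` [set w | signs w \in r].
  by apply/seteqP; split => w /=; rewrite inE => /predU1P.
split; first exact: measurableU.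
rewrite measureU //; first by rewrite big_cons EFinD -Pr -prob_signs.
by apply/seteqP; split => // w [/= -> H]; move: sr; rewrite H.
Qed.

Let signs_filter (D : pred {ffun 'I_n + 'I_n -> bool}) :
  [set w | D (signs w)] = [set w | signs w \in seq.filter D (index_enum _)].
Proof. by apply/seteqP; split => w /=; rewrite mem_filter mem_index_enum andbT. Qed.

Lemma measurable_signs (D : pred {ffun 'I_n + 'I_n -> bool}) :
  measurable [set w | D (signs w)].
Proof.
by rewrite signs_filter; apply: (signs_seq _).1; rewrite filter_uniq ?index_enum_uniq.
Qed.

Lemma prob_signs_in (D : pred {ffun 'I_n + 'I_n -> bool}) :
  P [set w | D (signs w)] = (Ex (@qs R n g) (fun s => (D s)%:R))%:E.
Proof.
rewrite signs_filter (signs_seq _).2 ?filter_uniq ?index_enum_uniq //.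
rewrite big_filter big_mkcond; congr (_%:E); apply: eq_bigr => s _.
by case: ifP; rewrite ?mulr1 ?mulr0.
Qed.

Lemma measurable_fun_signs (Y : {ffun 'I_n + 'I_n -> bool} -> R) :
  measurable_fun [set: T] (fun w => Y (signs w)).
Proof.
move=> _ B mB; rewrite setTI.
have -> : (fun w => Y (signs w)) @^-1` B = [set w | `[< B (Y (signs w)) >]].
  by apply/seteqP; split => w /= /asboolP.
exact: (measurable_signs (fun s => `[< B (Y s) >])).
Qed.

End Transfer.

(** * Localization of the eigenvalues of a perturbed scaled Gram matrix *)

Section Spectrum.
Variable R : realType.

Lemma eigvals_of_roots (q : nat) (A : 'M[R]_q) (r : seq R) :
  sorted >%R r -> char_poly A = \prod_(z <- r) ('X - z%:P) -> eigvals A = r.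
Proof.
move=> r_sorted pE; rewrite /eigvals.
have p0 : char_poly A != 0 by rewrite monic_neq0 ?char_poly_monic.
have <- : rev r = rootsR (char_poly A).
  apply: roots_uniq => //; last by rewrite rev_sorted.
  move=> x; rewrite mem_rev -root_prod_XsubC -pE.
  have [px|//] := boolP (root (char_poly A) x); last by rewrite andbF.
  by rewrite andbT; have := root_in_cauchy_bound p0 px.
have ur : uniq r by apply: sorted_uniq r_sorted; [move=> x y z h1 h2; exact: lt_trans h2 h1|exact: ltxx].
rewrite revK -[RHS]flatten_seq1; congr flatten; apply/eq_in_map => x xr.
by rewrite pE mu_prod_XsubC count_uniq_mem // xr.
Qed.

Lemma horner_char_poly (q : nat) (A : 'M[R]_q) (x : R) :
  (char_poly A).[x] = \det (x%:M - A).
Proof.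
rewrite /char_poly -[LHS]/(horner_eval x _) -det_map_mx; congr (\det _).
apply/matrixP => i j; rewrite /char_poly_mx !mxE /=.
by rewrite /horner_eval hornerD hornerN hornerC hornerMn hornerX.
Qed.

Lemma prod_perturb (I : Type) (r : seq I) (a b : I -> R) (M t : R) :
  1 <= M -> 0 <= t -> (forall i, `|a i| <= M) -> (forall i, `|b i| <= M) ->
  (forall i, `|a i - b i| <= t) ->
  `|\prod_(i <- r) a i - \prod_(i <- r) b i| <= (size r)%:R * M ^+ size r * t.
Proof.
move=> M1 t0 aM bM abt; have M0 : 0 <= M by exact: le_trans M1.
have bd r' : `|\prod_(i <- r') b i| <= M ^+ size r'.
  elim: r' => [|i r' IH]; first by rewrite big_nil normr1 expr0.
  by rewrite big_cons normrM exprS ler_pM.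
elim: r => [|i r IH]; first by rewrite !big_nil subrr normr0 !mul0r.
rewrite !big_cons /=.
have -> : a i * \prod_(j <- r) a j - b i * \prod_(j <- r) b j =
  a i * (\prod_(j <- r) a j - \prod_(j <- r) b j) + (a i - b i) * \prod_(j <- r) b j by ring.
apply: le_trans (ler_normD _ _) _; rewrite !normrM.
have h1 : `|a i| * `|\prod_(j <- r) a j - \prod_(j <- r) b j| <=
   M * ((size r)%:R * M ^+ size r * t) by rewrite ler_pM.
have h2 : `|a i - b i| * `|\prod_(j <- r) b j| <= t * (M * M ^+ size r).
  rewrite ler_pM //; apply: le_trans (bd r) _.
  by rewrite ler_peMl // exprn_ge0.
apply: le_trans (lerD h1 h2) _; rewrite exprS -natr1.
by rewrite le_eqVlt; apply/orP; left; apply/eqP; ring.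
Qed.

Lemma det_perturb (q : nat) (A B : 'M[R]_q) (M t : R) :
  1 <= M -> 0 <= t -> (forall i j, `|A i j| <= M) -> (forall i j, `|B i j| <= M) ->
  (forall i j, `|A i j - B i j| <= t) ->
  `|\det A - \det B| <= q`!%:R * (q%:R * M ^+ q * t).
Proof.
move=> M1 t0 AM BM ABt; rewrite /determinant -sumrB.
apply: le_trans (ler_norm_sum _ _ _) _.
rewrite -card_Sn -sum1_card natr_sum mulr_suml; apply: ler_sum => s _; rewrite mul1r.
rewrite -mulrBr normrM normrX normrN1 expr1n mul1r.
have := @prod_perturb _ (index_enum 'I_q) (fun i => A i (s i)) (fun i => B i (s i)) M t.
rewrite (_ : size (index_enum _) = q); first by apply.
by rewrite -[index_enum _]enumT size_enum_ord.
Qed.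

Lemma mul_perturb_lt0 (a b a' b' : R) :
  `|a - a'| < `|a| -> `|b - b'| < `|b| -> a * b < 0 -> a' * b' < 0.
Proof.
have same (x y : R) : `|x - y| < `|x| -> 0 < x * y.
  move=> h; have [x0|x0|x0] := ltgtP x 0.
  - move: h; rewrite (ltr0_norm x0) ltr_norml => /andP[h _].
    by rewrite nmulr_rgt0 //; lra.
  - move: h; rewrite (gtr0_norm x0) ltr_norml => /andP[_ h].
    by rewrite pmulr_rgt0 //; lra.
  - by move: h; rewrite x0 normr0 normr_lt0.
move=> /same ha /same hb ab; have : 0 < (a * a') * (b * b') by rewrite mulr_gt0.
have -> : a * a' * (b * b') = (a * b) * (a' * b') by ring.
by rewrite nmulr_rgt0.
Qed.

End Spectrum.

(** [K] bounds the ratios of the singular values [ell] and [rho] separates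
    consecutive ones. *)
Section Separation.
Variables (R : realType) (p : nat) (K rho : R).
Hypotheses (K1 : 1 <= K) (rho1 : 1 < rho).

(** A point outside of the open intervals around the squared singular values has
    with each of them a ratio at least this far from one. *)
Definition sep_const : R := 1 - rho^-1.
Definition entry_bound : R := rho * K ^+ 2 + 2.

Let rho0 : 0 < rho. Proof. exact: lt_trans ltr01 rho1. Qed.
Let sep0 : 0 < sep_const. Proof. by rewrite subr_gt0 invf_lt1. Qed.

Lemma entry_bound_ge1 : 1 <= entry_bound.
Proof.
have : 0 <= rho * K ^+ 2 by rewrite mulr_ge0 ?sqr_ge0 // ltW.
by rewrite /entry_bound; lra.
Qed.

(** The size of a perturbation that cannot change the sign of the determinant of
    a diagonal matrix with entries bounded away from zero by [sep_const]. *)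
Definition pert_radius : R :=
  sep_const ^+ p.+1 / (p.+1`!%:R * (p.+1%:R * entry_bound ^+ p.+1)) / 2.

Variables (ell : 'rV[R]_p.+1).
Hypothesis ell0 : forall i, 0 < ell 0 i.
Hypothesis ellK : forall i j, ell 0 i <= K * ell 0 j.
Hypothesis ellrho : forall i j : 'I_p.+1, (i < j)%N -> rho * ell 0 j <= ell 0 i.

Variables (E : 'M[R]_p.+1) (t : R).
Hypotheses (t0 : 0 <= t) (t1 : t <= 1) (trad : t <= pert_radius).
Hypothesis Et : forall i j, `|E i j| <= t.

Definition scaled_gram : 'M[R]_p.+1 := diag_mx ell *m (1%:M + E) *m diag_mx ell.

Let D (x : R) : 'rV[R]_p.+1 := \row_j (x / ell 0 j ^+ 2 - 1).

(** Factoring out [ell] on both sides makes the perturbation [E] additive, and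
    its size comparable with that of the diagonal, whatever the scale of [ell]. *)
Lemma char_poly_scaled_gram x :
  (char_poly scaled_gram).[x] = (\prod_j ell 0 j ^+ 2) * \det (diag_mx (D x) - E).
Proof.
rewrite horner_char_poly.
have -> : x%:M - scaled_gram = diag_mx ell *m (diag_mx (D x) - E) *m diag_mx ell.
  apply/matrixP => i j; rewrite /scaled_gram !(mul_diag_mx, mul_mx_diag) !mxE.
  have ej : ell 0 j != 0 by rewrite gt_eqF.
  have [->|ij] := eqVneq i j; rewrite ?mulr1n ?mulr0n; first by field.
  by ring.
by rewrite !det_mulmx !det_diag mulrC mulrA -big_split.
Qed.

Let det_D (x : R) : 0 <= x ->
  (forall j, x <= rho * K ^+ 2 * ell 0 j ^+ 2) ->
  (forall j, x <= ell 0 j ^+ 2 / rho \/ rho * ell 0 j ^+ 2 <= x) ->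
  `|\det (diag_mx (D x)) - \det (diag_mx (D x) - E)| < `|\det (diag_mx (D x))|.
Proof.
move=> x0 xK xsep.
have e0 j : 0 < ell 0 j ^+ 2 by rewrite exprn_gt0.
have big j : sep_const <= `|D x 0 j|.
  rewrite mxE; have [h|h] := xsep j.
    have h' : x / ell 0 j ^+ 2 <= rho^-1 by rewrite ler_pdivrMr // mulrC.
    by rewrite ler0_norm /sep_const; have := sep0; rewrite /sep_const; lra.
  have h' : rho <= x / ell 0 j ^+ 2 by rewrite ler_pdivlMr.
  have rr : rho * rho^-1 = 1 by rewrite divff // gt_eqF.
  have r1 := rho1; have r0 := rho0.
  have ri : 0 < rho^-1 by rewrite invr_gt0.
  by rewrite ger0_norm /sep_const; nra.
have small j : `|D x 0 j| <= rho * K ^+ 2 + 1.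
  rewrite mxE; have h' : x / ell 0 j ^+ 2 <= rho * K ^+ 2 by rewrite ler_pdivrMr.
  have h0 : 0 <= x / ell 0 j ^+ 2 by rewrite divr_ge0 // ltW.
  by rewrite ler_norml; apply/andP; split; lra.
have c0 : 0 <= rho * K ^+ 2 by rewrite mulr_ge0 ?sqr_ge0 // ltW.
apply: (@le_lt_trans _ _ (p.+1`!%:R * (p.+1%:R * entry_bound ^+ p.+1 * t))).
  apply: det_perturb => //.
  - exact: entry_bound_ge1.
  - move=> i j; rewrite mxE /entry_bound; have := small i.
    by case: eqP => _; rewrite ?mulr1n ?mulr0n ?normr0; lra.
  - move=> i j; apply: (@le_trans _ _ (rho * K ^+ 2 + 1 + 1)); last by rewrite /entry_bound; lra.
    rewrite mxE [in X in _ + X]mxE (le_trans (ler_normB _ _)) // lerD //; last by rewrite (le_trans (Et _ _)).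
    rewrite mxE; have := small i.
    by case: eqP => _; rewrite ?mulr1n ?mulr0n ?normr0; lra.
  - move=> i j; have -> : diag_mx (D x) i j - (diag_mx (D x) - E) i j = E i j.
      by rewrite [(_ - E) i j]mxE [(- E) i j]mxE; ring.
    exact: Et.
rewrite det_diag normr_prod.
have ss : sep_const ^+ p.+1 <= \prod_i `|D x 0 i|.
  rewrite -[p.+1 in leLHS]card_ord -prodr_const; apply: ler_prod => i _.
  by rewrite (ltW sep0) big.
apply: lt_le_trans ss.
have C0 : 0 < p.+1`!%:R * (p.+1%:R * entry_bound ^+ p.+1) :> R.
  rewrite !mulr_gt0 ?ltr0n ?fact_gt0 // exprn_gt0 //.
  exact: lt_le_trans ltr01 entry_bound_ge1.
have s1 : 0 < sep_const ^+ p.+1 by rewrite exprn_gt0.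
have := trad; rewrite /pert_radius ler_pdivlMr // ler_pdivlMr // => h.
rewrite mulrA; set C := _`!%:R * _ in C0 h *.
have [->|tn0] := eqVneq t 0; first by rewrite mulr0.
have tp : 0 < t by rewrite lt_def tn0.
have Ct0 : 0 < C * t by exact: mulr_gt0.
by nra.
Qed.

(** The characteristic polynomial changes sign between the ends of the interval:
    it does so for [E = 0], where exactly one factor changes sign, and [E] is too
    small to alter the signs at the ends. *)
Lemma scaled_gram_root i : exists2 x, root (char_poly scaled_gram) x &
  ell 0 i ^+ 2 / rho < x < rho * ell 0 i ^+ 2.
Proof.
pose x := ell 0 i ^+ 2 / rho; pose y := rho * ell 0 i ^+ 2.
have e0 j : 0 < ell 0 j ^+ 2 by rewrite exprn_gt0.
have ri : 0 < rho^-1 by rewrite invr_gt0.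
have rr : rho * rho^-1 = 1 by rewrite divff // gt_eqF.
have r1 := rho1; have r0 := rho0.
have ri1 : rho^-1 < 1 by rewrite invf_lt1.
have rhosq (j k : 'I_p.+1) : (j < k)%N -> rho ^+ 2 * ell 0 k ^+ 2 <= ell 0 j ^+ 2.
  move=> jk; rewrite -exprMn lerXn2r ?nnegrE ?ellrho //; last exact: ltW.
  by rewrite mulr_ge0 // ltW.
have Ksq j : ell 0 i ^+ 2 <= K ^+ 2 * ell 0 j ^+ 2.
  rewrite -exprMn lerXn2r ?nnegrE ?ellK //; first exact: ltW.
  by rewrite mulr_ge0 ?(ltW (ell0 _)) //; exact: le_trans K1.
have xy : x < y.
  by rewrite /x /y; have := e0 i; nra.
have x0 : 0 < x by rewrite mulr_gt0.
have side (j : 'I_p.+1) : (j < i)%N -> y <= ell 0 j ^+ 2 / rho.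
  by move=> ji; rewrite ler_pdivlMr // /y; have := rhosq _ _ ji; nra.
have side' (j : 'I_p.+1) : (i < j)%N -> rho * ell 0 j ^+ 2 <= x.
  by move=> ij; rewrite ler_pdivlMr //; have := rhosq _ _ ij; nra.
have yK j : y <= rho * K ^+ 2 * ell 0 j ^+ 2 by rewrite /y -mulrA ler_wpM2l // ltW.
have sepx j : x <= ell 0 j ^+ 2 / rho \/ rho * ell 0 j ^+ 2 <= x.
  have [ji|ij|/ord_inj ->] := ltngtP j i; last by left.
  - by left; apply: le_trans (side _ ji); exact: ltW.
  - by right; exact: side'.
have sepy j : y <= ell 0 j ^+ 2 / rho \/ rho * ell 0 j ^+ 2 <= y.
  have [ji|ij|/ord_inj ->] := ltngtP j i; last by right.
  - by left; exact: side.
  - by right; apply: le_trans (side' _ ij) _; exact: ltW.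
have hx := det_D (ltW x0) (fun j => le_trans (ltW xy) (yK j)) sepx.
have hy := det_D (ltW (lt_trans x0 xy)) yK sepy.
have sgn : \det (diag_mx (D x)) * \det (diag_mx (D y)) < 0.
  rewrite !det_diag -big_split (bigD1 i) //= nmulr_rlt0.
    apply: prodr_gt0 => j ji; rewrite !mxE.
    have ef z : z / ell 0 j ^+ 2 - 1 = (z - ell 0 j ^+ 2) / ell 0 j ^+ 2 by field; rewrite gt_eqF.
    rewrite !ef mulrACA pmulr_lgt0; last by rewrite mulr_gt0 ?invr_gt0.
    have ej := e0 j.
    have [lt|lt] := ltnP j i.
      have := side _ lt => h; have h2 : ell 0 j ^+ 2 / rho < ell 0 j ^+ 2 by nra.
      by rewrite nmulr_rgt0; lra.
    have lt' : (i < j)%N by rewrite ltn_neqAle eq_sym ji.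
    have := side' _ lt' => h; have h2 : ell 0 j ^+ 2 < rho * ell 0 j ^+ 2 by nra.
    by rewrite pmulr_rgt0; lra.
  rewrite !mxE /x /y mulrAC divff ?gt_eqF // mul1r mulfK ?gt_eqF //.
  by rewrite nmulr_rlt0; lra.
have neg := mul_perturb_lt0 hx hy sgn.
have [||z zxy rz] := @poly_ivtoo _ (char_poly scaled_gram) x y; first exact: ltW.
  rewrite !char_poly_scaled_gram mulrACA pmulr_rlt0 //.
  by rewrite mulr_gt0 //; apply: prodr_gt0 => j _.
by exists z => //; move: zxy; rewrite in_itv.
Qed.

(** Each of the disjoint intervals contains a root; hence the characteristic
    polynomial is split with simple roots, and the ordered eigenvalues lie in
    the intervals. *)
Lemma eigval_scaled_gram (A : 'M[R]_p.+1) i : char_poly A = char_poly scaled_gram ->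
  ell 0 i ^+ 2 / rho < eigval A i < rho * ell 0 i ^+ 2.
Proof.
move=> cA.
have [r hr] : exists r : 'I_p.+1 -> R, forall i, root (char_poly scaled_gram) (r i) /\
  ell 0 i ^+ 2 / rho < r i < rho * ell 0 i ^+ 2.
  have h j : exists x, root (char_poly scaled_gram) x /\ ell 0 j ^+ 2 / rho < x < rho * ell 0 j ^+ 2.
    by have [x h1 h2] := scaled_gram_root j; exists x.
  by exists (fun j => projT1 (cid (h j))) => j; exact: (projT2 (cid (h j))).
have lt_r (j k : 'I_p.+1) : (j < k)%N -> r k < r j.
  move=> jk; have [_ /andP[_ h1]] := hr k; have [_ /andP[h2 _]] := hr j.
  apply: lt_trans h1 _; apply: le_lt_trans h2.
  rewrite ler_pdivlMr // mulrAC -expr2 -exprMn lerXn2r ?nnegrE ?ellrho //; last exact: ltW.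
  by rewrite mulr_ge0 // ltW.
pose s := [seq r j | j <- enum 'I_p.+1].
have ss : sorted >%R s.
  have : sorted ltn (map val (enum 'I_p.+1)) by rewrite val_enum_ord iota_ltn_sorted.
  by rewrite !sorted_map; apply: sub_sorted => j k; exact: lt_r.
have us : uniq s by apply: sorted_uniq ss; [move=> x y z h1 h2; exact: lt_trans h2 h1|exact: ltxx].
have pE : char_poly A = \prod_(z <- s) ('X - z%:P).
  rewrite [LHS](@all_roots_prod_XsubC _ _ s).
  - by rewrite (monicP (char_poly_monic A)) scale1r.
  - by rewrite size_char_poly size_map size_enum_ord.
  - by apply/allP => _ /mapP[j _ ->]; rewrite cA; case: (hr j).
  - by rewrite uniq_rootsE.
rewrite /eigval (eigvals_of_roots ss pE) (nth_map i) ?size_enum_ord // nth_ord_enum.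
by case: (hr i).
Qed.

End Separation.

(** * Uniform expansions of eigenvalues and eigenvectors *)

Section BigO.
Variables (R : realType) (Z : Type) (t : Z -> R).
Hypothesis t01 : forall z, 0 <= t z <= 1.
Implicit Types f g : Z -> R.

(** The constant is uniform over the family [Z], which for the limit theorem
    consists of all pairs of an index of the sequence and an outcome with a small
    error. *)
Definition isO f (e : nat) := exists C : R, forall z, `|f z| <= C * t z ^+ e.

Lemma isO_eq f g e : f =1 g -> isO f e -> isO g e.
Proof. by move=> fg [C h]; exists C => z; rewrite -fg. Qed.

Lemma isO_ge0 f e : isO f e -> exists2 C : R, 0 <= C & forall z, `|f z| <= C * t z ^+ e.
Proof.
move=> [C h]; exists `|C| => // z; apply: le_trans (h z) _.
by rewrite ler_wpM2r ?ler_norm // exprn_ge0 //; case/andP: (t01 z).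
Qed.

Lemma isO_bounded f (C : R) : (forall z, `|f z| <= C) -> isO f 0.
Proof. by move=> h; exists C => z; rewrite expr0 mulr1. Qed.

Lemma isO_cst (c : R) : isO (fun=> c) 0.
Proof. exact: (@isO_bounded _ `|c|). Qed.

Lemma isO_le f e e' : (e' <= e)%N -> isO f e -> isO f e'.
Proof.
move=> ee /isO_ge0 [C C0 h]; exists C => z; apply: le_trans (h z) _.
by have /andP[h0 h1] := t01 z; rewrite ler_wpM2l // ler_wiXn2l.
Qed.

Lemma isO_D f g e : isO f e -> isO g e -> isO (fun z => f z + g z) e.
Proof.
move=> [C h] [C' h']; exists (C + C') => z.
by rewrite mulrDl (le_trans (ler_normD _ _)) // lerD.
Qed.

Lemma isO_N f e : isO f e -> isO (fun z => - f z) e.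
Proof. by move=> [C h]; exists C => z; rewrite normrN. Qed.

Lemma isO_B f g e : isO f e -> isO g e -> isO (fun z => f z - g z) e.
Proof. by move=> hf hg; apply: isO_D => //; exact: isO_N. Qed.

Lemma isO_M f g e1 e2 e : e = (e1 + e2)%N ->
  isO f e1 -> isO g e2 -> isO (fun z => f z * g z) e.
Proof.
move=> -> [C h] [C' h']; exists (C * C') => z.
by rewrite exprD mulrACA normrM ler_pM.
Qed.

Lemma isO_sum (J : Type) (r : seq J) (P : pred J) (F : J -> Z -> R) e :
  (forall j, P j -> isO (F j) e) -> isO (fun z => \sum_(j <- r | P j) F j z) e.
Proof.
move=> h; elim: r => [|j r IH].
  by exists 0 => z; rewrite big_nil normr0 mul0r.
case Pj : (P j); last by apply: isO_eq IH => z; rewrite big_cons Pj.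
apply: isO_eq (isO_D (h j Pj) IH) => z; by rewrite big_cons Pj.
Qed.

Lemma isO_inv f (c : R) : 0 < c -> (forall z, c <= `|f z|) -> isO (fun z => (f z)^-1) 0.
Proof.
move=> c0 h; apply: (@isO_bounded _ c^-1) => z.
by rewrite normfV lef_pV2 // posrE // (lt_le_trans c0).
Qed.

End BigO.

(** [lam z i] and [u z i] are the eigenvalues and the eigenvectors, the latter in
    the basis of the unperturbed eigenvectors and with a nonnegative diagonal
    coordinate. The eigenvalue equation is used in its normalized form, in which
    only the ratios [x] of singular values and the relative eigenvalues [om]
    appear: these are bounded independently of the scale of the data. *)
Section Expansion.
Variables (R : realType) (p : nat) (K rho : R).
Hypotheses (K1 : 1 <= K) (rho1 : 1 < rho).
Variables (Z : Type) (t : Z -> R) (ell : Z -> 'rV[R]_p.+1) (E : Z -> 'M[R]_p.+1).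
Variables (lam : Z -> 'I_p.+1 -> R) (u : Z -> 'I_p.+1 -> 'I_p.+1 -> R).

(** A lower bound for the distance of a point of the interval between [rho^-1] and
    [rho] to any point outside of the interval between [rho ^- 3] and [rho ^+ 3]. *)
Definition gap : R := (rho - 1) / rho ^+ 3.
Definition off_bound : R := p.+1%:R * K ^+ 2 / gap.

Hypothesis t01 : forall z, 0 <= t z <= 1.
Hypothesis tsmall : forall z, 2 * p.+1%:R * off_bound ^+ 2 * t z <= 1.
Hypothesis Et : forall z i j, `|E z i j| <= t z.
Hypothesis ell0 : forall z i, 0 < ell z 0 i.
Hypothesis ellK : forall z i j, ell z 0 i <= K * ell z 0 j.
Hypothesis ellrho : forall z (i j : 'I_p.+1), (i < j)%N -> rho ^+ 2 * ell z 0 j <= ell z 0 i.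
Hypothesis lam_bounds : forall z i,
  ell z 0 i ^+ 2 / rho < lam z i < rho * ell z 0 i ^+ 2.
Hypothesis unit_u : forall z i, \sum_j u z i j ^+ 2 = 1.
Hypothesis pos_u : forall z i, 0 <= u z i i.
Hypothesis eig_u : forall z i j,
  ell z 0 j * \sum_k ((j == k)%:R + E z j k) * (ell z 0 k * u z i k) = lam z i * u z i j.

Let x z i j : R := ell z 0 j / ell z 0 i.
Let om z i : R := lam z i / ell z 0 i ^+ 2.

Let rho0 : 0 < rho. Proof. exact: lt_trans ltr01 rho1. Qed.
Let gap0 : 0 < gap. Proof. by rewrite divr_gt0 ?exprn_gt0 // subr_gt0. Qed.
Let K0 : 0 < K. Proof. exact: lt_le_trans K1. Qed.
Let t0 z : 0 <= t z. Proof. by case/andP: (t01 z). Qed.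

Let ell2 z i : 0 < ell z 0 i ^+ 2. Proof. by rewrite exprn_gt0. Qed.

Let x0 z i j : 0 < x z i j. Proof. by rewrite divr_gt0. Qed.
Let xK z i j : x z i j <= K. Proof. by rewrite ler_pdivrMr. Qed.

Let om_lo z i : rho^-1 < om z i.
Proof. by have /andP[h _] := lam_bounds z i; rewrite ltr_pdivlMr // mulrC. Qed.
Let om_hi z i : om z i < rho.
Proof. by have /andP[_ h] := lam_bounds z i; rewrite ltr_pdivrMr. Qed.
Let om0 z i : 0 < om z i. Proof. by apply: lt_trans (om_lo z i); rewrite invr_gt0. Qed.

Let x_small z (i j : 'I_p.+1) : (i < j)%N -> x z i j ^+ 2 <= rho ^- 4.
Proof.
move=> ij; rewrite /x expr_div_n ler_pdivrMr // ler_pdivlMl ?exprn_gt0 //.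
rewrite -[4%N]/(2 * 2)%N exprM -exprMn lerXn2r ?nnegrE ?ellrho //; last exact: ltW.
by rewrite mulr_ge0 ?(ltW (ell0 _ _)) // exprn_ge0 // ltW.
Qed.

Let x_large z (i j : 'I_p.+1) : (j < i)%N -> rho ^+ 4 <= x z i j ^+ 2.
Proof.
move=> ji; rewrite /x expr_div_n ler_pdivlMr //.
rewrite -[4%N]/(2 * 2)%N exprM -exprMn lerXn2r ?nnegrE ?ellrho //; last exact: ltW.
by rewrite mulr_ge0 ?(ltW (ell0 _ _)) // exprn_ge0 // ltW.
Qed.

Let ri0 : 0 < rho^-1. Proof. by rewrite invr_gt0. Qed.
Let ri1 : rho^-1 < 1. Proof. by rewrite invf_lt1. Qed.

Let gapE : gap = rho^-1 ^+ 2 * (1 - rho^-1).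
Proof. by rewrite /gap; field; rewrite gt_eqF. Qed.

Let far_num (y : R) : rho^-1 < y -> y < rho -> forall w : R,
  (w <= rho^-1 ^+ 3 \/ rho ^+ 3 <= w) -> gap <= `|y - w|.
Proof.
move=> y1 y2 w; have h1 := ri0; have h2 := ri1; have h3 := rho1; have h4 := rho0.
have rr : rho * rho^-1 = 1 by rewrite divff // gt_eqF.
rewrite gapE; set q := rho^-1 in y1 h1 h2 rr *.
have q2 : q ^+ 2 <= q by rewrite expr2; nra.
have q2' : 0 < q ^+ 2 by rewrite exprn_gt0.
move=> [hw|hw].
  have : q ^+ 3 <= q ^+ 2 by rewrite ler_wiXn2l // ltW.
  move=> q3; rewrite ger0_norm; first by rewrite mulrBr mulr1 -exprSr; lra.
  by rewrite subr_ge0 (le_trans hw) // (le_trans q3) // (le_trans q2) // ltW.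
have r2 : rho ^+ 2 <= rho ^+ 3 by rewrite ler_weXn2l // ltW.
have r1 : rho + (rho - 1) <= rho ^+ 2 by have := sqr_ge0 (rho - 1); rewrite sqrrB; lra.
have q1 : 1 - q <= rho - 1 by nra.
have q3 : q ^+ 2 * (1 - q) <= 1 - q by nra.
by rewrite ler0_norm; lra.
Qed.

Let far_om z (i j : 'I_p.+1) : j != i -> gap <= `|om z i - x z i j ^+ 2|.
Proof.
move=> ji; apply: far_num; [exact: om_lo|exact: om_hi|].
have [lt|lt|/ord_inj e] := ltngtP i j; last by rewrite e eqxx in ji.
  left; apply: le_trans (x_small z lt) _.
  by rewrite -exprVn ler_wiXn2l // ltW.
by right; apply: le_trans (x_large z lt); rewrite ler_weXn2l // ltW.
Qed.

Let far_1 z (i j : 'I_p.+1) : j != i -> gap <= `|1 - x z i j ^+ 2|.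
Proof.
move=> ji; apply: far_num => //.
have [lt|lt|/ord_inj e] := ltngtP i j; last by rewrite e eqxx in ji.
  left; apply: le_trans (x_small z lt) _.
  by rewrite -exprVn ler_wiXn2l // ltW.
by right; apply: le_trans (x_large z lt); rewrite ler_weXn2l // ltW.
Qed.

(* The two eigenvalues are separated because the intervals are: this is where
   the gap [rho ^+ 2] between the singular values exceeds the width [rho] of the
   intervals. *)
Let far_om_om z (i j : 'I_p.+1) : j != i -> gap <= `|om z i - om z j * x z i j ^+ 2|.
Proof.
move=> ji; apply: far_num; [exact: om_lo|exact: om_hi|].
have h4 := rho0; have rr : rho * rho^-1 = 1 by rewrite divff // gt_eqF.
have [lt|lt|/ord_inj e] := ltngtP i j; last by rewrite e eqxx in ji.
  left; have -> : rho^-1 ^+ 3 = rho * rho ^- 4 by field; rewrite gt_eqF.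
  by rewrite ler_pM ?sqr_ge0 ?x_small // ltW.
right; have -> : rho ^+ 3 = rho^-1 * rho ^+ 4 by field; rewrite gt_eqF.
by rewrite ler_pM ?x_large ?exprn_ge0 // ltW.
Qed.

Let u_le1 z i j : `|u z i j| <= 1.
Proof.
rewrite -(expr_le1 (n := 2)) // real_normK ?num_real // -(unit_u z i) (bigD1 j) //=.
by rewrite lerDl sumr_ge0 // => k _; exact: sqr_ge0.
Qed.

Let eig_normalized z i j :
  (om z i - x z i j ^+ 2) * u z i j = x z i j * \sum_k E z j k * (x z i k * u z i k).
Proof.
have ei : ell z 0 i != 0 by rewrite gt_eqF.
have -> : \sum_k E z j k * (x z i k * u z i k) =
   (ell z 0 i)^-1 * \sum_k E z j k * (ell z 0 k * u z i k).
  by rewrite mulr_sumr; apply: eq_bigr => k _; rewrite /x; ring.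
have := eig_u z i j.
under eq_bigr => k _ do rewrite mulrDl.
rewrite big_split /= (bigD1 j) //= big1 => [|k kj]; last first.
  by rewrite eq_sym (negbTE kj) mul0r.
rewrite eqxx mul1r addr0; set S := \sum_k _ => h.
have -> : (om z i - x z i j ^+ 2) * u z i j =
   (lam z i * u z i j) / ell z 0 i ^+ 2 - x z i j ^+ 2 * u z i j by rewrite /om; ring.
by rewrite -h /x; field.
Qed.

(* The relative eigenvalue keeps the distance [gap] from the other unperturbed
   ones; hence the coordinates on the other eigenvectors are of order [t]. *)
Let off_le z (i j : 'I_p.+1) : j != i -> `|u z i j| <= off_bound * t z.
Proof.
move=> ji.
have g_le : `|\sum_k E z j k * (x z i k * u z i k)| <= p.+1%:R * (t z * K).
  apply: le_trans (ler_norm_sum _ _ _) _.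
  rewrite -[p.+1%:R * _](_ : \sum_(k < p.+1) t z * K = _); last first.
    by rewrite sumr_const card_ord -[LHS]mulr_natl.
  apply: ler_sum => k _; rewrite (normrM (E z j k)) ler_pM //.
  by rewrite (normrM (x z i k)) -[K]mulr1 ler_pM // ger0_norm // ltW.
have : gap * `|u z i j| <= K * (p.+1%:R * (t z * K)).
  apply: le_trans (_ : `|(om z i - x z i j ^+ 2) * u z i j| <= _).
    by rewrite normrM ler_wpM2r // far_om.
  by rewrite eig_normalized normrM ler_pM // ger0_norm // ltW.
rewrite -ler_pdivlMl // => h; apply: le_trans h _.
by rewrite /off_bound le_eqVlt; apply/orP; left; apply/eqP; ring.
Qed.

Let defect_le z i : 1 - u z i i <= p.+1%:R * off_bound ^+ 2 * t z ^+ 2.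
Proof.
have u1 : u z i i <= 1 by have := u_le1 z i i; rewrite ger0_norm.
have h : 1 - u z i i <= 1 - u z i i ^+ 2.
  by have := pos_u z i; rewrite expr2; nra.
apply: le_trans h _; rewrite -[in leLHS](unit_u z i) (bigD1 i) //= addrAC subrr add0r.
apply: le_trans (_ : \sum_(j < p.+1) (off_bound * t z) ^+ 2 <= _); last first.
  by rewrite sumr_const card_ord -[leLHS]mulr_natl exprMn mulrA.
apply: le_trans (_ : \sum_(j | j != i) (off_bound * t z) ^+ 2 <= _).
  apply: ler_sum => j ji; rewrite -[leLHS]real_normK ?num_real //.
  by rewrite lerXn2r ?nnegrE ?off_le // (le_trans _ (off_le z ji)).
by rewrite [leRHS](bigD1 i) //= lerDr sqr_ge0.
Qed.

Let u_half z i : 2^-1 <= u z i i.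
Proof.
have := defect_le z i; have := tsmall z; have /andP[h0 h1] := t01 z.
have : 0 <= p.+1%:R * off_bound ^+ 2 :> R by rewrite mulr_ge0 ?sqr_ge0.
rewrite -[2 * _ * _]mulrA; set c := p.+1%:R * off_bound ^+ 2.
rewrite -[2 * _ * _]mulrA [t z ^+ 2]expr2 => c0 h2 h3.
have : c * (t z * t z) <= c * t z by rewrite ler_wpM2l // ler_piMr.
lra.
Qed.

Local Notation O := (isO t).

Lemma O_pert j k : O (fun z => E z j k) 1.
Proof. by exists 1 => z; rewrite mul1r expr1. Qed.

Lemma O_ratio i j : O (fun z => x z i j) 0.
Proof. by apply: (@isO_bounded _ _ _ _ K) => z; rewrite ger0_norm // ltW. Qed.

Lemma O_off (i j : 'I_p.+1) : j != i -> O (fun z => u z i j) 1.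
Proof. by move=> ji; exists off_bound => z; rewrite expr1 off_le. Qed.

Lemma O_defect i : O (fun z => u z i i - 1) 2.
Proof.
exists (p.+1%:R * off_bound ^+ 2) => z; rewrite distrC ger0_norm ?defect_le //.
by rewrite subr_ge0; have := u_le1 z i i; rewrite ger0_norm.
Qed.

Let rest z i j := \sum_(k | k != i) E z j k * (x z i k * u z i k).

Let O_rest i j : O (fun z => rest z i j) 2.
Proof.
apply: isO_sum => k ki; apply: (isO_M (e1 := 1) (e2 := 1)) => //; first exact: O_pert.
by apply: (isO_M (e1 := 0) (e2 := 1)) => //; [exact: O_ratio|exact: O_off].
Qed.

Let eig_split z i j :
  (om z i - x z i j ^+ 2) * u z i j = x z i j * (E z j i * u z i i + rest z i j).
Proof.
rewrite eig_normalized (bigD1 i) //= -/(rest z i j); congr (_ * (_ * _ + _)).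
by rewrite /x divff ?mul1r // gt_eqF.
Qed.

Let O_om i : O (fun z => om z i - 1 - E z i i) 2.
Proof.
have h : O (fun z => (u z i i)^-1) 0.
  apply: (@isO_inv _ _ _ _ 2^-1) => // z.
  by rewrite ger0_norm // u_half.
apply: isO_eq (isO_M (e := 2) (e1 := 2) (e2 := 0) _ (O_rest i i) h) => // z.
have := eig_split z i i; rewrite {1 2}/x divff ?gt_eqF // expr1n mul1r => e.
have ui : u z i i != 0 by rewrite gt_eqF // (lt_le_trans _ (u_half z i)).
apply: (mulIf ui); rewrite divfK // mulrBl e; ring.
Qed.

Lemma O_eigval_rel i : O (fun z => om z i - 1) 1.
Proof.
apply: isO_eq (isO_D (isO_le t01 (_ : (1 <= 2)%N) (O_om i)) (O_pert i i)) => // z.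
by ring.
Qed.

Lemma O_om0 i : O (fun z => om z i) 0.
Proof. by apply: (@isO_bounded _ _ _ _ rho) => z; rewrite gtr0_norm // ltW. Qed.

Let O_omV i : O (fun z => (om z i)^-1) 0.
Proof.
apply: (@isO_inv _ _ _ _ rho^-1) => // z; by rewrite gtr0_norm // ltW.
Qed.

(** First order expansion: the diagonal coordinate is one up to a second order
    term, and the other terms of the eigenvalue equation are of second order. *)
Lemma O_eigval i : O (fun z => (lam z i)^-1 * (lam z i - ell z 0 i ^+ 2) - E z i i) 2.
Proof.
have h1 := O_eigval_rel i.
have h2 := isO_M (erefl (1 + 1)%N) h1 h1.
apply: isO_eq (isO_B (O_om i) (isO_M (e := 2) (e1 := 2) (e2 := 0) _ h2 (O_omV i))) => // z.
have o0 : om z i != 0 by rewrite gt_eqF.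
have e0 : ell z 0 i != 0 by rewrite gt_eqF.
have -> : lam z i = om z i * ell z 0 i ^+ 2 by rewrite /om divfK // expf_neq0.
by field; rewrite o0 e0.
Qed.

Lemma O_gapV (i j : 'I_p.+1) : j != i -> O (fun z => (1 - x z i j ^+ 2)^-1) 0.
Proof. by move=> ji; apply: (@isO_inv _ _ _ _ gap) => // z; exact: far_1. Qed.

Let coef z i j := ell z 0 i * ell z 0 j / (ell z 0 i ^+ 2 - ell z 0 j ^+ 2).

Let gap_neq0 z (i j : 'I_p.+1) : j != i -> 1 - x z i j ^+ 2 != 0.
Proof. by move=> ji; rewrite -normr_gt0 (lt_le_trans gap0) // far_1. Qed.

Let coefE z (i j : 'I_p.+1) : j != i -> coef z i j = x z i j / (1 - x z i j ^+ 2).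
Proof.
move=> ji; have := gap_neq0 z ji; rewrite /coef /x => h.
have e0 : ell z 0 i != 0 by rewrite gt_eqF.
have h' : ell z 0 i ^+ 2 - ell z 0 j ^+ 2 != 0.
  apply: contra h => /eqP h; apply/eqP; rewrite expr_div_n.
  have -> : ell z 0 j ^+ 2 = ell z 0 i ^+ 2 by apply/eqP; rewrite eq_sym -subr_eq0 h.
  by rewrite divff ?subrr // expf_neq0.
by field; rewrite e0 h'.
Qed.

(** The equation for the coordinate [j] of the eigenvector [i] gives its first
    order part, once the relative eigenvalue is replaced by one. *)
Lemma O_eigvec (i j : 'I_p.+1) : j != i -> O (fun z => u z i j - coef z i j * E z j i) 2.
Proof.
move=> ji.
have h1 : O (fun z => x z i j * (E z j i * (u z i i - 1) + rest z i j)) 2.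
  apply: (isO_M (e1 := 0) (e2 := 2)) => //; first exact: O_ratio.
  apply: isO_D; last exact: O_rest.
  apply: (@isO_le _ _ _ t01 _ 3) => //.
  by apply: (isO_M (e1 := 1) (e2 := 2)) => //; [exact: O_pert|exact: O_defect].
have h2 := isO_M (erefl (1 + 1)%N) (O_eigval_rel i) (O_off ji).
apply: isO_eq (isO_M (e := 2) (e1 := 2) (e2 := 0) _ (isO_B h1 h2) (O_gapV ji)) => // z.
rewrite coefE //; have g0 := gap_neq0 z ji.
apply: (mulIf g0); rewrite divfK //.
have e : u z i j * (1 - x z i j ^+ 2) = (om z i - x z i j ^+ 2) * u z i j - (om z i - 1) * u z i j by ring.
by rewrite [RHS]mulrBl e eig_split; field.
Qed.

Lemma O_coef (i j : 'I_p.+1) : j != i -> O (fun z => coef z i j) 0.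
Proof.
move=> ji; apply: isO_eq (isO_M (e := 0) (e1 := 0) (e2 := 0) _ (O_ratio i j) (O_gapV ji)) => // z.
by rewrite coefE.
Qed.

(** With [a], [b] the relative eigenvalues and [y] the squared ratio of singular
    values, this is the difference between [a * b * y / (a - b * y) ^+ 2] and its
    value at [a = b = 1], written with the factors [a - 1] and [b - 1]. *)
Lemma O_weight (i j : 'I_p.+1) : j != i ->
  O (fun z => lam z i * lam z j / (lam z i - lam z j) ^+ 2 - coef z i j ^+ 2) 1.
Proof.
move=> ji; pose a z := om z i; pose b z := om z j; pose y z := x z i j ^+ 2.
have hy : O y 0 by apply: isO_eq (isO_M (e := 0) (e1 := 0) (e2 := 0) _ (O_ratio i j) (O_ratio i j)) => // z; rewrite expr2.
have ha : O (fun z => a z - 1) 1 by exact: O_eigval_rel.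
have hb : O (fun z => b z - 1) 1 by exact: O_eigval_rel.
have ha0 : O a 0 by exact: O_om0.
have hb0 : O b 0 by exact: O_om0.
have h1 : O (fun z => 1 - y z) 0 by apply: isO_B => //; exact: isO_cst.
have h2 : O (fun z => a z - b z * y z) 0.
  by apply: isO_B => //; exact: (isO_M (e1 := 0) (e2 := 0)).
have d1 : O (fun z => (1 - y z)^-1) 0 by exact: O_gapV.
have d2 : O (fun z => (a z - b z * y z)^-1) 0.
  by apply: (@isO_inv _ _ _ _ gap) => // z; exact: far_om_om.
have s1 : O (fun z => (a z - 1) * b z + (b z - 1)) 1.
  by apply: isO_D => //; exact: (isO_M (e1 := 1) (e2 := 0)).
have s2 : O (fun z => (b z - 1) * y z - (a z - 1)) 1.
  by apply: isO_B => //; exact: (isO_M (e1 := 1) (e2 := 0)).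
have n1 : O (fun z => ((a z - 1) * b z + (b z - 1)) * ((1 - y z) * (1 - y z))) 1.
  by apply: (isO_M (e1 := 1) (e2 := 0)) => //; exact: (isO_M (e1 := 0) (e2 := 0)).
have n2 : O (fun z => ((b z - 1) * y z - (a z - 1)) * ((1 - y z) + (a z - b z * y z))) 1.
  by apply: (isO_M (e1 := 1) (e2 := 0)) => //; exact: isO_D.
have dd : O (fun z => y z * ((1 - y z)^-1 * (1 - y z)^-1 * ((a z - b z * y z)^-1 * (a z - b z * y z)^-1))) 0.
  by do ?[apply: (isO_M (e1 := 0) (e2 := 0)) => //].
apply: isO_eq (isO_M (e := 1) (e1 := 1) (e2 := 0) _ (isO_D n1 n2) dd) => // z.
have g1 := gap_neq0 z ji; rewrite -/(y z) in g1.
have g2 : a z - b z * y z != 0 by rewrite -normr_gt0 (lt_le_trans gap0) // far_om_om.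
have ei : ell z 0 i != 0 by rewrite gt_eqF.
have ej : ell z 0 j != 0 by rewrite gt_eqF.
rewrite coefE // expr_div_n -/(y z).
have -> : lam z i = a z * ell z 0 i ^+ 2 by rewrite /a /om divfK // expf_neq0.
have -> : lam z j = b z * y z * ell z 0 i ^+ 2 by rewrite /b /om /y /x; field; rewrite ei ej.
rewrite -[a z * _ - _]mulrBl.
set D := a z - b z * y z in g2 *; set F := 1 - y z in g1 *.
have -> : a z = D + b z * y z by rewrite /D; ring.
have -> : y z = 1 - F by rewrite /F; ring.
field.
by rewrite ei g1 g2.
Qed.

End Expansion.

(** * The error of the sketched Gram matrix *)

Section Hadamard.
Variable R : realType.

Lemma hadamard_step (n N : nat) (e : (n + n)%N = N) (H : 'M[R]_n) (c : R) :
  H^T = H -> H *m H = 1%:M -> (forall i j, H i j ^+ 2 = c) ->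
  let G := (Num.sqrt 2)^-1 *: castmx (e, e) (block_mx H H H (- H)) in
  [/\ G^T = G, G *m G = 1%:M & forall i j, G i j ^+ 2 = 2^-1 * c].
Proof.
move=> HT HH Hc G; rewrite {}/G; case: N / e; rewrite castmx_id.
have s2 : (Num.sqrt 2)^-1 * (Num.sqrt 2)^-1 = 2^-1 :> R.
  by rewrite -invfM -expr2 sqr_sqrtr.
split.
- by rewrite linearZ /= tr_block_mx linearN /= HT.
- rewrite -scalemxAl -scalemxAr scalerA s2 mulmx_block !mulmxN !mulNmx opprK HH subrr.
  apply/matrixP => i j; rewrite mxE.
  case: (split_ordP i) => i' ->; case: (split_ordP j) => j' ->.
  + rewrite block_mxEul !mxE eq_lshift; case: eqP => _; rewrite ?mulr1n ?mulr0n; by field.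
  + by rewrite block_mxEur !mxE eq_lrshift mulr0n; ring.
  + by rewrite block_mxEdl !mxE eq_rlshift mulr0n; ring.
  + rewrite block_mxEdr !mxE eq_rshift; case: eqP => _; rewrite ?mulr1n ?mulr0n; by field.
- move=> i j; rewrite mxE exprMn [(Num.sqrt 2)^-1 ^+ 2]expr2 s2; congr (_ * _).
  case: (split_ordP i) => i' ->; case: (split_ordP j) => j' ->.
  + by rewrite block_mxEul.
  + by rewrite block_mxEur.
  + by rewrite block_mxEdl.
  + by rewrite block_mxEdr mxE sqrrN.
Qed.

Lemma hadamard_props (l : nat) : let H := hadamard R l in
  [/\ H^T = H, H *m H = 1%:M & forall i j, H i j ^+ 2 = (2 ^ l)%:R^-1].
Proof.
elim: l => [|l [HT HH Hc]] /=.
  rewrite trmx1 mul1mx; split=> // i j.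
  by rewrite mxE !ord1 eqxx expr1n invr1.
have [h1 h2 h3] := hadamard_step (hadamard_dim l) HT HH Hc.
by split=> // i j; rewrite h3 expnS natrM invfM.
Qed.

(** The Hadamard matrix with entries 1 and -1. *)
Definition hsign (l : nat) : 'M[R]_(2 ^ l) := Num.sqrt (2 ^ l)%:R *: hadamard R l.

Let n0 (l : nat) : (2 ^ l)%:R != 0 :> R.
Proof. by rewrite pnatr_eq0 -lt0n expn_gt0. Qed.

Lemma hsign_sqr l j i : hsign l j i ^+ 2 = 1.
Proof.
have [_ _ h] := hadamard_props l.
by rewrite mxE exprMn sqr_sqrtr // h divff.
Qed.

Lemma hsign_row l j j' : \sum_i hsign l j i * hsign l j' i = (2 ^ l)%:R * (j == j')%:R.
Proof.
have [hT hH _] := hadamard_props l.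
have /matrixP/(_ j j') := hH; rewrite -{2}hT !mxE => <-; rewrite mulr_sumr.
apply: eq_bigr => i _; rewrite !mxE.
have sn : Num.sqrt (2 ^ l)%:R ^+ 2 = (2 ^ l)%:R :> R by rewrite sqr_sqrtr.
by ring: sn.
Qed.

Lemma hsign_col l i i' : \sum_j hsign l j i * hsign l j i' = (2 ^ l)%:R * (i == i')%:R.
Proof.
have [hT _ _] := hadamard_props l.
have hs a b' : hsign l a b' = hsign l b' a by rewrite !mxE -[in LHS]hT mxE.
by rewrite -hsign_row; apply: eq_bigr => j _; rewrite hs [hsign l j i']hs.
Qed.

End Hadamard.

(** The two random diagonals of the sketch, read off a configuration. *)
Definition srht_of (R : realType) (l m : nat) (s : {ffun 'I_(2 ^ l) + 'I_(2 ^ l) -> bool}) :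
    'M[R]_(2 ^ l) :=
  srht m (\row_j (if s (inl j) then 1 else 0)) (\row_j sgn R s j).

Section Gram.
Variables (R : realType) (l m q : nat) (U : 'M[R]_(2 ^ l, q)).
Hypothesis m0 : (0 < m)%N.
Hypothesis orthU : U^T *m U = 1%:M.
Let n := (2 ^ l)%N.
Let g : R := m%:R / n%:R.

Let nR : n%:R != 0 :> R. Proof. by rewrite pnatr_eq0 -lt0n expn_gt0. Qed.
Let mR : m%:R != 0 :> R. Proof. by rewrite pnatr_eq0 -lt0n. Qed.

Definition cmb (a : 'I_q -> R) (i : 'I_n) : R := \sum_c U i c * a c.

(** The error of the sketched Gram matrix, as a bilinear form in two coefficient
    vectors: a sum over the rows, weighted by the centered sampling variables. *)
Definition gram_err (a b : 'I_q -> R) (s : {ffun 'I_n + 'I_n -> bool}) : R :=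
  n%:R^-1 * \sum_j csamp g s j * (lin (hsign R l) (cmb a) j s * lin (hsign R l) (cmb b) j s).

Lemma sum_cmb (a b : 'I_q -> R) : \sum_i cmb a i * cmb b i = \sum_c a c * b c.
Proof.
transitivity (\sum_c \sum_c' (a c * b c') * \sum_i U i c * U i c').
  transitivity (\sum_i \sum_c \sum_c' (a c * b c') * (U i c * U i c')).
    apply: eq_bigr => i _; rewrite mulr_suml; apply: eq_bigr => c _.
    by rewrite mulr_sumr; apply: eq_bigr => c' _; ring.
  rewrite exchange_big; apply: eq_bigr => c _; rewrite exchange_big.
  by apply: eq_bigr => c' _; rewrite mulr_sumr.
apply: eq_bigr => c _; rewrite (bigD1 c) //= [X in _ + X]big1 => [|c' c'c].
  have /matrixP/(_ c c) := orthU; rewrite !mxE eqxx => e.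
  by rewrite -[RHS]mulr1 -[X in _ = _ * X]e addr0; congr (_ * _); apply: eq_bigr => i _; rewrite mxE.
have /matrixP/(_ c c') := orthU; rewrite !mxE eq_sym (negbTE c'c) => e.
by rewrite -[RHS](mulr0 (a c * b c')) -[X in _ = _ * X]e; congr (_ * _); apply: eq_bigr => i _; rewrite mxE.
Qed.

(** The transform is orthogonal, so the centering term of the sampling variables
    accounts for the identity matrix. *)
Lemma gram_srht (s : {ffun 'I_n + 'I_n -> bool}) :
  U^T *m (srht_of R m s)^T *m srht_of R m s *m U
  = 1%:M + \matrix_(c, c') gram_err (fun k => (k == c)%:R) (fun k => (k == c')%:R) s.
Proof.
pose Y : 'M[R]_(n, q) := hadamard R l *m diag_mx (\row_j sgn R s j) *m U.
have cmbE c i : cmb (fun k => (k == c)%:R) i = U i c.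
  rewrite /cmb (bigD1 c) //= eqxx mulr1 big1 ?addr0 // => k kc.
  by rewrite (negbTE kc) mulr0.
have linE c j : lin (hsign R l) (cmb (fun k => (k == c)%:R)) j s = Num.sqrt n%:R * Y j c.
  rewrite /lin /Y !mxE mulr_sumr; apply: eq_bigr => i _.
  by rewrite mul_mx_diag cmbE !mxE; ring.
have sn : Num.sqrt n%:R * Num.sqrt n%:R = n%:R :> R by rewrite -expr2 sqr_sqrtr.
have -> : U^T *m (srht_of R m s)^T *m srht_of R m s *m U = (srht_of R m s *m U)^T *m (srht_of R m s *m U).
  by rewrite trmx_mul !mulmxA.
have -> : srht_of R m s *m U = Num.sqrt (n%:R / m%:R) *: (diag_mx (\row_j (if s (inl j) then 1 else 0)) *m Y).
  by rewrite /srht_of /srht -scalemxAl /Y !mulmxA.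
rewrite [(_ *: _)^T]linearZ /= -scalemxAl -scalemxAr scalerA -expr2 sqr_sqrtr ?divr_ge0 //.
apply/matrixP => c c'.
rewrite !mxE /gram_err.
have -> : (c == c')%:R = n%:R^-1 * \sum_j (Num.sqrt n%:R * Y j c) * (Num.sqrt n%:R * Y j c').
  under eq_bigr => j _ do rewrite -!linE.
  rewrite (sum_lin_lin (@hsign_sqr R l) (@hsign_col R l)) mulKf // sum_cmb (bigD1 c) //= eqxx mul1r.
  by rewrite big1 ?addr0 // => k kc; rewrite (negbTE kc) mul0r.
rewrite -mulrDr -big_split /= mulr_sumr [RHS]mulr_sumr.
apply: eq_bigr => j _; rewrite !linE /csamp /g.
have dE k : (diag_mx (\row_j (if s (inl j) then 1 else 0)) *m Y) j k = (if s (inl j) then 1 else 0) * Y j k.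
  by rewrite mul_diag_mx mxE [X in X * _]mxE.
rewrite [(_^T) c j]mxE !dE.
have -> : Num.sqrt n%:R * Y j c * (Num.sqrt n%:R * Y j c') = n%:R * (Y j c * Y j c').
  by rewrite mulrACA sn.
by case: (s _); field; rewrite ?nR ?mR.
Qed.

Lemma gram_errE (a b : 'I_q -> R) s :
  gram_err a b s = \sum_c \sum_c' a c * b c' * gram_err (fun k => (k == c)%:R) (fun k => (k == c')%:R) s.
Proof.
have cmbE c i : cmb (fun k => (k == c)%:R) i = U i c.
  rewrite /cmb (bigD1 c) //= eqxx mulr1 big1 ?addr0 // => k kc.
  by rewrite (negbTE kc) mulr0.
have linE d j : lin (hsign R l) (cmb d) j s =
   \sum_c d c * lin (hsign R l) (cmb (fun k => (k == c)%:R)) j s.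
  rewrite /lin; under [RHS]eq_bigr => c _ do rewrite mulr_sumr.
  rewrite exchange_big; apply: eq_bigr => i _ /=.
  rewrite {1}/cmb mulr_sumr mulr_suml; apply: eq_bigr => c _.
  by rewrite cmbE; ring.
rewrite /gram_err mulr_sumr.
under [RHS]eq_bigr => c _ do under eq_bigr => c' _ do rewrite !mulr_sumr.
under [RHS]eq_bigr => c _ do rewrite exchange_big.
rewrite [RHS]exchange_big; apply: eq_bigr => j _ /=.
rewrite (linE a) (linE b) mulr_suml !mulr_sumr; apply: eq_bigr => c _.
move: (csamp _ _ _) n%:R^-1 (lin _ _ _ _) => e r y.
by rewrite !mulr_sumr; apply: eq_bigr => c' _; move: (lin _ _ _ _) => y'; ring.
Qed.

Hypothesis mn : (m < n)%N.

Let n_gt0 : 0 < n%:R :> R. Proof. by rewrite lt0r nR ler0n. Qed.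
Let m_gt0 : 0 < m%:R :> R. Proof. by rewrite lt0r mR ler0n. Qed.

Let g01 : 0 < g <= 1.
Proof. by rewrite divr_gt0 //= ler_pdivrMr // mul1r ler_nat ltnW. Qed.

Let g01' : 0 <= g <= 1. Proof. by case/andP: g01 => /ltW -> ->. Qed.

Let g1 : 0 < 1 - g.
Proof. by rewrite subr_gt0 ltr_pdivrMr // mul1r ltr_nat. Qed.

Local Notation E := (Ex (@qs R n g)).
Local Notation hs := (hsign R l).

Variables a b : 'I_q -> R.
Hypotheses (a1 : \sum_c a c ^+ 2 = 1) (b1 : \sum_c b c ^+ 2 = 1).

Let A2 d : \sum_i cmb d i ^+ 2 = \sum_c d c ^+ 2.
Proof.
under eq_bigr do rewrite expr2.
by rewrite sum_cmb; apply: eq_bigr => c _; rewrite expr2.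
Qed.

Let young6 (y z : R) : `|y * z| ^+ 3 <= 2^-1 * (y ^+ 6 + z ^+ 6).
Proof.
rewrite -[leLHS]ger0_norm ?exprn_ge0 // normrX normr_id normrM exprMn.
have e (w : R) : w ^+ 6 = (`|w| ^+ 3) ^+ 2.
  by rewrite -[LHS]ger0_norm ?normrX -?exprM // -[6%N]/(3 * 2)%N exprM sqr_ge0.
by rewrite !e; have := sqr_ge0 (`|y| ^+ 3 - `|z| ^+ 3); rewrite sqrrB; lra.
Qed.

Let young4 (y z : R) : (y * z) ^+ 2 <= 2^-1 * (y ^+ 4 + z ^+ 4).
Proof.
have e (w : R) : w ^+ 4 = (w ^+ 2) ^+ 2 by rewrite -exprM.
by rewrite exprMn !e; have := sqr_ge0 (y ^+ 2 - z ^+ 2); rewrite sqrrB; lra.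
Qed.

Let lin_inl d j s i c : lin hs (cmb d) j (upd s (inl i) c) = lin hs (cmb d) j s.
Proof. exact: lin_upd_inl. Qed.

(** The variance of the sampling variables multiplies a sum of squared products,
    and Young's inequality reduces these to the fourth moments of the entries of
    the two transformed vectors. *)
Lemma gram_err_second_moment : E (fun s => gram_err a b s ^+ 2) <= 3 / m%:R.
Proof.
pose x j s := n%:R^-1 * (lin hs (cmb a) j s * lin hs (cmb b) j s).
have xinl j s i c : x j (upd s (inl i) c) = x j s by rewrite /x !lin_inl.
rewrite (eq_Ex _ (G := fun s => csum g x s ^+ 2)) => [|s]; last first.
  by rewrite /gram_err /csum mulr_sumr; congr (_ ^+ 2); apply: eq_bigr => j _; rewrite /x; ring.
rewrite Ex_csum_sqr //.
have h : \sum_j E (fun s => x j s ^+ 2) <= n%:R^-1 * 3.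
  rewrite -[n%:R^-1](mulKf nR) mulrCA -mulrA mulr_natl -[X in _ *+ X]card_ord -sumr_const.
  apply: ler_sum => j _.
  apply: le_trans (_ : E (fun s => n%:R^-1 ^+ 2 * (2^-1 * (lin hs (cmb a) j s ^+ 4 + lin hs (cmb b) j s ^+ 4))) <= _).
    apply: le_Ex => [|s]; first exact: qs01.
    by rewrite /x exprMn ler_wpM2l ?sqr_ge0.
  rewrite ExZ ExZ ExD (Ex_lin4 _ (@hsign_sqr R l) (cmb a)) (Ex_lin4 _ (@hsign_sqr R l) (cmb b)).
  rewrite !A2 a1 b1 -expr2; apply: ler_wpM2l; first exact: sqr_ge0.
  have s4 d : 0 <= \sum_i cmb d i ^+ 4.
    by apply: sumr_ge0 => i _; rewrite -[4%N]/(2 * 2)%N exprM sqr_ge0.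
  by rewrite expr1n; have := s4 a; have := s4 b; lra.
have g0 : 0 < g by case/andP: g01.
apply: le_trans (ler_wpM2l _ h) _; first by rewrite divr_ge0 // ltW.
rewrite /g; have -> : (1 - m%:R / n%:R) / (m%:R / n%:R) * (n%:R^-1 * 3) = (1 - m%:R / n%:R) * (3 / m%:R) :> R.
  by field; rewrite nR mR.
by rewrite ler_piMl ?divr_ge0 // lerBlDr lerDl divr_ge0.
Qed.

(** The statistic is normalized by the limit of its conditional variance. *)
Let r := \sum_c a c * b c.
Let sigma2 := 1 + 2 * r ^+ 2.
Let tau := Num.sqrt (m%:R / (1 - g)) / Num.sqrt sigma2.

Let sigma2_ge1 : 1 <= sigma2.
Proof. by rewrite /sigma2 lerDl mulr_ge0 // sqr_ge0. Qed.

(** The bound of [Ex_quart_dist] for a vector of squared norm at most 4 whose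
    entries are at most [2 * Num.sqrt M] in modulus, such as [cmb a + cmb b]. *)
Definition quart_bound (M : R) : R := Num.sqrt (42 * 32 * (4 * M) * 64) + 2 * (4 * M) * 4.

Let quart_dist (al : 'I_n -> R) (M : R) : (forall i, al i ^+ 2 <= 4 * M) ->
  \sum_i al i ^+ 2 <= 4 ->
  E (fun s => `|quart hs al s - 3 * (\sum_i al i ^+ 2) ^+ 2|) <= quart_bound M.
Proof.
move=> alM al4; have n_pos : (0 < n)%N by rewrite expn_gt0.
apply: le_trans (Ex_quart_dist g01' (@hsign_sqr R l) (@hsign_row R l) (@hsign_col R l) n_pos alM) _.
have M0 : 0 <= 4 * M by apply: le_trans (alM (Ordinal n_pos)); exact: sqr_ge0.
have S0 : 0 <= \sum_i al i ^+ 2 by apply: sumr_ge0 => i _; exact: sqr_ge0.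
apply: lerD; last by rewrite ler_wpM2l // mulr_ge0.
have c0 : 0 <= 42 * 32 * (4 * M) by apply: mulr_ge0 => //; apply: mulr_ge0; exact: ler0n.
rewrite ler_sqrt; last by apply: mulr_ge0 => //; exact: ler0n.
apply: ler_wpM2l => //.
have -> : 64 = 4 ^+ 3 :> R by ring.
by rewrite lerXn2r ?nnegrE.
Qed.

(** By the polarization
    [12 * (y * z) ^+ 2 = (y + z) ^+ 4 + (y - z) ^+ 4 - 2 * y ^+ 4 - 2 * z ^+ 4]
    the conditional variance is a combination of four empirical fourth moments.
    Their limits [3 * (2 + 2 * r) ^+ 2], [3 * (2 - 2 * r) ^+ 2], 3 and 3 combine to
    [12 * (1 + 2 * r ^+ 2)]: the limit is the one of two Gaussian variables of
    correlation [r]. *)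
Lemma stein_gram (M C : R) (f df : R -> R) :
  (forall i, \sum_c U i c ^+ 2 <= M) ->
  (forall z : R, is_derive z 1 f (df z)) -> (forall z, `|df z| <= C) ->
  (forall y z, `|df y - df z| <= C * `|y - z|) ->
  `|E (fun s => df (tau * gram_err a b s) - tau * gram_err a b s * f (tau * gram_err a b s))|
  <= C * (2^-1 * quart_bound M) + C * (60 * (Num.sqrt (m%:R / (1 - g)) / m%:R)).
Proof.
move=> UM fdf dfC dfL.
have C0 : 0 <= C by apply: le_trans (dfC 0).
pose x j s := tau * n%:R^-1 * (lin hs (cmb a) j s * lin hs (cmb b) j s).
have xinl j s i c : x j (upd s (inl i) c) = x j s by rewrite /x !lin_inl.
have Tx s : tau * gram_err a b s = csum g x s.
  by rewrite /gram_err /csum !mulr_sumr; apply: eq_bigr => j _; rewrite /x; ring.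
under eq_Ex => s do rewrite Tx.
apply: le_trans (stein_bound g01 xinl fdf dfC dfL) _.
have s0 : 0 < m%:R / (1 - g) by rewrite divr_gt0.
have sq2 : Num.sqrt (m%:R / (1 - g)) ^+ 2 = m%:R / (1 - g) by rewrite sqr_sqrtr // ltW.
have sg0 : 0 < sigma2 by exact: lt_le_trans sigma2_ge1.
have ss2 : Num.sqrt sigma2 ^+ 2 = sigma2 by rewrite sqr_sqrtr // ltW.
have ss1 : 1 <= Num.sqrt sigma2 by rewrite -[leLHS]sqrtr1 ler_sqrt // ltW.
have tau0 : 0 <= tau by rewrite divr_ge0 // sqrtr_ge0.
have tau_le : tau <= Num.sqrt (m%:R / (1 - g)).
  by rewrite ler_pdivrMr ?(lt_le_trans ltr01) // ler_peMr ?sqrtr_ge0.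
have cmbM d i : \sum_c d c ^+ 2 = 1 -> cmb d i ^+ 2 <= M.
  move=> d1; apply: le_trans (UM i).
  have sq y : \sum_c (U i c - y * d c) ^+ 2 = \sum_c U i c ^+ 2 - 2 * y * cmb d i + y ^+ 2 * \sum_c d c ^+ 2.
    by rewrite /cmb !mulr_sumr -sumrB -big_split; apply: eq_bigr => c _ /=; ring.
  have : 0 <= \sum_c (U i c - cmb d i * d c) ^+ 2 by apply: sumr_ge0 => c _; exact: sqr_ge0.
  by rewrite sq d1 expr2; lra.
apply: lerD.
- apply: ler_wpM2l => //.
  pose Qp := quart hs (fun i => cmb a i + cmb b i); pose Qm := quart hs (fun i => cmb a i - cmb b i).
  pose Qa := quart hs (cmb a); pose Qb := quart hs (cmb b).
  have Sp : \sum_i (cmb a i + cmb b i) ^+ 2 = 2 + 2 * r.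
    transitivity (\sum_i cmb a i ^+ 2 + \sum_i cmb b i ^+ 2 + 2 * \sum_i cmb a i * cmb b i).
      by rewrite mulr_sumr -!big_split; apply: eq_bigr => i _ /=; ring.
    by rewrite !A2 a1 b1 sum_cmb.
  have Sm : \sum_i (cmb a i - cmb b i) ^+ 2 = 2 - 2 * r.
    transitivity (\sum_i cmb a i ^+ 2 + \sum_i cmb b i ^+ 2 - 2 * \sum_i cmb a i * cmb b i).
      by rewrite mulr_sumr -big_split -sumrB; apply: eq_bigr => i _ /=; ring.
    by rewrite !A2 a1 b1 sum_cmb.
  have r_le : 2 + 2 * r <= 4 /\ 2 - 2 * r <= 4.
    have hp : 0 <= 2 + 2 * r by rewrite -Sp; apply: sumr_ge0 => i _; exact: sqr_ge0.
    have hm : 0 <= 2 - 2 * r by rewrite -Sm; apply: sumr_ge0 => i _; exact: sqr_ge0.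
    by split; lra.
  have ident s : (1 - g) / g * (\sum_j x j s ^+ 2) - 1 =
    (12 * sigma2)^-1 * ((Qp s - 3 * (2 + 2 * r) ^+ 2) + (Qm s - 3 * (2 - 2 * r) ^+ 2)
      - 2 * (Qa s - 3 * 1 ^+ 2) - 2 * (Qb s - 3 * 1 ^+ 2)).
    have -> : (1 - g) / g * (\sum_j x j s ^+ 2) =
       sigma2^-1 * (n%:R^-1 * \sum_j (lin hs (cmb a) j s * lin hs (cmb b) j s) ^+ 2).
      rewrite !mulr_sumr; apply: eq_bigr => j _.
      rewrite /x [(tau * _ * _) ^+ 2]exprMn [(tau * _) ^+ 2]exprMn expr_div_n sq2 ss2.
      rewrite /g; field; rewrite ?nR ?mR ?(gt_eqF sg0) /=.
      by rewrite andbT subr_eq0 eqr_nat gtn_eqF.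
    have -> : \sum_j (lin hs (cmb a) j s * lin hs (cmb b) j s) ^+ 2 =
       12^-1 * (n%:R * (Qp s + Qm s - 2 * Qa s - 2 * Qb s)).
      rewrite /Qp /Qm /Qa /Qb /quart.
      rewrite !(mulrCA 2) -!mulrDr -!mulrBr mulVKf // !mulr_sumr -!(big_split, sumrB) /= mulr_sumr.
      by apply: eq_bigr => j _; rewrite linD linB; field.
    rewrite mulrA.
    have s2 : sigma2 != 0 by rewrite gt_eqF.
    have -> : Qp s + Qm s - 2 * Qa s - 2 * Qb s =
      ((Qp s - 3 * (2 + 2 * r) ^+ 2) + (Qm s - 3 * (2 - 2 * r) ^+ 2)
      - 2 * (Qa s - 3 * 1 ^+ 2) - 2 * (Qb s - 3 * 1 ^+ 2)) + 12 * sigma2.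
      by rewrite /sigma2; ring.
    by field; rewrite nR s2.
  have p1 : E (fun s => `|Qp s - 3 * (2 + 2 * r) ^+ 2|) <= quart_bound M.
    rewrite -Sp; apply: quart_dist; last by rewrite Sp; case: r_le.
    move=> i; have := cmbM a i a1; have := cmbM b i b1; have := sqr_ge0 (cmb a i - cmb b i).
    by rewrite sqrrB sqrrD; lra.
  have p2 : E (fun s => `|Qm s - 3 * (2 - 2 * r) ^+ 2|) <= quart_bound M.
    rewrite -Sm; apply: quart_dist; last by rewrite Sm; case: r_le.
    move=> i; have := cmbM a i a1; have := cmbM b i b1; have := sqr_ge0 (cmb a i + cmb b i).
    by rewrite sqrrB sqrrD; lra.
  have pd d : \sum_c d c ^+ 2 = 1 -> E (fun s => `|quart hs (cmb d) s - 3 * 1 ^+ 2|) <= quart_bound M.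
    move=> d1; rewrite -[X in 3 * X ^+ 2]d1 -A2; apply: quart_dist; last by rewrite A2 d1; lra.
    by move=> i; have := cmbM d i d1; have := sqr_ge0 (cmb d i); lra.
  apply: le_trans (_ : E (fun s => 12^-1 * (`|Qp s - 3 * (2 + 2 * r) ^+ 2| + `|Qm s - 3 * (2 - 2 * r) ^+ 2|
      + 2 * `|Qa s - 3 * 1 ^+ 2| + 2 * `|Qb s - 3 * 1 ^+ 2|)) <= _).
    apply: le_Ex => [|s]; first exact: qs01.
    rewrite ident normrM; apply: ler_pM => //.
      rewrite gtr0_norm ?invr_gt0 ?mulr_gt0 // lef_pV2 ?posrE ?mulr_gt0 //.
      by rewrite ler_peMr.
    rewrite -[in X in _ <= _ + X](@ger0_norm _ 2) // -[in X in _ <= _ + X + _](@ger0_norm _ 2) // -!normrM.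
    rewrite (le_trans (ler_normB _ _)) // lerD2r (le_trans (ler_normB _ _)) // lerD2r.
    exact: ler_normD.
  rewrite ExZ !ExD !ExZ.
  have := pd a a1; have := pd b b1; rewrite -/Qa -/Qb; move: p1 p2; lra.
- have c0 : 0 <= 4 * (1 - g) / g ^+ 2 by rewrite divr_ge0 ?sqr_ge0 // mulr_ge0 // ltW.
  rewrite [_ / g ^+ 2 * C]mulrC -[leLHS]mulrA; apply: ler_wpM2l => //.
  have h : E (fun s => \sum_j `|x j s| ^+ 3) <= n%:R * ((tau * n%:R^-1) ^+ 3 * 15).
    rewrite Ex_sum mulr_natl -[X in _ *+ X]card_ord -sumr_const.
    apply: ler_sum => j _.
    apply: le_trans (_ : E (fun s => (tau * n%:R^-1) ^+ 3 * (2^-1 * (lin hs (cmb a) j s ^+ 6 + lin hs (cmb b) j s ^+ 6))) <= _).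
      apply: le_Ex => [|s]; first exact: qs01.
      rewrite /x normrM exprMn ger0_norm ?mulr_ge0 ?invr_ge0 // ler_wpM2l // exprn_ge0 //.
      by rewrite mulr_ge0 ?invr_ge0.
    rewrite !ExZ ExD ler_wpM2l ?exprn_ge0 ?mulr_ge0 ?invr_ge0 //.
    have := Ex_lin6 g01' (@hsign_sqr R l) (cmb a) j; have := Ex_lin6 g01' (@hsign_sqr R l) (cmb b) j.
    by rewrite !A2 a1 b1 expr1n; lra.
  apply: le_trans (ler_wpM2l c0 h) _.
  have h3 : tau ^+ 3 <= Num.sqrt (m%:R / (1 - g)) ^+ 3 by rewrite lerXn2r ?nnegrE ?sqrtr_ge0.
  apply: le_trans (_ : 4 * (1 - g) / g ^+ 2 * (n%:R * ((Num.sqrt (m%:R / (1 - g)) ^+ 3 * n%:R^-1 ^+ 3) * 15)) <= _).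
    have hh : (tau / n%:R) ^+ 3 <= Num.sqrt (m%:R / (1 - g)) ^+ 3 * n%:R^-1 ^+ 3.
      by rewrite exprMn; apply: ler_wpM2r => //; apply: exprn_ge0; rewrite invr_ge0.
    by apply: ler_wpM2l => //; rewrite ler_wpM2l // ler_wpM2r.
  rewrite [Num.sqrt _ ^+ 3]exprS sq2; move: (Num.sqrt _) => S.
  rewrite le_eqVlt; apply/orP; left; apply/eqP.
  have gn : 1 - g != 0 by rewrite gt_eqF.
  have gE : g * n%:R = m%:R by rewrite /g divfK.
  have g0 : g != 0 by case/andP: g01 => h0 _; rewrite gt_eqF.
  by rewrite -gE; field; rewrite g0 gn nR.
Qed.

End Gram.

(** * Passage to the limit *)

Section Asymptotics.
Variable R : realType.

Lemma limn_esup_lt (x : nat -> \bar R) (a : \bar R) : (limn_esup x < a)%E ->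
  exists2 c : \bar R, (c < a)%E & \forall k \near \oo, (x k <= c)%E.
Proof.
move=> /ereal_inf_lt[_ [B /= Boo <-] Ba]; exists (ereal_sup (x @` B)) => //.
by apply: filterS Boo => k Bk; apply: ereal_sup_ubound; exists k.
Qed.

Lemma limn_esup_lt_pinfty (x : nat -> R) : (limn_esup (fun k => (x k)%:E) < +oo)%E ->
  exists C : R, \forall k \near \oo, x k <= C.
Proof.
move=> /limn_esup_lt[[c| |]] // _ h; first by exists c; apply: filterS h => k; rewrite lee_fin.
by exists 0; apply: filterS h => k; rewrite leeNy_eq.
Qed.

Lemma limn_esup_lt1 (x : nat -> R) : (limn_esup (fun k => (x k)%:E) < 1)%E ->
  exists2 dlt : R, 0 < dlt & \forall k \near \oo, x k <= 1 - dlt.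
Proof.
move=> /limn_esup_lt[[c| |]] //.
  rewrite lte_fin => c1 h; exists (1 - c); first by rewrite subr_gt0.
  by apply: filterS h => k; rewrite lee_fin subKr.
by move=> _ h; exists 1 => //; apply: filterS h => k; rewrite leeNy_eq.
Qed.

Lemma limn_einf_gt1 (p : nat) (y : nat -> nat -> R) :
  (1 < limn_einf (fun k => \big[Order.min/+oo]_(i < p) (y k i)%:E))%E ->
  exists2 rho : R, 1 < rho & \forall k \near \oo, forall i : 'I_p, rho <= y k i.
Proof.
rewrite /limn_einf lteNr => /limn_esup_lt[c c1 h].
have hb k : (- (\big[Order.min/+oo]_(i < p) (y k i)%:E) <= c)%E -> forall i : 'I_p, (- (y k i)%:E <= c)%E.
  move=> hk i; apply: le_trans hk; rewrite leeN2.
  by rewrite (bigD1 i) //= ge_min lexx.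
case: c => [c| |] // in c1 h hb *.
- exists (- c); first by move: c1; rewrite lte_fin ltrNr.
  by apply: filterS h => k /hb hk i; rewrite lerNl -lee_fin; exact: hk.
- exists 2; first by rewrite ltr1n.
  by apply: filterS h => k /hb hk i; have := hk i; rewrite -EFinN leeNy_eq.
Qed.

Lemma cvg0_near_le (x y : nat -> R) : (\forall k \near \oo, `|x k| <= y k) ->
  y k @[k --> \oo] --> (0 : R) -> x k @[k --> \oo] --> (0 : R).
Proof.
move=> xy y0; apply/norm_cvg0P; apply: (@squeeze_cvgr _ _ _ _ (cst 0) y) => //; last exact: cvg_cst.
by apply: filterS xy => k ->; rewrite normr_ge0.
Qed.

Lemma cvg_natrV (m : nat -> nat) : m k @[k --> \oo] --> \oo ->
  (m k)%:R^-1 @[k --> \oo] --> (0 : R).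
Proof.
move=> moo; apply/cvgrPdist_le => eps eps0.
pose N := Num.bound eps^-1.
have hN : eps^-1 < N%:R by apply: archi_boundP; rewrite invr_ge0 ltW.
have : \forall k \near \oo, (N < m k)%N := moo _ (nbhs_infty_gt N).
apply: filterS => k Nk; rewrite sub0r normrN ger0_norm ?invr_ge0 // -[eps]invrK.
rewrite lef_pV2 ?posrE ?invr_gt0 ?ltr0n ?(leq_ltn_trans _ Nk) //.
by rewrite (le_trans (ltW hN)) // ler_nat ltnW.
Qed.

Lemma cvg_sqrt0 (x : nat -> R) : x k @[k --> \oo] --> (0 : R) ->
  Num.sqrt (x k) @[k --> \oo] --> (0 : R).
Proof.
by move=> x0; rewrite -[X in _ --> X]sqrtr0; apply: continuous_cvg => //; exact: sqrt_continuous.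
Qed.

Lemma cvg_mulr0 (c : R) (x : nat -> R) : x k @[k --> \oo] --> (0 : R) ->
  c * x k @[k --> \oo] --> (0 : R).
Proof. by move=> x0; rewrite -[X in _ --> X](mulr0 c); apply: cvgMr. Qed.

(** A remainder of order [sqrt m * t ^+ 2], with [t] of order [1 / sqrt m] in
    mean square, vanishes in probability; the exceptional event may have a
    threshold [r k], provided that it is large compared with [1 / sqrt m]. *)
Lemma remainder_vanishes (I : nat -> finType) (q : forall k, I k -> R)
    (t T Y : forall k, {ffun I k -> bool} -> R) (m : nat -> nat) (r : nat -> R) (B C : R) :
  (forall k i, 0 <= q k i <= 1) ->
  m k @[k --> \oo] --> \oo ->
  (\forall k \near \oo, Ex (q k) (fun s => t k s ^+ 2) <= B / (m k)%:R) ->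
  (forall k s, 0 <= t k s) ->
  (\forall k \near \oo, 0 < r k) ->
  ((m k)%:R * r k ^+ 2)^-1 @[k --> \oo] --> (0 : R) ->
  (\forall k \near \oo, forall s, t k s <= r k ->
     `|Y k s - T k s| <= C * Num.sqrt (m k)%:R * t k s ^+ 2) ->
  forall dlt : R, 0 < dlt ->
    Ex (q k) (fun s => (dlt < `|Y k s - T k s|)%R%:R) @[k --> \oo] --> (0 : R).
Proof.
move=> q01 moo hB t0 r0 mr hY dlt dlt0.
have m_gt0 : \forall k \near \oo, (0 < m k)%N := moo _ (nbhs_infty_gt 0).
have lim0 : B * ((m k)%:R * r k ^+ 2)^-1 + `|C| * B / dlt * Num.sqrt (m k)%:R^-1 @[k --> \oo] --> (0 : R).
  rewrite -[X in _ --> X]addr0; apply: cvgD; first exact: cvg_mulr0.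
  by apply: cvg_mulr0; apply: cvg_sqrt0; exact: cvg_natrV.
apply: cvg0_near_le lim0; near=> k.
have mk : (0 < m k)%N by near: k.
have rk : 0 < r k by near: k.
have hBk : Ex (q k) (fun s => t k s ^+ 2) <= B / (m k)%:R by near: k.
have hYk : forall s, t k s <= r k -> `|Y k s - T k s| <= C * Num.sqrt (m k)%:R * t k s ^+ 2 by near: k.
rewrite ger0_norm; last by apply: Ex_ge0.
have mR : 0 < (m k)%:R :> R by rewrite ltr0n.
set c1 := (r k ^+ 2)^-1; set c2 := `|C| * Num.sqrt (m k)%:R / dlt.
have c1_0 : 0 <= c1 by rewrite invr_ge0 sqr_ge0.
have c2_0 : 0 <= c2 by rewrite divr_ge0 ?mulr_ge0 ?sqrtr_ge0 // ltW.
apply: le_trans (_ : (c1 + c2) * Ex (q k) (fun s => t k s ^+ 2) <= _).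
  rewrite -ExZ; apply: le_Ex => // s.
  case: ltP => [dYT|_] /=; last by rewrite mulr_ge0 ?sqr_ge0 // addr_ge0.
  rewrite mulrDl; have [tr|tr] := leP (t k s) (r k).
    have h : 1 <= c2 * t k s ^+ 2.
      rewrite /c2 mulrAC ler_pdivlMr // mul1r (le_trans (ltW dYT)) // (le_trans (hYk s tr)) //.
      by rewrite ler_wpM2r ?sqr_ge0 // ler_wpM2r ?sqrtr_ge0 // ler_norm.
    by rewrite (le_trans h) // lerDr mulr_ge0 ?sqr_ge0.
  have h : 1 <= c1 * t k s ^+ 2.
    rewrite /c1 mulrC ler_pdivlMr ?exprn_gt0 // mul1r lerXn2r ?nnegrE // ltW //.
  by rewrite (le_trans h) // lerDl mulr_ge0 ?sqr_ge0.
apply: le_trans (ler_wpM2l (addr_ge0 c1_0 c2_0) hBk) _.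
rewrite mulrDl lerD // le_eqVlt; apply/orP; left; apply/eqP.
  by rewrite /c1; field; rewrite !gt_eqF.
rewrite /c2 sqrtrV ?ler0n //.
have sm : Num.sqrt (m k)%:R * Num.sqrt (m k)%:R = (m k)%:R :> R by rewrite -expr2 sqr_sqrtr ?ler0n.
have sm0 : Num.sqrt (m k)%:R != 0 :> R by rewrite sqrtr_eq0 -ltNge.
by rewrite -[in X in B / X]sm; field; rewrite sm0 gt_eqF.
Unshelve. all: by end_near. Qed.

(** The rows of [U] have to become small: this makes the empirical fourth moments
    concentrate. *)
Lemma stein_gram_cvg (q : nat) (l m : nat -> nat) (U : forall k, 'M[R]_(2 ^ l k, q))
    (a b : nat -> 'I_q -> R) (r dlt : R) (mu : nat -> R) :
  let g k : R := (m k)%:R / (2 ^ l k)%:R in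
  let tau k : R := Num.sqrt ((m k)%:R / (1 - g k)) / Num.sqrt (1 + 2 * r ^+ 2) in
  (forall k, (U k)^T *m U k = 1%:M) ->
  (forall k j, norm2 (row j (U k)) <= mu k) -> mu k @[k --> \oo] --> (0 : R) ->
  (forall k, \sum_c a k c ^+ 2 = 1) -> (forall k, \sum_c b k c ^+ 2 = 1) ->
  (forall k, \sum_c a k c * b k c = r) ->
  m k @[k --> \oo] --> \oo -> 0 < dlt -> (\forall k \near \oo, g k <= 1 - dlt) ->
  forall (f df : R -> R) (C : R),
    (forall x : R, is_derive x 1 f (df x)) -> (forall x, `|df x| <= C) ->
    (forall x y, `|df x - df y| <= C * `|x - y|) ->
  Ex (qs (g k)) (fun s => df (tau k * gram_err (m k) (U k) (a k) (b k) s)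
       - tau k * gram_err (m k) (U k) (a k) (b k) s * f (tau k * gram_err (m k) (U k) (a k) (b k) s))
    @[k --> \oo] --> (0 : R).
Proof.
move=> g tau orthU Umu mu0 a1 b1 ab moo dlt0 gdlt f df C fdf dfC dfL.
have m_gt0 : \forall k \near \oo, (0 < m k)%N := moo _ (nbhs_infty_gt 0).
have lim0 : C * (2^-1 * quart_bound (mu k ^+ 2)) + C * (60 * Num.sqrt (dlt^-1 * (m k)%:R^-1))
    @[k --> \oo] --> (0 : R).
  have mu2 : mu k ^+ 2 @[k --> \oo] --> (0 : R).
    rewrite (_ : (fun k => mu k ^+ 2) = (fun k => mu k * mu k)); last first.
      by apply/funext => k; rewrite expr2.
    by rewrite -[X in _ --> X](mulr0 (0 : R)); apply: cvgM.
  have m4 : 4 * mu k ^+ 2 @[k --> \oo] --> (0 : R) by exact: cvg_mulr0.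
  rewrite -[X in _ --> X]addr0; apply: cvgD; do 2 apply: cvg_mulr0; last first.
    by apply: cvg_sqrt0; apply: cvg_mulr0; exact: cvg_natrV.
  rewrite /quart_bound -[X in _ --> X]addr0; apply: cvgD.
    apply: cvg_sqrt0; rewrite -[X in _ --> X](mul0r (64 : R)); apply: cvgMl.
    exact: cvg_mulr0.
  rewrite -[X in _ --> X](mul0r (4 : R)); apply: cvgMl.
  exact: cvg_mulr0.
apply: cvg0_near_le lim0; near=> k.
have mk : (0 < m k)%N by near: k.
have gk : g k <= 1 - dlt by near: k.
have mR : 0 < (m k)%:R :> R by rewrite ltr0n.
have nR : 0 < (2 ^ l k)%:R :> R by rewrite ltr0n expn_gt0.
have mn : (m k < 2 ^ l k)%N.
  rewrite -(ltr_nat R) -[ltRHS]mul1r -ltr_pdivrMr //.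
  by apply: le_lt_trans gk _; rewrite gtrBl.
have UM i : \sum_c U k i c ^+ 2 <= mu k ^+ 2.
  have h0 : 0 <= \sum_c U k i c ^+ 2 by apply: sumr_ge0 => c _; exact: sqr_ge0.
  have mu_ge0 : 0 <= mu k by apply: le_trans (Umu k i); rewrite sqrtr_ge0.
  have := Umu k i; rewrite /norm2; under eq_bigr => c _ do rewrite mxE.
  by move=> h; rewrite -[leLHS]sqr_sqrtr // lerXn2r ?nnegrE ?sqrtr_ge0.
have := stein_gram mk (orthU k) mn (a1 k) (b1 k) UM fdf dfC dfL; rewrite ab => H.
apply: le_trans H _; rewrite lerD2l.
have C0 : 0 <= C by apply: le_trans (dfC 0).
apply: ler_wpM2l => //; apply: ler_wpM2l => //.
have sm : (m k)%:R^-1 = Num.sqrt ((m k)%:R ^- 2) :> R.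
  by rewrite sqrtrV ?sqr_ge0 // sqrtr_sqr ger0_norm // ltW.
rewrite [X in _ * X <= _]sm -sqrtrM; last first.
  by rewrite divr_ge0 ?ler0n // subr_ge0 (le_trans gk) // gerBl ltW.
apply: ler_wsqrtr.
have gd : dlt <= 1 - g k by lra.
have g1 : 0 < 1 - g k by exact: lt_le_trans gd.
have -> : (m k)%:R / (1 - (m k)%:R / (2 ^ l k)%:R) * ((m k)%:R ^+ 2)^-1 = (1 - g k)^-1 * (m k)%:R^-1 :> R.
  by rewrite -/(g k); field; rewrite !gt_eqF.
by rewrite ler_wpM2r ?invr_ge0 ?ler0n // lef_pV2.
Unshelve. all: by end_near. Qed.

End Asymptotics.

(** * Expansions for the selected eigenvectors *)

Section Coordinates.
Variables (R : realType) (p : nat).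
Local Notation n := p.+1.

Lemma pert_radius_gt0 (K rho : R) : 1 <= K -> 1 < rho -> 0 < pert_radius p K rho.
Proof.
move=> K1 rho1; have rho0 : 0 < rho by exact: lt_trans ltr01 rho1.
have s0 : 0 < sep_const rho by rewrite subr_gt0 invf_lt1.
rewrite /pert_radius !divr_gt0 ?exprn_gt0 // mulr_gt0 ?ltr0n ?fact_gt0 //.
by rewrite mulr_gt0 // exprn_gt0 // (lt_le_trans ltr01) // entry_bound_ge1.
Qed.

Lemma char_poly_conj (V M : 'M[R]_n) : V^T *m V = 1%:M ->
  char_poly (V *m M *m V^T) = char_poly M.
Proof.
move=> VV; have VV' : V *m V^T = 1%:M by exact: mulmx1C.
rewrite /char_poly.
have -> : char_poly_mx (V *m M *m V^T) =
   map_mx polyC V *m char_poly_mx M *m map_mx polyC V^T.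
  rewrite /char_poly_mx mulmxBr mulmxBl !map_mxM; congr (_ - _).
  by rewrite scalar_mxC -mulmxA -map_mxM VV' map_scalar_mx /= rmorph1 mulmx1.
by rewrite !det_mulmx mulrAC -det_mulmx -map_mxM VV' map_scalar_mx rmorph1 det1 mul1r.
Qed.

Lemma dotvE (x y : 'cV[R]_n) : dotv x y = \sum_k x k 0 * y k 0.
Proof. by rewrite /dotv mxE; apply: eq_bigr => k _; rewrite mxE. Qed.

Lemma dotv_orth (V : 'M[R]_n) (x y : 'cV[R]_n) : V^T *m V = 1%:M ->
  dotv (V^T *m x) (V^T *m y) = dotv x y.
Proof.
move=> /mulmx1C VV; rewrite /dotv trmx_mul trmxK mulmxA -(mulmxA x^T) VV mulmx1 //.
Qed.

Lemma dotvN (x y : 'cV[R]_n) : dotv x (- y) = - dotv x y.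
Proof. by rewrite !dotvE -sumrN; apply: eq_bigr => k _; rewrite mxE mulrN. Qed.

Lemma dotvB (x y z : 'cV[R]_n) : dotv x (y - z) = dotv x y - dotv x z.
Proof. by rewrite !dotvE -sumrB; apply: eq_bigr => k _; rewrite !mxE mulrBr. Qed.

Variables (v : 'M[R]_n -> 'I_n -> 'cV[R]_n).
Hypothesis vP : eigvec_choice v.

(** Coordinates of the selected eigenvectors in the orthonormal basis [V], and
    the same coordinates after a change of sign that makes the diagonal ones
    nonnegative. *)
Definition coords (V A : 'M[R]_n) (i j : 'I_n) : R := (V^T *m v A i) j 0.
Definition flip (V A : 'M[R]_n) (i : 'I_n) : R := if 0 <= coords V A i i then 1 else -1.
Definition ncoords (V A : 'M[R]_n) (i j : 'I_n) : R := flip V A i * coords V A i j.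

Lemma flip_sqr V A i : flip V A i ^+ 2 = 1.
Proof. by rewrite /flip; case: ifP; rewrite ?sqrrN expr1n. Qed.

Lemma ncoords_ge0 V A i : 0 <= ncoords V A i i.
Proof.
rewrite /ncoords /flip; case: ifP => [h|/negbT]; first by rewrite mul1r.
by rewrite -ltNge mulN1r oppr_ge0 => /ltW.
Qed.

Variables (V A : 'M[R]_n) (ell : 'rV[R]_n) (E : 'M[R]_n).
Hypothesis VV : V^T *m V = 1%:M.
Hypothesis AE : A = V *m scaled_gram ell E *m V^T.
Hypothesis AT : A^T = A.

Lemma dotv_coords (c : 'cV[R]_n) i : dotv c (v A i) = \sum_k (V^T *m c) k 0 * coords V A i k.
Proof. by rewrite -(dotv_orth _ _ VV) dotvE. Qed.

Lemma sum_ncoords i : \sum_j ncoords V A i j ^+ 2 = 1.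
Proof.
have [_ <- _] := vP i AT; rewrite -(dotv_orth _ _ VV) dotvE; apply: eq_bigr => j _.
by rewrite /ncoords exprMn flip_sqr mul1r expr2.
Qed.

Lemma eig_ncoords i j :
  ell 0 j * \sum_k ((j == k)%:R + E j k) * (ell 0 k * ncoords V A i k) =
  eigval A i * ncoords V A i j.
Proof.
have [e _ _] := vP i AT.
have hA (w : 'cV_n) : A *m w = V *m (scaled_gram ell E *m (V^T *m w)) by rewrite AE -!mulmxA.
have : V^T *m (A *m v A i) = eigval A i *: (V^T *m v A i) by rewrite e scalemxAr.
rewrite hA mulmxA VV mul1mx => /matrixP/(_ j 0); rewrite [RHS]mxE -/(coords V A i j) => h.
rewrite /ncoords mulrCA -h mxE !mulr_sumr; apply: eq_bigr => k _.
rewrite -/(coords V A i k) /scaled_gram mul_mx_diag mul_diag_mx !mxE.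
by ring.
Qed.

Lemma eigval_window (K rho t : R) i : 1 <= K -> 1 < rho ->
  (forall i, 0 < ell 0 i) -> (forall i j, ell 0 i <= K * ell 0 j) ->
  (forall i j : 'I_n, (i < j)%N -> rho ^+ 2 * ell 0 j <= ell 0 i) ->
  0 <= t -> t <= 1 -> t <= pert_radius p K rho -> (forall i j, `|E i j| <= t) ->
  ell 0 i ^+ 2 / rho < eigval A i < rho * ell 0 i ^+ 2.
Proof.
move=> K1 rho1 ell0 ellK ellrho t0 t1 trad Et.
apply: (eigval_scaled_gram K1 rho1 ell0 ellK _ t0 t1 trad Et); last by rewrite AE char_poly_conj.
move=> j k jk; apply: le_trans (ellrho _ _ jk).
rewrite ler_wpM2r ?(ltW (ell0 _)) // expr2 ler_peMl ?(ltW rho1) //.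
by rewrite (le_trans ler01) // ltW.
Qed.

End Coordinates.

Section Family.
Variables (R : realType) (p : nat) (K rho : R).
Local Notation n := p.+1.
Hypotheses (K1 : 1 <= K) (rho1 : 1 < rho).
Variables (v : 'M[R]_n -> 'I_n -> 'cV[R]_n).
Hypothesis vP : eigvec_choice v.

(** Below this size of the error, the eigenvalues are localized, and the diagonal
    coordinates of the eigenvectors are at least one half. *)
Definition tol : R :=
  Num.min 1 (Num.min (pert_radius p K rho) (2 * n%:R * off_bound p K rho ^+ 2 + 1)^-1).

Lemma tol_gt0 : 0 < tol.
Proof.
rewrite !lt_min ltr01 pert_radius_gt0 //= invr_gt0 ltr_wpDl //.
by rewrite mulr_ge0 ?sqr_ge0 // mulr_ge0.
Qed.

Variables (Z : Type) (t : Z -> R) (ell : Z -> 'rV[R]_n) (E V A : Z -> 'M[R]_n).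
Hypothesis t0 : forall z, 0 <= t z.
Hypothesis trad : forall z, t z <= tol.
Hypothesis Et : forall z i j, `|E z i j| <= t z.
Hypothesis ell0 : forall z i, 0 < ell z 0 i.
Hypothesis ellK : forall z i j, ell z 0 i <= K * ell z 0 j.
Hypothesis ellrho : forall z (i j : 'I_n), (i < j)%N -> rho ^+ 2 * ell z 0 j <= ell z 0 i.
Hypothesis VV : forall z, (V z)^T *m V z = 1%:M.
Hypothesis AE : forall z, A z = V z *m scaled_gram (ell z) (E z) *m (V z)^T.
Hypothesis AT : forall z, (A z)^T = A z.

Let lam z i := eigval (A z) i.
Let u z i j := ncoords v (V z) (A z) i j.

Let t01 z : 0 <= t z <= 1.
Proof. by rewrite t0 /=; have := trad z; rewrite !le_min => /andP[]. Qed.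

Let tsmall z : 2 * n%:R * off_bound p K rho ^+ 2 * t z <= 1.
Proof.
have c0 : 0 <= 2 * n%:R * off_bound p K rho ^+ 2 by rewrite mulr_ge0 ?sqr_ge0 // mulr_ge0.
have := trad z; rewrite !le_min => /and3P[_ _ h].
apply: le_trans (_ : (2 * n%:R * off_bound p K rho ^+ 2 + 1) * t z <= _).
  by rewrite ler_wpM2r // lerDl.
by rewrite -ler_pdivlMl ?mulr1 // ltr_wpDl.
Qed.

Let lam_bounds z i : ell z 0 i ^+ 2 / rho < lam z i < rho * ell z 0 i ^+ 2.
Proof.
have := trad z; rewrite !le_min => /and3P[_ h2 _].
have /andP[t0z t1z] := t01 z.
exact: (eigval_window (VV z) (AE z) i K1 rho1 (ell0 z) (ellK z) (ellrho z) t0z t1z h2 (Et z)).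
Qed.

Let unit_u z i : \sum_j u z i j ^+ 2 = 1.
Proof. exact: sum_ncoords. Qed.

Let pos_u z i : 0 <= u z i i.
Proof. exact: ncoords_ge0. Qed.

Let eig_u z i j :
  ell z 0 j * \sum_k ((j == k)%:R + E z j k) * (ell z 0 k * u z i k) = lam z i * u z i j.
Proof. exact: eig_ncoords. Qed.

Local Notation O := (isO t).

(** The factor of the first order part: an eigenvector moves towards another one
    at a speed that is inverse to the distance of the eigenvalues. *)
Definition coef (e : 'rV[R]_n) (i j : 'I_n) : R :=
  e 0 i * e 0 j / (e 0 i ^+ 2 - e 0 j ^+ 2).

Lemma fam_eigval i : O (fun z => (lam z i)^-1 * (lam z i - ell z 0 i ^+ 2) - E z i i) 2.
Proof. exact: (O_eigval rho1 t01 tsmall Et ell0 ellK ellrho lam_bounds unit_u pos_u eig_u). Qed.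

Lemma fam_off (i j : 'I_n) : j != i -> O (fun z => u z i j) 1.
Proof. exact: (O_off rho1 Et ell0 ellK ellrho lam_bounds unit_u eig_u). Qed.

Lemma fam_defect i : O (fun z => u z i i - 1) 2.
Proof. exact: (O_defect rho1 Et ell0 ellK ellrho lam_bounds unit_u pos_u eig_u). Qed.

Lemma fam_eigvec (i j : 'I_n) : j != i -> O (fun z => u z i j - coef (ell z) i j * E z j i) 2.
Proof. exact: (O_eigvec rho1 t01 tsmall Et ell0 ellK ellrho lam_bounds unit_u pos_u eig_u). Qed.

Lemma fam_weight (i j : 'I_n) : j != i ->
  O (fun z => lam z i * lam z j / (lam z i - lam z j) ^+ 2 - coef (ell z) i j ^+ 2) 1.
Proof. exact: (O_weight rho1 t01 tsmall Et ell0 ellK ellrho lam_bounds unit_u pos_u eig_u). Qed.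

Lemma fam_coef (i j : 'I_n) : j != i -> O (fun z => coef (ell z) i j) 0.
Proof. exact: (O_coef rho1 t ell0 ellK ellrho). Qed.

Variables (i : 'I_n) (c : Z -> 'I_n -> R).
Hypothesis c1 : forall z, \sum_k c z k ^+ 2 = 1.

Let c_le1 z k : `|c z k| <= 1.
Proof.
rewrite -(expr_le1 (n := 2)) // real_normK ?num_real // -(c1 z) (bigD1 k) //=.
by rewrite lerDl sumr_ge0 // => k' _; exact: sqr_ge0.
Qed.

Let O_c k : O (fun z => c z k) 0.
Proof. exact: (@isO_bounded _ _ _ _ 1). Qed.

(** The deviation of a linear functional of the eigenvector, its first order part,
    the asymptotic variance of the latter up to the factor [(1 - gamma) / m], and
    the estimate of this variance from the sketched matrix. *)
Definition dev z : R := \sum_k c z k * (u z i k - (k == i)%:R).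
Definition lin_dev z : R := \sum_(k | k != i) c z k * (coef (ell z) i k * E z k i).
Definition asvar z : R := \sum_(j | j != i) coef (ell z) i j ^+ 2 * c z j ^+ 2.
Definition asvar_hat z : R := \sum_(j | j != i)
  lam z i * lam z j / (lam z i - lam z j) ^+ 2 * (\sum_k c z k * u z j k) ^+ 2.

Lemma O_dev : O (fun z => dev z - lin_dev z) 2.
Proof.
have h1 : O (fun z => c z i * (u z i i - 1)) 2.
  exact: (isO_M (e1 := 0) (e2 := 2) _ (O_c i) (fam_defect i)).
have h2 : O (fun z => \sum_(k | k != i) c z k * (u z i k - coef (ell z) i k * E z k i)) 2.
  apply: isO_sum => k ki; exact: (isO_M (e1 := 0) (e2 := 2) _ (O_c k) (fam_eigvec ki)).
apply: isO_eq (isO_D h1 h2) => z.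
rewrite /dev /lin_dev [in RHS](bigD1 i) //= eqxx -addrA; congr (_ + _).
rewrite -sumrB; apply: eq_bigr => k ki; rewrite (negbTE ki) subr0; ring.
Qed.

Lemma O_lin_dev : O lin_dev 1.
Proof.
apply: isO_sum => k ki; apply: (isO_M (e1 := 0) (e2 := 1) _ (O_c k)) => //.
apply: (isO_M (e1 := 0) (e2 := 1) _ (fam_coef ki)) => //.
by exists 1 => z; rewrite mul1r expr1.
Qed.

Let O_proj j : O (fun z => \sum_k c z k * u z j k - c z j) 1.
Proof.
have h1 : O (fun z => c z j * (u z j j - 1)) 1.
  apply: (isO_M (e1 := 0) (e2 := 1) _ (O_c j)) => //.
  exact: isO_le (fam_defect j).
have h2 : O (fun z => \sum_(k | k != j) c z k * u z j k) 1.
  apply: isO_sum => k kj; exact: (isO_M (e1 := 0) (e2 := 1) _ (O_c k) (fam_off kj)).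
apply: isO_eq (isO_D h1 h2) => z.
by rewrite [in RHS](bigD1 j) //=; ring.
Qed.

Lemma O_asvar : O (fun z => asvar_hat z - asvar z) 1.
Proof.
have h : O (fun z => \sum_(j | j != i)
   ((lam z i * lam z j / (lam z i - lam z j) ^+ 2 - coef (ell z) i j ^+ 2) * (\sum_k c z k * u z j k) ^+ 2
   + coef (ell z) i j ^+ 2 * ((\sum_k c z k * u z j k - c z j) * ((\sum_k c z k * u z j k - c z j) + 2 * c z j)))) 1.
  apply: isO_sum => j ji.
  have hp0 := isO_le t01 (_ : (0 <= 1)%N) (O_proj j).
  have hw : O (fun z => \sum_k c z k * u z j k) 0.
    by apply: isO_eq (isO_D (hp0 _) (O_c j)) => // z; rewrite subrK.
  have hw2 : O (fun z => (\sum_k c z k * u z j k) ^+ 2) 0.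
    by apply: isO_eq (isO_M (e := 0) (e1 := 0) (e2 := 0) _ hw hw) => // z; rewrite expr2.
  have hc2 : O (fun z => coef (ell z) i j ^+ 2) 0.
    by apply: isO_eq (isO_M (e := 0) (e1 := 0) (e2 := 0) _ (fam_coef ji) (fam_coef ji)) => // z; rewrite expr2.
  apply: isO_D; first exact: (isO_M (e1 := 1) (e2 := 0) _ (fam_weight ji) hw2).
  apply: (isO_M (e1 := 0) (e2 := 1) _ hc2) => //.
  apply: (isO_M (e1 := 1) (e2 := 0) _ (O_proj j)) => //.
  apply: isO_D; first exact: hp0.
  by apply: (isO_M (e1 := 0) (e2 := 0) _ (isO_cst _ _) (O_c j)).
apply: isO_eq h => z; rewrite /asvar_hat /asvar -sumrB; apply: eq_bigr => j ji.
by ring.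
Qed.

Variable eta0 : R.
Hypothesis eta0_gt0 : 0 < eta0.
Hypothesis asvar_ge : forall z, eta0 <= asvar z.
Hypothesis asvar_hat_ge : forall z, eta0 <= asvar_hat z.

(** The variance is bounded away from zero, hence its square root may be replaced
    by the estimate at the cost of a factor of first order; since the deviation is
    itself of first order, the total effect is of second order. *)
Lemma O_studentized :
  O (fun z => (Num.sqrt (asvar_hat z))^-1 * dev z - (Num.sqrt (asvar z))^-1 * lin_dev z) 2.
Proof.
have se : 0 < Num.sqrt eta0 by rewrite sqrtr_gt0.
have s1 z : Num.sqrt eta0 <= Num.sqrt (asvar_hat z) by rewrite ler_sqrt // (le_trans (ltW eta0_gt0)).
have s2 z : Num.sqrt eta0 <= Num.sqrt (asvar z) by rewrite ler_sqrt // (le_trans (ltW eta0_gt0)).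
have p1 z : 0 < Num.sqrt (asvar_hat z) := lt_le_trans se (s1 z).
have p2 z : 0 < Num.sqrt (asvar z) := lt_le_trans se (s2 z).
have i1 : O (fun z => (Num.sqrt (asvar_hat z))^-1) 0.
  by apply: (@isO_inv _ _ _ _ (Num.sqrt eta0)) => // z; rewrite ger0_norm // sqrtr_ge0.
have i2 : O (fun z => (Num.sqrt (asvar z))^-1) 0.
  by apply: (@isO_inv _ _ _ _ (Num.sqrt eta0)) => // z; rewrite ger0_norm // sqrtr_ge0.
have i3 : O (fun z => (Num.sqrt (asvar_hat z) + Num.sqrt (asvar z))^-1) 0.
  apply: (@isO_inv _ _ _ _ (Num.sqrt eta0)) => // z.
  by rewrite ger0_norm ?addr_ge0 ?sqrtr_ge0 // (le_trans (s1 z)) // lerDl sqrtr_ge0.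
have h1 := isO_M (e := 2) (e1 := 0) (e2 := 2) erefl i1 O_dev.
have h2 : O (fun z => lin_dev z * (asvar_hat z - asvar z) *
    ((Num.sqrt (asvar_hat z))^-1 * ((Num.sqrt (asvar z))^-1 * (Num.sqrt (asvar_hat z) + Num.sqrt (asvar z))^-1))) 2.
  apply: (isO_M (e1 := 2) (e2 := 0)) => //.
    exact: (isO_M (e1 := 1) (e2 := 1) _ O_lin_dev O_asvar).
  apply: (isO_M (e1 := 0) (e2 := 0) _ i1) => //.
  exact: (isO_M (e1 := 0) (e2 := 0) _ i2).
apply: isO_eq (isO_B h1 h2) => z.
have q1 : Num.sqrt (asvar_hat z) ^+ 2 = asvar_hat z.
  by rewrite sqr_sqrtr // (le_trans (ltW eta0_gt0)).
have q2 : Num.sqrt (asvar z) ^+ 2 = asvar z.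
  by rewrite sqr_sqrtr // (le_trans (ltW eta0_gt0)).
rewrite -q1 -q2 !sqrtr_sqr !ger0_norm ?sqrtr_ge0 //.
have := p1 z; have := p2 z.
move: (Num.sqrt _) (Num.sqrt _) => x y x0 y0.
by field; rewrite (gt_eqF x0) (gt_eqF y0) gt_eqF // addr_gt0.
Qed.

End Family.

Section ExactSpectrum.
Variables (R : realType) (p : nat) (K rho : R).
Local Notation n := p.+1.
Hypotheses (K1 : 1 <= K) (rho1 : 1 < rho).
Variables (v : 'M[R]_n -> 'I_n -> 'cV[R]_n).
Hypothesis vP : eigvec_choice v.
Variables (ell : 'rV[R]_n) (V A : 'M[R]_n).
Hypothesis ell0 : forall i, 0 < ell 0 i.
Hypothesis ellK : forall i j, ell 0 i <= K * ell 0 j.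
Hypothesis ellrho : forall (i j : 'I_n), (i < j)%N -> rho ^+ 2 * ell 0 j <= ell 0 i.
Hypothesis VV : V^T *m V = 1%:M.
Hypothesis AE : A = V *m scaled_gram ell 0 *m V^T.
Hypothesis AT : A^T = A.

Let isO0 (x : R) e : (0 < e)%N -> isO (fun _ : unit => 0 : R) (fun=> x) e -> x = 0.
Proof.
by move=> e0 [C /(_ tt)]; rewrite expr0n eqn0Ngt e0 mulr0 normr_le0 => /eqP.
Qed.

Let E0 (z : unit) (i j : 'I_n) : `|(0 : 'M[R]_n) i j| <= 0.
Proof. by rewrite mxE normr0. Qed.

Let rad0 (z : unit) : 0 <= tol p K rho. Proof. exact/ltW/tol_gt0. Qed.

(** Without perturbation the expansions are exact. *)
Lemma eigval_exact i : eigval A i = ell 0 i ^+ 2.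
Proof.
have := fam_eigval K1 rho1 vP (fun _ : unit => lexx (0 : R)) rad0 E0
  (fun=> ell0) (fun=> ellK) (fun=> ellrho) (fun=> VV) (fun=> AE) (fun=> AT) i.
move=> /isO0 -/(_ isT); rewrite mxE subr0 => /eqP; rewrite mulf_eq0 invr_eq0 subr_eq0.
case/orP => /eqP // e.
have h2 : 0 <= pert_radius p K rho by apply/ltW/pert_radius_gt0.
have := @eigval_window _ _ V A ell 0 VV AE K rho 0 i K1 rho1 ell0 ellK ellrho (lexx _) ler01 h2 (E0 tt).
rewrite e => /andP[]; rewrite ltNge divr_ge0 ?sqr_ge0 //.
by rewrite (le_trans ler01) // ltW.
Qed.

Lemma eigvec_exact i : v A i = flip v V A i *: col i V.
Proof.
have hoff j : j != i -> ncoords v V A i j = 0.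
  move=> ji; have := fam_off K1 rho1 vP (fun _ : unit => lexx (0 : R)) rad0 E0
    (fun=> ell0) (fun=> ellK) (fun=> ellrho) (fun=> VV) (fun=> AE) (fun=> AT) ji.
  by move=> /isO0 -/(_ isT).
have hdiag : ncoords v V A i i = 1.
  have := fam_defect K1 rho1 vP (fun _ : unit => lexx (0 : R)) rad0 E0
    (fun=> ell0) (fun=> ellK) (fun=> ellrho) (fun=> VV) (fun=> AE) (fun=> AT) i.
  by move=> /isO0 -/(_ isT) /eqP; rewrite subr_eq0 => /eqP.
have hc j : coords v V A i j = flip v V A i * (j == i)%:R.
  have -> : coords v V A i j = flip v V A i * ncoords v V A i j.
    by rewrite /ncoords mulrA -expr2 flip_sqr mul1r.
  by have [->|/hoff ->] := eqVneq j i; rewrite ?hdiag.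
have -> : v A i = V *m (V^T *m v A i) by rewrite mulmxA (mulmx1C VV) mul1mx.
apply/matrixP => a b; rewrite !mxE (bigD1 i) //= big1 => [|j ji].
  by rewrite !ord1 -/(coords v V A i i) hc eqxx mulr1 addr0 mulrC.
by rewrite !ord1 -/(coords v V A i j) hc (negbTE ji) !mulr0.
Qed.

End ExactSpectrum.

(** * Limit laws for the spectrum of the sketched matrix *)

(** The conditions on the data are required for all [k], with the same constants;
    they hold after finitely many terms have been dropped from the sequences. *)
Section SketchedSpectrum.
Variables (R : realType) (p : nat).
Local Notation n := p.+1.
Variables (K rho dlt : R) (v : 'M[R]_n -> 'I_n -> 'cV[R]_n).
Hypotheses (K1 : 1 <= K) (rho1 : 1 < rho) (dlt0 : 0 < dlt).
Hypothesis vP : eigvec_choice v.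
Variables (l m : nat -> nat) (X U : forall k, 'M[R]_(2 ^ l k, n)).
Variables (ell : nat -> 'rV[R]_n) (V : nat -> 'M[R]_n) (mu : nat -> R).
Hypothesis orthU : forall k, (U k)^T *m U k = 1%:M.
Hypothesis orthV : forall k, (V k)^T *m V k = 1%:M.
Hypothesis ell0 : forall k i, 0 < ell k 0 i.
Hypothesis ellK : forall k i j, ell k 0 i <= K * ell k 0 j.
Hypothesis ellrho : forall k (i j : 'I_n), (i < j)%N -> rho ^+ 2 * ell k 0 j <= ell k 0 i.
Hypothesis svdX : forall k, X k = U k *m diag_mx (ell k) *m (V k)^T.
Hypothesis Umu : forall k j, norm2 (row j (U k)) <= mu k.
Hypothesis mu0 : mu k @[k --> \oo] --> (0 : R).
Hypothesis m_gt0 : forall k, (0 < m k)%N.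
Hypothesis moo : m k @[k --> \oo] --> \oo.

Definition rate k : R := (m k)%:R / (2 ^ l k)%:R.
Hypothesis rate_le : forall k, rate k <= 1 - dlt.

Local Notation cfg k := {ffun 'I_(2 ^ l k) + 'I_(2 ^ l k) -> bool}.
Local Notation q k := (@qs R (2 ^ l k) (rate k)).

Definition gram k : 'M[R]_n := (X k)^T *m X k.
Definition sketched_gram k (s : cfg k) : 'M[R]_n :=
  (X k)^T *m (srht_of R (m k) s)^T *m srht_of R (m k) s *m X k.
Definition delta (i k : 'I_n) : R := (k == i)%:R.
(** The error of the sketch in the orthonormal basis given by the columns of [U]. *)
Definition err k (s : cfg k) : 'M[R]_n :=
  \matrix_(c, c') gram_err (m k) (U k) (delta c) (delta c') s.
Definition err_norm k (s : cfg k) : R := Num.sqrt (\sum_c \sum_c' err s c c' ^+ 2).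

Lemma gramE k : gram k = V k *m scaled_gram (ell k) 0 *m (V k)^T.
Proof.
rewrite /gram svdX !trmx_mul trmxK tr_diag_mx /scaled_gram addr0 mulmx1 -!mulmxA.
by rewrite (mulmxA (U k)^T) orthU mul1mx.
Qed.

Lemma sketched_gramE k (s : cfg k) :
  sketched_gram s = V k *m scaled_gram (ell k) (err s) *m (V k)^T.
Proof.
rewrite /sketched_gram svdX /scaled_gram -(gram_srht (m_gt0 k) (orthU k) s).
by rewrite !trmx_mul trmxK tr_diag_mx !mulmxA.
Qed.

Lemma gram_sym k : (gram k)^T = gram k.
Proof. by rewrite /gram trmx_mul trmxK. Qed.

Lemma sketched_gram_sym k (s : cfg k) : (sketched_gram s)^T = sketched_gram s.
Proof. by rewrite /sketched_gram !trmx_mul !trmxK !mulmxA. Qed.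

Lemma sum_delta_sqr i : \sum_k delta i k ^+ 2 = 1.
Proof.
rewrite /delta (bigD1 i) //= eqxx expr1n big1 ?addr0 // => j ji.
by rewrite (negbTE ji) expr0n.
Qed.

Lemma rate_gt0 k : 0 < rate k.
Proof. by rewrite divr_gt0 // ltr0n ?m_gt0 // expn_gt0. Qed.

Lemma q01 k u : 0 <= q k u <= 1.
Proof.
apply: qs01; rewrite (ltW (rate_gt0 k)) (le_trans (rate_le k)) // gerBl.
exact: ltW dlt0.
Qed.

Lemma m_lt k : (m k < 2 ^ l k)%N.
Proof.
rewrite -(ltr_nat R) -[ltRHS]mul1r -ltr_pdivrMr ?ltr0n ?expn_gt0 //.
by apply: le_lt_trans (rate_le k) _; rewrite gtrBl.
Qed.

Lemma err_norm_ge0 k (s : cfg k) : 0 <= err_norm s.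
Proof. exact: sqrtr_ge0. Qed.

Lemma err_norm_sqr k (s : cfg k) : err_norm s ^+ 2 = \sum_c \sum_c' err s c c' ^+ 2.
Proof.
by rewrite sqr_sqrtr // sumr_ge0 // => c _; apply: sumr_ge0 => c' _; exact: sqr_ge0.
Qed.

Lemma err_le k (s : cfg k) i j : `|err s i j| <= err_norm s.
Proof.
rewrite -[leLHS]sqrtr_sqr ler_wsqrtr //.
rewrite (bigD1 i) //= (bigD1 j) //= -addrA lerDl addr_ge0 ?sumr_ge0 // => c _.
  exact: sqr_ge0.
by apply: sumr_ge0 => c' _; exact: sqr_ge0.
Qed.

Lemma Ex_err_norm_sqr k : Ex (q k) (fun s => err_norm s ^+ 2) <= 3 * (n * n)%:R / (m k)%:R.
Proof.
under eq_Ex => s do rewrite err_norm_sqr.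
rewrite Ex_sum; under eq_bigr => c _ do rewrite Ex_sum.
apply: le_trans (_ : \sum_(c < n) \sum_(c' < n) 3 / (m k)%:R <= _).
  apply: ler_sum => c _; apply: ler_sum => c' _.
  under eq_Ex => s do rewrite mxE.
  by apply: (gram_err_second_moment (m_gt0 k) (orthU k) (m_lt k)); exact: sum_delta_sqr.
rewrite !sumr_const !card_ord -mulrnA -[leLHS]mulr_natr.
by rewrite mulrAC.
Qed.

Definition good_outcome (r : R) :=
  {z : {k : nat & cfg k} | @err_norm (tag z) (tagged z) <= r}.

(** An expansion that is uniform over [good_outcome r] has one constant for all
    [k] and all outcomes with an error of at most [r]. *)
Lemma uniform_isO (r : R) (f : forall k, cfg k -> R) (e : nat) :
  isO (fun z : good_outcome r => err_norm (tagged (sval z)))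
      (fun z => f (tag (sval z)) (tagged (sval z))) e ->
  exists2 C : R, 0 < C & forall k (s : cfg k), err_norm s <= r ->
     `|f k s| <= C * err_norm s ^+ e.
Proof.
move=> [C h]; exists (`|C| + 1) => [|k s sr]; first by rewrite ltr_wpDl.
have := h (exist _ (Tagged (fun k => cfg k) s) sr) => /= hs; apply: le_trans hs _.
rewrite ler_wpM2r ?exprn_ge0 ?err_norm_ge0 //.
by rewrite (le_trans (ler_norm _)) // lerDl.
Qed.

Lemma scale_le k : Num.sqrt ((m k)%:R / (1 - rate k)) <= Num.sqrt dlt^-1 * Num.sqrt (m k)%:R.
Proof.
rewrite -sqrtrM ?invr_ge0 ?(ltW dlt0) // ler_wsqrtr // mulrC ler_wpM2r ?ler0n //.
have h : dlt <= 1 - rate k by have := rate_le k; lra.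
by rewrite lef_pV2 // posrE // (lt_le_trans dlt0).
Qed.

Lemma inv_m_radius (r : R) : ((m k)%:R * r ^+ 2)^-1 @[k --> \oo] --> (0 : R).
Proof.
under eq_cvg => k do rewrite invfM mulrC.
by apply: cvg_mulr0; exact: cvg_natrV.
Qed.

Local Notation tol0 := (tol p K rho).

Lemma eigval_gram k i : eigval (gram k) i = ell k 0 i ^+ 2.
Proof.
exact: (eigval_exact K1 rho1 vP (ell0 k) (ellK k) (ellrho k) (orthV k) (gramE k) (gram_sym k)).
Qed.

(** To first order the relative deviation of the eigenvalue is the diagonal entry
    of the error; both coefficient vectors are equal to the same unit vector, so
    the correlation is 1 and the variance factor is 3. *)
Lemma eigval_cdf (i : 'I_n) (x : R) :
  Ex (q k) (fun s => (Num.sqrt ((m k)%:R / (3 * (1 - rate k))) *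
     (eigval (sketched_gram s) i)^-1 * (eigval (sketched_gram s) i - eigval (gram k) i) <= x)%R%:R)
   @[k --> \oo] --> Phi x.
Proof.
pose Z := good_outcome tol0.
have [C C0 hC] := uniform_isO (f := fun k s =>
    (eigval (sketched_gram s) i)^-1 * (eigval (sketched_gram s) i - ell k 0 i ^+ 2) - err s i i)
  (fam_eigval K1 rho1 vP (fun z : Z => err_norm_ge0 (tagged (sval z))) (fun z => svalP z)
    (fun z => err_le (tagged (sval z))) (fun z => ell0 (tag (sval z)))
    (fun z => ellK (tag (sval z))) (fun z => ellrho (tag (sval z)))
    (fun z => orthV (tag (sval z))) (fun z => sketched_gramE (tagged (sval z)))
    (fun z => sketched_gram_sym (tagged (sval z))) i).
pose tau k := Num.sqrt ((m k)%:R / (1 - rate k)) / Num.sqrt (1 + 2 * 1 ^+ 2) : R.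
apply: (cdf_limit (T := fun k s => tau k * gram_err (m k) (U k) (delta i) (delta i) s)).
- by move=> k u; exact: q01.
- apply: (stein_gram_cvg (a := fun=> delta i) (b := fun=> delta i) (r := 1) orthU Umu mu0 _ _ _ moo dlt0).
  + by move=> _; exact: sum_delta_sqr.
  + by move=> _; exact: sum_delta_sqr.
  + by move=> _; under eq_bigr => c _ do rewrite -expr2; exact: sum_delta_sqr.
  + exact: nearW.
apply: (remainder_vanishes (t := @err_norm) (r := fun=> tol0) (B := 3 * (n * n)%:R)
   (C := Num.sqrt dlt^-1 * C) _ moo).
- by move=> k u; exact: q01.
- by apply: nearW => k; exact: Ex_err_norm_sqr.
- exact: err_norm_ge0.
- by apply: nearW => _; exact: tol_gt0.
- exact: inv_m_radius.
apply: nearW => k s sr.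
have tauE : Num.sqrt ((m k)%:R / (3 * (1 - rate k))) = tau k.
  have d0 : 0 <= (m k)%:R / (1 - rate k).
    by rewrite divr_ge0 ?ler0n // subr_ge0 (le_trans (rate_le k)) // gerBl ltW.
  rewrite /tau expr1n mulr1 (_ : 1 + 2 = 3) // -sqrtrV // -sqrtrM //.
  by congr Num.sqrt; rewrite invfM; ring.
have tau_le : tau k <= Num.sqrt dlt^-1 * Num.sqrt (m k)%:R.
  have s3 : 1 <= Num.sqrt (1 + 2 * 1 ^+ 2) :> R.
    by rewrite -[leLHS]sqrtr1 ler_wsqrtr // lerDl mulr_ge0 // sqr_ge0.
  apply: le_trans (scale_le k).
  by rewrite ler_pdivrMr ?(lt_le_trans ltr01) // ler_peMr // sqrtr_ge0.
have tau0 : 0 <= tau k by rewrite divr_ge0 ?sqrtr_ge0.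
have := hC k s sr; rewrite eigval_gram tauE /err mxE -/(err s) => h.
rewrite -mulrA -mulrBr normrM (ger0_norm tau0).
apply: le_trans (ler_pM tau0 (normr_ge0 _) tau_le h) _.
by rewrite le_eqVlt; apply/orP; left; apply/eqP; ring.
Qed.

Variable i : 'I_n.

Local Notation vec k := (v (gram k) i).
Local Notation vech s := (v (sketched_gram s)).
Local Notation lamh s := (eigval (sketched_gram s)).

Definition sgn0 k : R := flip v (V k) (gram k) i.
Definition proj (x : 'cV[R]_n) k (j : 'I_n) : R := ((V k)^T *m x) j 0.

Lemma dotvC (x y : 'cV[R]_n) : dotv x y = dotv y x.
Proof. by rewrite !dotvE; apply: eq_bigr => j _; rewrite mulrC. Qed.

Lemma sum_proj_sqr x k : dotv x x = 1 -> \sum_j proj x k j ^+ 2 = 1.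
Proof.
by move=> <-; rewrite -(dotv_orth _ _ (orthV k)) dotvE; apply: eq_bigr => j _; rewrite expr2.
Qed.

Lemma dotv_vec x k : dotv x (vec k) = sgn0 k * proj x k i.
Proof.
rewrite (eigvec_exact K1 rho1 vP (ell0 k) (ellK k) (ellrho k) (orthV k) (gramE k) (gram_sym k)).
rewrite -/(sgn0 k) dotvE /proj mxE mulr_sumr; apply: eq_bigr => j _; rewrite !mxE; ring.
Qed.

Definition dev_at x k (s : cfg k) : R :=
  \sum_j proj x k j * (ncoords v (V k) (sketched_gram s) i j - (j == i)%:R).
Definition lin_at x k (s : cfg k) : R :=
  \sum_(j | j != i) proj x k j * (coef (ell k) i j * err s j i).
Definition asvar_at x k : R := \sum_(j | j != i) coef (ell k) i j ^+ 2 * proj x k j ^+ 2.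
Definition asvar_hat_at x k (s : cfg k) : R := \sum_(j | j != i)
  lamh s i * lamh s j / (lamh s i - lamh s j) ^+ 2 * dotv x (vech s j) ^+ 2.

(** Aligning the estimated eigenvector with the target amounts to normalizing the
    sign of its diagonal coordinate, as in [ncoords]; if that coordinate vanishes,
    the two conventions may differ. *)
Lemma dotv_sign_align x k (s : cfg k) : coords v (V k) (sketched_gram s) i i != 0 ->
  dotv x (sign_align (vec k) (vech s i) - vec k) = sgn0 k * dev_at x s.
Proof.
move=> nz; set w := sign_align _ _.
have e1 : dotv x w = sgn0 k * \sum_j proj x k j * ncoords v (V k) (sketched_gram s) i j.
  have e0 : \sum_j proj x k j * ncoords v (V k) (sketched_gram s) i j =
     flip v (V k) (sketched_gram s) i * dotv x (vech s i).
    rewrite (dotv_coords v (sketched_gram s) (orthV k)) mulr_sumr; apply: eq_bigr => j _.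
    by rewrite /ncoords mulrCA.
  have h : dotv (vec k) (vech s i) = sgn0 k * coords v (V k) (sketched_gram s) i i.
    by rewrite dotvC dotv_vec.
  rewrite e0 /w /sign_align h /sgn0 /flip -/(coords v (V k) (gram k) i i).
  have [c1|c1] := leP 0 (coords v (V k) (gram k) i i);
  have [c2|c2] := leP 0 (coords v (V k) (sketched_gram s) i i).
  - by rewrite !mul1r c2.
  - by rewrite !mul1r leNgt c2 /= dotvN mulN1r.
  - by rewrite !mulN1r oppr_ge0 leNgt lt_neqAle eq_sym nz c2 /= mul1r dotvN.
  - by rewrite !mulN1r oppr_ge0 ltW // opprK.
rewrite dotvB e1 dotv_vec -mulrBr /dev_at; congr (_ * _).
under [in RHS]eq_bigr => j _ do rewrite mulrBr.
rewrite sumrB; congr (_ - _); rewrite (bigD1 i) //= eqxx mulr1 big1 ?addr0 // => j ji.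
by rewrite (negbTE ji) mulr0.
Qed.

Lemma asvar_hatE x k (s : cfg k) : asvar_hat_at x s = \sum_(j | j != i)
  lamh s i * lamh s j / (lamh s i - lamh s j) ^+ 2 *
    (\sum_c proj x k c * ncoords v (V k) (sketched_gram s) j c) ^+ 2.
Proof.
apply: eq_bigr => j ji; congr (_ * _).
rewrite (dotv_coords v (sketched_gram s) (orthV k)).
have -> : \sum_c proj x k c * ncoords v (V k) (sketched_gram s) j c =
   flip v (V k) (sketched_gram s) j * \sum_c proj x k c * coords v (V k) (sketched_gram s) j c.
  by rewrite mulr_sumr; apply: eq_bigr => c _; rewrite /ncoords mulrCA.
by rewrite exprMn flip_sqr mul1r.
Qed.

(** The differences of the squared singular values are at most [K] times their
    geometric mean, so no weight in the asymptotic variance is small. *)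
Lemma coef_sqr_ge k j : j != i -> K ^- 2 <= coef (ell k) i j ^+ 2.
Proof.
move=> ji; have ei := ell0 k i; have ej := ell0 k j.
have h1 := ellK k i j; have h2 := ellK k j i.
have r2 : 1 < rho ^+ 2 by rewrite exprn_egt1.
set d := ell k 0 i ^+ 2 - ell k 0 j ^+ 2.
have d0 : d != 0.
  rewrite subr_eq0 eqrXn2 ?ltW //.
  have [lt|lt|/ord_inj e] := ltngtP i j; last by rewrite e eqxx in ji.
    by rewrite gt_eqF // (lt_le_trans _ (ellrho k lt)) // ltr_pMl.
  by rewrite lt_eqF // (lt_le_trans _ (ellrho k lt)) // ltr_pMl.
have dle : `|d| <= K * (ell k 0 i * ell k 0 j).
  have g1 : ell k 0 i * ell k 0 i <= ell k 0 i * (K * ell k 0 j) by rewrite ler_pM2l.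
  have g2 : ell k 0 j * ell k 0 j <= ell k 0 j * (K * ell k 0 i) by rewrite ler_pM2l.
  have s1 := sqr_ge0 (ell k 0 i); have s2 := sqr_ge0 (ell k 0 j).
  by rewrite ler_norml /d !expr2 in s1 s2 *; apply/andP; split; nra.
rewrite /coef -/d expr_div_n ler_pdivlMr ?exprn_even_gt0 //.
rewrite mulrC ler_pdivrMr ?exprn_gt0 ?(lt_le_trans ltr01) //.
rewrite -[d ^+ 2]real_normK ?num_real // -exprMn lerXn2r ?nnegrE ?mulr_ge0 ?(ltW ei) ?(ltW ej) //.
  by rewrite (le_trans ler01).
by rewrite mulrC.
Qed.

(** The unit vector keeps a distance from the line of the target, hence some of
    its mass lies on the other eigenvectors. *)
Lemma asvar_ge x k eta0 : dotv x x = 1 -> dotv x (vec k) ^+ 2 <= 1 - eta0 ->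
  eta0 / K ^+ 2 <= asvar_at x k.
Proof.
move=> x1; rewrite dotv_vec exprMn flip_sqr mul1r => h.
have := sum_proj_sqr k x1; rewrite (bigD1 i) //= => hs.
apply: le_trans (_ : (\sum_(j | j != i) proj x k j ^+ 2) / K ^+ 2 <= _).
  by rewrite ler_wpM2r ?invr_ge0 ?sqr_ge0 //; lra.
rewrite mulr_suml; apply: ler_sum => j ji.
by rewrite mulrC ler_wpM2r ?sqr_ge0 // coef_sqr_ge.
Qed.

Section Bounds.
Variable x : 'cV[R]_n.
Hypothesis x1 : dotv x x = 1.
Variable r0 : R.
Hypothesis r0_le : r0 <= tol0.

Local Notation Z := (good_outcome r0).

Let small (z : Z) : err_norm (tagged (sval z)) <= tol0.
Proof. exact: le_trans (svalP z) r0_le. Qed.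

Let sum1 (z : Z) : \sum_j proj x (tag (sval z)) j ^+ 2 = 1.
Proof. exact: sum_proj_sqr. Qed.

Lemma diag_bound : exists2 C : R, 0 < C & forall k (s : cfg k), err_norm s <= r0 ->
  `|ncoords v (V k) (sketched_gram s) i i - 1| <= C * err_norm s ^+ 2.
Proof.
apply: (uniform_isO (f := fun k s => ncoords v (V k) (sketched_gram s) i i - 1)).
exact: (fam_defect K1 rho1 vP (fun z : Z => err_norm_ge0 (tagged (sval z))) small
    (fun z => err_le (tagged (sval z))) (fun z => ell0 (tag (sval z)))
    (fun z => ellK (tag (sval z))) (fun z => ellrho (tag (sval z)))
    (fun z => orthV (tag (sval z))) (fun z => sketched_gramE (tagged (sval z)))
    (fun z => sketched_gram_sym (tagged (sval z))) i).
Qed.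

Lemma dev_bound : exists2 C : R, 0 < C & forall k (s : cfg k), err_norm s <= r0 ->
  `|dev_at x s - lin_at x s| <= C * err_norm s ^+ 2.
Proof.
apply: (uniform_isO (f := fun k s => dev_at x s - lin_at x s)).
exact: (O_dev K1 rho1 vP (fun z : Z => err_norm_ge0 (tagged (sval z))) small
    (fun z => err_le (tagged (sval z))) (fun z => ell0 (tag (sval z)))
    (fun z => ellK (tag (sval z))) (fun z => ellrho (tag (sval z)))
    (fun z => orthV (tag (sval z))) (fun z => sketched_gramE (tagged (sval z)))
    (fun z => sketched_gram_sym (tagged (sval z))) i sum1).
Qed.

Lemma lin_bound : exists2 C : R, 0 < C & forall k (s : cfg k), err_norm s <= r0 ->
  `|lin_at x s| <= C * err_norm s ^+ 1.
Proof.
apply: (uniform_isO (f := fun k s => lin_at x s)).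
exact: (O_lin_dev rho1
    (fun z : Z => err_le (tagged (sval z))) (fun z => ell0 (tag (sval z)))
    (fun z => ellK (tag (sval z))) (fun z => ellrho (tag (sval z))) i sum1).
Qed.

Lemma asvar_bound : exists2 C : R, 0 < C & forall k (s : cfg k), err_norm s <= r0 ->
  `|asvar_hat_at x s - asvar_at x k| <= C * err_norm s ^+ 1.
Proof.
apply: (uniform_isO (f := fun k s => asvar_hat_at x s - asvar_at x k)).
apply: isO_eq (O_asvar K1 rho1 vP (fun z : Z => err_norm_ge0 (tagged (sval z))) small
    (fun z => err_le (tagged (sval z))) (fun z => ell0 (tag (sval z)))
    (fun z => ellK (tag (sval z))) (fun z => ellrho (tag (sval z)))
    (fun z => orthV (tag (sval z))) (fun z => sketched_gramE (tagged (sval z)))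
    (fun z => sketched_gram_sym (tagged (sval z))) i sum1) => z.
by rewrite asvar_hatE.
Qed.

Lemma studentized_bound eta0 : 0 < eta0 ->
  (forall k (s : cfg k), err_norm s <= r0 -> eta0 <= asvar_at x k /\ eta0 <= asvar_hat_at x s) ->
  exists2 C : R, 0 < C & forall k (s : cfg k), err_norm s <= r0 ->
  `|(Num.sqrt (asvar_hat_at x s))^-1 * dev_at x s - (Num.sqrt (asvar_at x k))^-1 * lin_at x s|
     <= C * err_norm s ^+ 2.
Proof.
move=> eta0_gt0 h.
apply: (uniform_isO (f := fun k s => (Num.sqrt (asvar_hat_at x s))^-1 * dev_at x s -
   (Num.sqrt (asvar_at x k))^-1 * lin_at x s)).
have h1 (z : Z) : eta0 <= asvar (fun z : Z => ell (tag (sval z))) i (fun z => proj x (tag (sval z))) z.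
  by have [] := h _ _ (svalP z).
have h2 (z : Z) : eta0 <= asvar_hat v (fun z : Z => V (tag (sval z)))
   (fun z => sketched_gram (tagged (sval z))) i (fun z => proj x (tag (sval z))) z.
  by have [_] := h _ _ (svalP z); rewrite asvar_hatE.
apply: isO_eq (O_studentized K1 rho1 vP (fun z : Z => err_norm_ge0 (tagged (sval z))) small
    (fun z => err_le (tagged (sval z))) (fun z => ell0 (tag (sval z)))
    (fun z => ellK (tag (sval z))) (fun z => ellrho (tag (sval z)))
    (fun z => orthV (tag (sval z))) (fun z => sketched_gramE (tagged (sval z)))
    (fun z => sketched_gram_sym (tagged (sval z))) sum1 eta0_gt0 h1 h2) => z.
by rewrite asvar_hatE.
Qed.

End Bounds.

Lemma inv_m_min (r r' : nat -> R) :
  (\forall k \near \oo, 0 < r k) -> (\forall k \near \oo, 0 < r' k) ->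
  ((m k)%:R * r k ^+ 2)^-1 @[k --> \oo] --> (0 : R) ->
  ((m k)%:R * r' k ^+ 2)^-1 @[k --> \oo] --> (0 : R) ->
  ((m k)%:R * Num.min (r k) (r' k) ^+ 2)^-1 @[k --> \oo] --> (0 : R).
Proof.
move=> r0 r'0 h h'.
have hs : ((m k)%:R * r k ^+ 2)^-1 + ((m k)%:R * r' k ^+ 2)^-1 @[k --> \oo] --> (0 : R).
  by rewrite -[X in _ --> X]addr0; apply: cvgD.
apply: cvg0_near_le hs; near=> k.
have h1 : 0 < r k by near: k.
have h2 : 0 < r' k by near: k.
have p1 : 0 <= ((m k)%:R * r k ^+ 2)^-1 by rewrite invr_ge0 mulr_ge0 ?ler0n ?sqr_ge0.
have p2 : 0 <= ((m k)%:R * r' k ^+ 2)^-1 by rewrite invr_ge0 mulr_ge0 ?ler0n ?sqr_ge0.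
by rewrite minEle; case: ifP => _; rewrite ger0_norm // ?lerDl ?lerDr.
Unshelve. all: by end_near. Qed.

Lemma coords_neq0 : exists2 r0 : R, 0 < r0 <= tol0 & forall k (s : cfg k), err_norm s <= r0 ->
  coords v (V k) (sketched_gram s) i i != 0.
Proof.
have [C C0 hC] := diag_bound (lexx tol0).
have tol0_gt0 : 0 < tol0 by exact: tol_gt0.
exists (Num.min tol0 (2 * C)^-1) => [|k s].
  by rewrite lt_min tol0_gt0 invr_gt0 mulr_gt0 //= ge_min lexx.
rewrite le_min => /andP[st sC]; have t0 := err_norm_ge0 s.
have t1 : err_norm s <= 1 by rewrite (le_trans st) // ge_min lexx.
have h : C * err_norm s ^+ 2 <= 2^-1.
  have : C * err_norm s <= 2^-1 by rewrite -ler_pdivlMl // -invfM mulrC.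
  by apply: le_trans; rewrite ler_wpM2l ?(ltW C0) // expr2 ler_piMl.
apply/negP => /eqP c0; have := hC k s st.
rewrite /ncoords c0 mulr0 sub0r normrN1; lra.
Qed.

Definition studentized x k (s : cfg k) (w : 'cV[R]_n) : R :=
  Num.sqrt ((m k)%:R / (1 - rate k)) * (Num.sqrt (asvar_hat_at x s))^-1 * dotv x (w - vec k).

(** To first order the deviation is the error form at the unit vector [delta i] and
    at [bvec], which has norm one by the choice of the variance and is orthogonal
    to [delta i]: the correlation is 0 and the variance factor is 1. *)
Lemma studentized_cdf x eta0 (w : forall k, cfg k -> 'cV[R]_n) (r : nat -> R) :
  dotv x x = 1 -> 0 < eta0 -> (forall k, dotv x (vec k) ^+ 2 <= 1 - eta0) ->
  (\forall k \near \oo, 0 < r k) ->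
  ((m k)%:R * r k ^+ 2)^-1 @[k --> \oo] --> (0 : R) ->
  (\forall k \near \oo, forall s : cfg k, err_norm s <= r k ->
     w k s = sign_align (vec k) (vech s i)) ->
  forall y : R, Ex (q k) (fun s => (studentized x s (w k s) <= y)%R%:R) @[k --> \oo] --> Phi y.
Proof.
move=> x1 eta0_gt0 sep r_gt0 mr wE y.
have [r1 /andP[r1_gt0 r1_tol] nz] := coords_neq0.
have [C1 C1_gt0 hC1] := asvar_bound x1 (lexx tol0).
have K0 : 0 < K by exact: lt_le_trans K1.
pose eta1 := eta0 / K ^+ 2 / 2.
have eta1_gt0 : 0 < eta1 by rewrite !divr_gt0 ?exprn_gt0.
pose r0 := Num.min r1 (eta1 / C1).
have r0_gt0 : 0 < r0 by rewrite lt_min r1_gt0 divr_gt0.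
have r0_r1 : r0 <= r1 by rewrite ge_min lexx.
have r0_tol : r0 <= tol0 by exact: le_trans r1_tol.
have as_ge k : 2 * eta1 <= asvar_at x k.
  by rewrite mulrC divfK //; exact: asvar_ge.
have as_both k (s : cfg k) : err_norm s <= r0 -> eta1 <= asvar_at x k /\ eta1 <= asvar_hat_at x s.
  move=> sr; have := hC1 k s (le_trans sr r0_tol).
  have : C1 * err_norm s <= eta1.
    by rewrite mulrC -ler_pdivlMr // (le_trans sr) // ge_min lexx orbT.
  have := as_ge k; rewrite expr1 ler_norml => h1 h2 /andP[h3 h4].
  by split; lra.
have [C C0 hC] := studentized_bound x1 r0_tol eta1_gt0 as_both.
have as_gt0 k : 0 < asvar_at x k by apply: lt_le_trans (as_ge k); rewrite mulr_gt0.
pose bvec k (c : 'I_n) : R := if c == i then 0 else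
  sgn0 k * (Num.sqrt (asvar_at x k))^-1 * (proj x k c * coef (ell k) i c).
pose tau k : R := Num.sqrt ((m k)%:R / (1 - rate k)) / Num.sqrt (1 + 2 * 0 ^+ 2).
have gram_b k (s : cfg k) : gram_err (m k) (U k) (bvec k) (delta i) s =
   sgn0 k * ((Num.sqrt (asvar_at x k))^-1 * lin_at x s).
  rewrite gram_errE mulrA /lin_at mulr_sumr [RHS]big_mkcond /=; apply: eq_bigr => c _.
  rewrite (bigD1 i) //= big1 ?addr0 => [|c' ci]; last first.
    by rewrite /delta (negbTE ci) mulr0 mul0r.
  rewrite /delta eqxx mulr1 /bvec; case: eqP => _ /=; first by rewrite mul0r.
  by rewrite /err mxE -!mulrA.
apply: (cdf_limit (T := fun k s => tau k * gram_err (m k) (U k) (bvec k) (delta i) s)).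
- by move=> k u; exact: q01.
- apply: (stein_gram_cvg (a := bvec) (b := fun=> delta i) (r := 0) orthU Umu mu0 _ _ _ moo dlt0).
  + move=> k; rewrite (bigD1 i) //= {1}/bvec eqxx expr0n add0r.
    transitivity ((asvar_at x k)^-1 * asvar_at x k); last by rewrite mulVf // gt_eqF.
    rewrite {2}/asvar_at mulr_sumr; apply: eq_bigr => c ci.
    rewrite /bvec (negbTE ci) !exprMn flip_sqr mul1r exprVn sqr_sqrtr ?(ltW (as_gt0 k)) //.
    by ring.
  + by move=> _; exact: sum_delta_sqr.
  + move=> k; rewrite big1 // => c _; rewrite /bvec /delta.
    by case: eqP => _; rewrite ?mul0r ?mulr0.
  + exact: nearW.
apply: (remainder_vanishes (t := @err_norm) (r := fun k => Num.min (r k) r0) (B := 3 * (n * n)%:R)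
   (C := Num.sqrt dlt^-1 * C) _ moo).
- by move=> k u; exact: q01.
- by apply: nearW => k; exact: Ex_err_norm_sqr.
- exact: err_norm_ge0.
- by apply: filterS r_gt0 => k rk; rewrite lt_min rk r0_gt0.
- by apply: inv_m_min => //; [exact: nearW|exact: inv_m_radius].
apply: filterS wE => k wk s; rewrite le_min => /andP[sr sr0].
have -> : tau k = Num.sqrt ((m k)%:R / (1 - rate k)).
  by rewrite /tau expr0n /= mulr0 addr0 sqrtr1 divr1.
rewrite gram_b /studentized (wk s sr) dotv_sign_align; last by apply: nz; exact: le_trans sr0 r0_r1.
set sc := Num.sqrt _.
have -> : sc * (Num.sqrt (asvar_hat_at x s))^-1 * (sgn0 k * dev_at x s) -
    sc * (sgn0 k * ((Num.sqrt (asvar_at x k))^-1 * lin_at x s)) =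
    sgn0 k * (sc * ((Num.sqrt (asvar_hat_at x s))^-1 * dev_at x s -
      (Num.sqrt (asvar_at x k))^-1 * lin_at x s)) by ring.
have sg1 : `|sgn0 k| = 1 by rewrite /sgn0 /flip; case: ifP; rewrite ?normrN1 ?normr1.
rewrite normrM sg1 mul1r normrM (ger0_norm (sqrtr_ge0 _)).
apply: le_trans (ler_pM (sqrtr_ge0 _) (normr_ge0 _) (scale_le k) (hC k s sr0)) _.
by rewrite le_eqVlt; apply/orP; left; apply/eqP; ring.
Qed.

(** The first coordinate of the estimated eigenvector differs from that of the
    target by a term of the order of the error. As long as this is less than the
    first coordinate of the target, the aligned vector has a positive first
    coordinate, and so it is the one selected by the sign convention. *)
Lemma sign_resolved :
  Num.sqrt (m k)%:R * vec k ord0 0 @[k --> \oo] --> +oo ->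
  exists r : nat -> R, [/\ \forall k \near \oo, 0 < r k,
    ((m k)%:R * r k ^+ 2)^-1 @[k --> \oo] --> (0 : R) &
    \forall k \near \oo, forall s : cfg k, err_norm s <= r k ->
      vech s i = sign_align (vec k) (vech s i)].
Proof.
move=> big; have [r1 /andP[r1_gt0 r1_tol] nz] := coords_neq0.
pose x : 'cV[R]_n := \col_j (j == ord0)%:R.
have xE (z : 'cV[R]_n) : dotv x z = z ord0 0.
  rewrite dotvE (bigD1 ord0) //= mxE eqxx mul1r big1 ?addr0 // => j j0.
  by rewrite mxE (negbTE j0) mul0r.
have x1 : dotv x x = 1 by rewrite xE mxE eqxx.
have [C1 C1_gt0 hC1] := dev_bound x1 r1_tol.
have [C2 C2_gt0 hC2] := lin_bound x1 r1.
pose C := C1 + C2; have C_gt0 : 0 < C by rewrite addr_gt0.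
have vec_gt0 : \forall k \near \oo, 0 < vec k ord0 0.
  have : \forall k \near \oo, 0 < Num.sqrt (m k)%:R * vec k ord0 0 by move/cvgryPgt: big; exact.
  by apply: filterS => k; rewrite pmulr_rgt0 // sqrtr_gt0 ltr0n m_gt0.
have lim0 : ((m k)%:R * (vec k ord0 0 / (2 * C)) ^+ 2)^-1 @[k --> \oo] --> (0 : R).
  have hV : (Num.sqrt (m k)%:R * vec k ord0 0)^-1 @[k --> \oo] --> (0 : R).
    apply/gtr0_cvgV0 => //; move/cvgryPgt: big; exact.
  have hVV : (Num.sqrt (m k)%:R * vec k ord0 0)^-1 * (Num.sqrt (m k)%:R * vec k ord0 0)^-1
      @[k --> \oo] --> (0 : R).
    by rewrite -[X in _ --> X](mulr0 (0 : R)); apply: cvgM.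
  apply: cvg_trans (cvg_mulr0 ((2 * C) ^+ 2) hVV); apply: near_eq_cvg; near=> k.
  have vk : 0 < vec k ord0 0 by near: k.
  have mk : Num.sqrt (m k)%:R != 0 :> R by rewrite gt_eqF // sqrtr_gt0 ltr0n m_gt0.
  have e2 : (m k)%:R = Num.sqrt (m k)%:R ^+ 2 :> R by rewrite sqr_sqrtr ?ler0n.
  rewrite [in RHS]e2.
  by field; rewrite mk !gt_eqF.
exists (fun k => Num.min r1 (vec k ord0 0 / (2 * C))); split.
- by apply: filterS vec_gt0 => k vk; rewrite lt_min r1_gt0 divr_gt0 // mulr_gt0.
- apply: inv_m_min => //; [exact: nearW| |exact: inv_m_radius].
  by apply: filterS vec_gt0 => k vk; rewrite divr_gt0 // mulr_gt0.
apply: filterS vec_gt0 => k vk s; rewrite le_min => /andP[sr1 srC].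
have t0 := err_norm_ge0 s.
have t1 : err_norm s <= 1 by rewrite (le_trans sr1) // (le_trans r1_tol) // ge_min lexx.
have hdev : `|dev_at x s| <= C * err_norm s.
  have -> : dev_at x s = (dev_at x s - lin_at x s) + lin_at x s by rewrite subrK.
  apply: le_trans (ler_normD _ _) _; rewrite mulrDl lerD //; last by rewrite -[err_norm s]expr1; exact: hC2.
  apply: le_trans (hC1 k s sr1) _; rewrite ler_wpM2l ?(ltW C1_gt0) // expr2 ler_piMl //.
have := dotv_sign_align x (nz k s sr1); rewrite xE !mxE => hw.
have sg1 : `|sgn0 k| = 1 by rewrite /sgn0 /flip; case: ifP; rewrite ?normrN1 ?normr1.
have hd2 : `|sgn0 k * dev_at x s| <= vec k ord0 0 / 2.
  rewrite normrM sg1 mul1r (le_trans hdev) // mulrC -ler_pdivlMr //.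
  by rewrite -mulrA -invfM.
have w_gt0 : 0 < sign_align (vec k) (vech s i) ord0 0.
  by move: hd2; rewrite -hw ler_norml => /andP[]; lra.
have [_ _ [j [vj lt0]]] := vP i (sketched_gram_sym s).
have vh0 : 0 <= vech s i ord0 0.
  have [j0|j0] := posnP j; last by rewrite lt0.
  by rewrite (_ : ord0 = j) ?ltW //; apply/val_inj.
rewrite /sign_align in w_gt0 *; case: ifP w_gt0 => // _.
by rewrite mxE oppr_gt0 ltNge vh0.
Unshelve. all: by end_near. Qed.

End SketchedSpectrum.

(** * The limit theorem *)

Section Law.
Variables (R : realType) (l m : nat -> nat).
Variables (d : nat -> measure_display) (T : forall k, measurableType (d k)).
Variables (P : forall k, probability (T k) R) (g : nat -> R).
Variables (b e : forall k, 'I_(2 ^ l k) -> {RV (P k) >-> R}).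
Arguments b : clear implicits.
Arguments e : clear implicits.
Hypothesis dbe : forall k, srht_diagonals (g k) (b k) (e k).

Lemma srht_signs k w :
  srht (m k) (\row_j b k j w) (\row_j e k j w) = srht_of R (m k) (signs (b k) (e k) w).
Proof.
have [hb he _] := dbe k; rewrite /srht_of; congr srht; apply/rowP => j; rewrite !mxE.
  have [hw _ _] := hb j; rewrite /signs ffunE.
  by case: (hw w) => ->; rewrite ?eqxx // eq_sym oner_eq0.
have [hw _ _] := he j; rewrite /sgn /signs ffunE.
have n1 : (-1 == 1 :> R) = false by apply/negbTE; rewrite -subr_eq0; apply/eqP; lra.
by case: (hw w) => ->; rewrite ?eqxx ?n1.
Qed.

Lemma cvg_in_law_signs (Y : forall k, T k -> R)
    (S : forall k, {ffun 'I_(2 ^ l k) + 'I_(2 ^ l k) -> bool} -> R) :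
  (forall k w, Y k w = S k (signs (b k) (e k) w)) ->
  (forall y, Ex (@qs R (2 ^ l k) (g k)) (fun s => (S k s <= y)%R%:R) @[k --> \oo] --> Phi y) ->
  cvg_in_law P Y (normal_prob 0 1).
Proof.
move=> YS h; split=> [k|y _].
  rewrite (_ : Y k = fun w => S k (signs (b k) (e k) w)); last by apply/funext => w.
  exact: (measurable_fun_signs (dbe k)).
rewrite [X in _ --> X](Phi_fin y).
have eP k : P k [set w | Y k w <= y] = (Ex (@qs R (2 ^ l k) (g k)) (fun s => (S k s <= y)%R%:R))%:E.
  rewrite -(prob_signs_in (dbe k) (fun s => S k s <= y)); congr (P k _).
  by apply/seteqP; split => w /=; rewrite YS.
under eq_cvg => k do rewrite eP.
by apply: cvg_EFin; [exact: nearW|exact: h].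
Qed.

End Law.

Theorem mainTheorem5 (R : realType) (p : nat)
    (* the sequence of pairs (n, m) = (2 ^ l k, m k) *)
    (l m : nat -> nat)
    (* the data and their SVD; there are p.+1 columns *)
    (X U : forall k, 'M[R]_(2 ^ l k, p.+1))
    (ell : nat -> 'rV[R]_p.+1) (V : nat -> 'M[R]_p.+1)
    (* the selection of eigenvectors *)
    (v : 'M[R]_p.+1 -> 'I_p.+1 -> 'cV[R]_p.+1)
    (* the random diagonals *)
    (d : nat -> measure_display) (T : forall k, measurableType (d k))
    (P : forall k, probability (T k) R)
    (b e : forall k, 'I_(2 ^ l k) -> {RV (P k) >-> R}) :
  let gamma (k : nat) : R := (m k)%:R / (2 ^ l k)%:R in
  let Smn (k : nat) (w : T k) : 'M[R]_(2 ^ l k) :=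
    srht (m k) (\row_j b k j w) (\row_j e k j w) in
  let Lam (k : nat) (i : 'I_p.+1) : R := eigval ((X k)^T *m X k) i in
  let vec (k : nat) (i : 'I_p.+1) : 'cV[R]_p.+1 := v ((X k)^T *m X k) i in
  let Lamh (k : nat) (i : 'I_p.+1) (w : T k) : R :=
    eigval ((X k)^T *m (Smn k w)^T *m Smn k w *m X k) i in
  let vech (k : nat) (i : 'I_p.+1) (w : T k) : 'cV[R]_p.+1 :=
    v ((X k)^T *m (Smn k w)^T *m Smn k w *m X k) i in
  let stat (k : nat) (i : 'I_p.+1) (c : 'cV[R]_p.+1) (w : T k)
      (u : 'cV[R]_p.+1) : R :=
    Num.sqrt ((m k)%:R / (1 - gamma k)) *
    (Num.sqrt (\sum_(j | j != i)
       Lamh k i w * Lamh k j w / (Lamh k i w - Lamh k j w) ^+ 2 *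
       dotv c (vech k j w) ^+ 2))^-1 *
    dotv c (u - vec k i) in
  eigvec_choice v ->
  (forall k, (U k)^T *m U k = 1%:M) ->
  (forall k, (V k)^T *m V k = 1%:M) ->
  (forall k (i j : 'I_p.+1), (i <= j)%N -> ell k 0 j <= ell k 0 i) ->
  (forall k (i : 'I_p.+1), 0 < ell k 0 i) ->
  (forall k, X k = U k *m diag_mx (ell k) *m (V k)^T) ->
  (limn_esup (fun k => (ell k 0 ord0 / ell k 0 ord_max)%:E) < +oo)%E ->
  (1 < limn_einf (fun k => \big[Order.min/+oo]_(i < p)
         (ell k 0 (inord i) / ell k 0 (inord i.+1))%:E))%E ->
  (\big[Num.max/0]_(j < 2 ^ l k) norm2 (row j (U k))) @[k --> \oo] --> 0 ->
  (forall k, srht_diagonals (gamma k) (b k) (e k)) ->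
  (2 ^ l k)%N @[k --> \oo] --> \oo ->
  m k @[k --> \oo] --> \oo ->
  ((m k)%:R / ln (2 ^ l k)%:R ^+ 2 : R) @[k --> \oo] --> +oo ->
  (limn_esup (fun k => (gamma k)%:E) < 1)%E ->
  forall i : 'I_p.+1,
    cvg_in_law P (fun k w =>
        Num.sqrt ((m k)%:R / (3 * (1 - gamma k))) *
        (Lamh k i w)^-1 * (Lamh k i w - Lam k i))
      (normal_prob 0 1)
    /\
    forall c : 'cV[R]_p.+1, dotv c c = 1 ->
      (limn_esup (fun k => (dotv c (vec k i) ^+ 2)%:E) < 1)%E ->
      (* the sign of the estimated eigenvector is fixed by that of the target *)
      cvg_in_law P (fun k w => stat k i c w (sign_align (vec k i) (vech k i w)))
        (normal_prob 0 1)
      /\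
      (* no adjustment, when the first coordinate of the target, which the sign
         convention makes nonnegative, is large compared with m^(-1/2) *)
      ((Num.sqrt (m k)%:R * vec k i ord0 0) @[k --> \oo] --> +oo ->
       cvg_in_law P (fun k w => stat k i c w (vech k i w)) (normal_prob 0 1)).
Proof.
move=> gamma Smn Lam vec Lamh vech stat vP orthU orthV mono ell0 svdX hK hgap hmu hdiag _ moo _ hg i.
have [K0 hK0] := limn_esup_lt_pinfty hK.
have [rho1 rho1_gt1 hrho] := limn_einf_gt1 (y := fun k j => ell k 0 (inord j) / ell k 0 (inord j.+1)) hgap.
have [dlt dlt0 hdlt] := limn_esup_lt1 hg.
have m_gt0 : \forall k \near \oo, (0 < m k)%N := moo _ (nbhs_infty_gt 0).
(* The expansions ask for a ratio [rho ^+ 2] between consecutive singular values. *)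
pose K := Num.max 1 K0; pose rho := Num.sqrt rho1.
have K1 : 1 <= K by rewrite le_max lexx.
have rho_gt1 : 1 < rho by rewrite -sqrtr1 ltr_sqrt // (lt_trans ltr01).
have rho2 : rho ^+ 2 = rho1 by rewrite sqr_sqrtr // ltW // (lt_trans ltr01).
pose mu k : R := \big[Num.max/0]_(j < 2 ^ l k) norm2 (row j (U k)).
have Umu k j : norm2 (row j (U k)) <= mu k by apply: (le_bigmax _ (fun j => norm2 (row j (U k)))).
have [N0 _ good] : \forall k \near \oo, [/\ (0 < m k)%N, gamma k <= 1 - dlt,
    forall j j', ell k 0 j <= K * ell k 0 j' &
    forall j j' : 'I_p.+1, (j < j')%N -> rho ^+ 2 * ell k 0 j' <= ell k 0 j].
  near=> k; split; [by near: k|by near: k| |].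
    move=> j j'; have hk : ell k 0 ord0 / ell k 0 ord_max <= K0 by near: k.
    rewrite ler_pdivrMr // in hk.
    apply: le_trans (mono k ord0 j (leq0n _)) _; apply: le_trans hk _.
    apply: le_trans (_ : K * ell k 0 ord_max <= _).
      by rewrite ler_wpM2r ?(ltW (ell0 _ _)) // le_max lexx orbT.
    by rewrite ler_wpM2l ?(le_trans ler01) //; apply: mono; rewrite -ltnS.
  move=> j j' jj'; have hk : forall a : 'I_p, rho1 <= ell k 0 (inord a) / ell k 0 (inord a.+1) by near: k.
  have jp : (j < p)%N by rewrite (leq_trans jj') // -ltnS.
  have := hk (Ordinal jp); rewrite /= ler_pdivlMr // inord_val rho2 => h.
  apply: le_trans h; rewrite ler_wpM2l ?(ltW (lt_trans ltr01 rho1_gt1)) //.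
  by apply: mono; rewrite inordK.
(* From now on the sequences are shifted, so that the conditions hold for all
   indices. *)
have SmnE k w : Smn k w = srht_of R (m k) (signs (b k) (e k) w) by exact: srht_signs.
have shift_mu N : mu (k + N)%N @[k --> \oo] --> (0 : R) by rewrite (cvg_shiftn N mu).
have shift_m N : m (k + N)%N @[k --> \oo] --> \oo by rewrite (cvg_shiftn N m).
have good_from N k : (N0 <= N)%N -> _ := fun hN => good (k + N)%N (leq_trans hN (leq_addl k N)).
have gram_mul k (s : {ffun 'I_(2 ^ l k) + 'I_(2 ^ l k) -> bool}) :
  (X k)^T *m (srht_of R (m k) s)^T *m srht_of R (m k) s *m X k = sketched_gram m X s by [].
split.
  apply: (cvg_in_law_signs (S := fun k s => Num.sqrt ((m k)%:R / (3 * (1 - gamma k))) *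
      (eigval (sketched_gram m X s) i)^-1 * (eigval (sketched_gram m X s) i - Lam k i)) hdiag).
    by move=> k w; rewrite /Lamh SmnE.
  move=> y; rewrite -(cvg_shiftn N0).
  have [gm gr gK grho] : [/\ forall k, (0 < m (k + N0))%N, forall k, gamma (k + N0)%N <= 1 - dlt,
     forall k j j', ell (k + N0)%N 0 j <= K * ell (k + N0)%N 0 j' &
     forall k (j j' : 'I_p.+1), (j < j')%N -> rho ^+ 2 * ell (k + N0)%N 0 j' <= ell (k + N0)%N 0 j].
    by split=> k; have [] := good_from N0 k (leqnn _).
  exact: (eigval_cdf K1 rho_gt1 dlt0 vP (fun k => orthU (k + N0)%N) (fun k => orthV (k + N0)%N)
    (fun k => ell0 (k + N0)%N) gK grho (fun k => svdX (k + N0)%N) (fun k => Umu (k + N0)%N)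
    (shift_mu N0) gm (shift_m N0) gr i).
move=> c c1 /limn_esup_lt1[eta0 eta0_gt0 [N1 _ hsep]].
pose N := maxn N0 N1; have N0N : (N0 <= N)%N by exact: leq_maxl.
have sep k : dotv c (v (gram X (k + N)%N) i) ^+ 2 <= 1 - eta0.
  by apply: hsep => /=; rewrite (leq_trans (leq_maxr N0 N1)) // leq_addl.
have [gm gr gK grho] : [/\ forall k, (0 < m (k + N))%N, forall k, gamma (k + N)%N <= 1 - dlt,
   forall k j j', ell (k + N)%N 0 j <= K * ell (k + N)%N 0 j' &
   forall k (j j' : 'I_p.+1), (j < j')%N -> rho ^+ 2 * ell (k + N)%N 0 j' <= ell (k + N)%N 0 j].
  by split=> k; have [] := good_from N k N0N.
have cdf := studentized_cdf K1 rho_gt1 dlt0 vP (fun k => orthU (k + N)%N) (fun k => orthV (k + N)%N)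
  (fun k => ell0 (k + N)%N) gK grho (fun k => svdX (k + N)%N) (fun k => Umu (k + N)%N)
  (shift_mu N) gm (shift_m N) gr c1 eta0_gt0 sep.
have statE k w u : stat k i c w u = studentized v m X i c (signs (b k) (e k) w) u.
  by rewrite /stat /Lamh /vech SmnE.
split.
  apply: (cvg_in_law_signs (S := fun k s => studentized v m X i c s
     (sign_align (vec k i) (v (sketched_gram m X s) i))) hdiag).
    by move=> k w; rewrite statE /vech SmnE.
  move=> y; rewrite -(cvg_shiftn N).
  apply: (cdf (fun k s => sign_align (v (gram X (k + N)%N) i)
     (v (sketched_gram (fun k => m (k + N)%N) (fun k => X (k + N)%N) s) i)) (fun=> 1)) => //.
  - exact: nearW.
  - exact: (inv_m_radius (m := fun k => m (k + N)%N)).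
  - exact: nearW.
move=> big.
have bigN : Num.sqrt (m (k + N)%N)%:R * v (gram X (k + N)%N) i ord0 0 @[k --> \oo] --> +oo.
  by rewrite (cvg_shiftn N (fun k => Num.sqrt (m k)%:R * v (gram X k) i ord0 0)).
have [r [r0 mr hr]] := sign_resolved K1 rho_gt1 vP (fun k => orthU (k + N)%N) (fun k => orthV (k + N)%N)
  (fun k => ell0 (k + N)%N) gK grho (fun k => svdX (k + N)%N) gm (shift_m N) bigN.
apply: (cvg_in_law_signs (S := fun k s => studentized v m X i c s (v (sketched_gram m X s) i)) hdiag).
  by move=> k w; rewrite statE /vech SmnE.
move=> y; rewrite -(cvg_shiftn N).
exact: (cdf (fun k s => v (sketched_gram (fun k => m (k + N)%N) (fun k => X (k + N)%N) s) i) r).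
Unshelve. all: by end_near. Qed.
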